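(* Let $G$ be a maximal planar graph on $n\ge 47$ vertices. Then $lpsr(G)\le \frac{n+7}{3n-6}$, where $lpsr(G)$ is the labeled plane-saturation ratio of $G$.
   Context: All graphs are finite and simple. A plane graph is a planar graph together with a specific plane embedding: vertices are mapped to distinct points of $\mathbb{R}^2$ and edges to simple topological curves joining their endpoints, where no two curves intersect, overlap or touch except possibly at common endpoints. A maximal planar graph on $n\ge 3$ vertices is a planar graph to which no edge can be added while keeping it simple and planar; it has $3n-6$ edges. Let $e(\cdot)$ denote the number of edges. Labeled plane-saturated subgraph: a plane graph $H=(V',E')$ with labeled vertices is a labeled plane-saturated subgraph of $G=(V,E)$ if $V'=V$, $E'\subseteq E$, and no edge of $E\setminus E'$ can be added to the drawing of $H$ (as a curve joining the two correspondingly labeled vertices) without introducing a crossing. The embedding of $H$ is arbitrary and need not extend to an embedding of $G$. The labeled plane-saturation ratio is $lpsr(G)=\min\{\frac{e(H)}{e(G)} : H \text{ is a labeled plane-saturated subgraph of } G\}$. *)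

(* Defs.v *)
From HB Require Import structures.
From mathcomp Require Import all_boot all_order all_algebra.
From mathcomp Require Import all_classical all_reals all_analysis.

Set Implicit Arguments.
Unset Strict Implicit.
Unset Printing Implicit Defensive.

Import Order.TTheory GRing.Theory Num.Theory.
Import numFieldNormedType.Exports.

Local Open Scope classical_set_scope.
Local Open Scope ring_scope.

(* A finite simple graph on the vertex type T is given by its set of edges,
   an edge being the set of its two endpoints. Since the vertices are the
   elements of T, they are labeled, and a spanning subgraph is a subset of
   the edge set. *)
Definition simple_graph (T : finType) (E : {set {set T}}) : Prop :=
  forall e : {set T}, e \in E -> #|e| = 2%N.

Definition simple_curve (R : realType) (c : R -> R * R) : Prop :=
  {within `[0, 1], continuous c} /\ {in `[0, 1] &, injective c}.

Definition trace (R : realType) (c : R -> R * R) : set (R * R) :=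
  c @` `[0, 1].

(* Only the values of arc on E matter. The third condition, that no edge runs
   through a vertex other than its endpoints, follows from the fourth one
   except for vertices of degree zero. *)
Definition plane_drawing (R : realType) (T : finType) (E : {set {set T}})
    (pos : T -> R * R) (arc : {set T} -> R -> R * R) : Prop :=
  [/\ injective pos,
      forall e : {set T}, e \in E -> simple_curve (arc e) /\
        exists u v, [/\ e = [set u; v]%SET, arc e 0 = pos u & arc e 1 = pos v],
      forall (e : {set T}) v, e \in E -> trace (arc e) (pos v) -> v \in e
    & forall e f : {set T}, e \in E -> f \in E -> e != f ->
        trace (arc e) `&` trace (arc f) `<=` pos @` [set` (e :&: f)%SET]].

Definition planar (R : realType) (T : finType) (E : {set {set T}}) : Prop :=
  exists pos arc, @plane_drawing R T E pos arc.

Definition maximal_planar (R : realType) (T : finType)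
    (E : {set {set T}}) : Prop :=
  [/\ simple_graph E, planar R E
    & forall e : {set T}, #|e| = 2%N -> e \notin E -> ~ planar R (e |: E)%SET].

Definition labeled_plane_saturated (R : realType) (T : finType)
    (E H : {set {set T}}) (pos : T -> R * R)
    (arc : {set T} -> R -> R * R) : Prop :=
  [/\ H \subset E, plane_drawing H pos arc
    & forall e : {set T}, e \in (E :\: H)%SET ->
        ~ exists c : R -> R * R,
            plane_drawing (e |: H)%SET pos [eta arc with e |-> c]].

(* The minimum ranges over finitely many edge sets H. The ratios are at most
   1, so the initial value 1 does not affect it. *)
Definition lpsr (R : realType) (T : finType) (E : {set {set T}}) : R :=
  \big[Num.min/1]_(H : {set {set T}} |
      `[< exists pos arc, @labeled_plane_saturated R T E H pos arc >])
    (#|H|%:R / #|E|%:R).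

(* Main.v *)
(**
  Let n = |T|. A maximal planar graph has exactly 3n - 6 edges, so it suffices
  to draw a saturated plane subgraph H with at most n + 7 edges. Draw a small
  subgraph of E, the frame, with straight lines so that it has five marked
  regions, and place all other vertices as isolated points inside these regions,
  one class of a proper 5-colouring per region. Saturate the drawing greedily.
  An edge of H cannot leave a region, and the classes are independent, so
  every new edge has an end on the frame; averaging over the cyclic shifts of
  the colours and using the bound 2n - 4 for bipartite planar graphs, some
  choice of the regions gives few edges. There is a vertex v of degree 4 to 11.
  If its degree is at least 6, the frame is a fan of five triangles at v; if it
  is 5, the wheel at v. If it is 4, the frame is the wheel at v with one more
  triangle: one disjoint from the wheel, or, if some neighbour p of v has
  degree at least 16, a triangle p x y drawn inside a face of the wheel.

  The combinatorics of planarity is extracted from topology as follows. A plane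
  drawing is turned into a drawing on a fine square lattice and conversely. In
  the lattice, crossing parities with an even subgraph 2-colour the cells, and
  this yields at each vertex a rotation for which every even subgraph is a
  boundary modulo 2. Euler's formula, the bounds on the number of edges, the
  impossibility of crossing disjoint paths (hence the Kempe chain argument) and,
  for a maximal planar graph, the fact that all faces are triangles follow by
  linear algebra modulo 2.
*)
Require Import Defs.
From HB Require Import structures.
From mathcomp Require Import all_boot all_order all_algebra perm.
From mathcomp Require Import zify ring lra.
From mathcomp Require Import boolp.

Set Implicit Arguments.
Unset Strict Implicit.
Unset Printing Implicit Defensive.

(** The count behind the bound: from the hub up to five regions are visible, from every other frame
    vertex at most two. On average over the five shifts, the edges leaving the frame therefore
    number at most the outer degree of the hub plus two fifths of the at most 2n - 4 edges leaving
    the rest of the frame. This is about 4n/5 if the degree of the hub is bounded, and the remaining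
    n/5 pays for the hub and for the edges inside the frame. Degree 4 is the hard case: the wheel
    has only four triangles for five colours. A fifth one disjoint from it may be missing if a
    neighbour [p] of the hub has large degree; with a triangle [p x y] instead, [p] sees three
    regions, which consumes the spare n/5, and this case fixes the constant 7. The Jordan curve
    theorem is avoided: the only closed curves needed in the final drawing are straight triangles,
    where the intermediate value theorem suffices, and on the lattice the parity of crossings of a
    ray takes its place. Rotations of subgraphs come from restricted drawings, not from the rotation
    of the whole graph. *)

(* Planarity modulo 2. Every even subgraph [z] is the boundary of a set of
   faces: [F u v] is the value of the face on one fixed side of the dart
   (u, v); the value jumps across the edges of [z], and the darts (u, v) and
   (v, next (rot v) u) lie on the same face. *)
Definition planar_rot (T : finType) (e : rel T) (rot : T -> seq T) : Prop :=
  [/\ forall v, uniq (rot v), forall v u, (u \in rot v) = e v u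
    & forall z : rel T, symmetric z -> subrel z e ->
        (forall v, ~~ odd #|[set u | z v u]|) ->
        exists F : T -> T -> bool, forall u v, e u v ->
          F v u = F u v (+) z u v /\ F v (next (rot v) u) = F u v].

Lemma big_addb_odd (I : finType) (P : pred I) (F : I -> bool) :
  \big[addb/false]_(i | P i) F i = odd (\sum_(i | P i) F i)%N.
Proof.
rewrite (big_morph odd oddD (erefl : odd 0 = false)).
by apply: eq_bigr => i _; case: (F i).
Qed.

Definition erel (T : finType) (E : {set {set T}}) : rel T :=
  fun x y => (x != y) && ([set x; y] \in E).

Lemma erel_sym (T : finType) (E : {set {set T}}) : symmetric (erel E).
Proof. by move=> x y; rewrite /erel eq_sym setUC. Qed.

Lemma erel_irr (T : finType) (E : {set {set T}}) : irreflexive (erel E).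
Proof. by move=> x; rewrite /erel eqxx. Qed.

(** * Even subgraphs *)

Definition symd (T : finType) (A B : {set T}) : {set T} := [set x | (x \in A) (+) (x \in B)].

Lemma odd_card (T : finType) (A : {set T}) : odd #|A| = \big[addb/false]_x (x \in A).
Proof. by rewrite -sum1_card big_mkcond big_addb_odd; congr odd; apply: eq_bigr => x _; case: ifP. Qed.

Lemma odd_symd (T : finType) (A B : {set T}) : odd #|symd A B| = odd #|A| (+) odd #|B|.
Proof. by rewrite !odd_card -big_split /=; apply: eq_bigr => x _; rewrite inE. Qed.

Lemma symdA (T : finType) (A B C : {set T}) : symd A (symd B C) = symd (symd A B) C.
Proof. by apply/setP => x; rewrite !inE addbA. Qed.

Lemma symdK (T : finType) (A B : {set T}) : symd (symd A B) B = A.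
Proof. by apply/setP => x; rewrite !inE addbK. Qed.

Lemma symd_sub (T : finType) (A B C : {set T}) : A \subset C -> B \subset C -> symd A B \subset C.
Proof.
move=> /subsetP a /subsetP b; apply/subsetP => x; rewrite inE.
by case xA : (x \in A); [rewrite a|case xB : (x \in B) => //; rewrite b].
Qed.

Section Parity.
Variable T : finType.
Implicit Types (Z E : {set {set T}}).

Definition par Z : {set T} := [set v | odd #|[set e in Z | v \in e]|].

Lemma par_symd Z1 Z2 : par (symd Z1 Z2) = symd (par Z1) (par Z2).
Proof.
apply/setP => v; rewrite !inE -odd_symd; congr odd; apply: eq_card => e; rewrite !inE.
by case: (v \in e); rewrite ?andbT ?andbF.
Qed.

Lemma simple_sub E Z : simple_graph E -> Z \subset E -> simple_graph Z.
Proof. by move=> sE /subsetP ZE e /ZE /sE. Qed.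

Lemma par_even Z : simple_graph Z -> ~~ odd #|par Z|.
Proof.
move=> sZ; rewrite odd_card.
have -> : \big[addb/false]_x (x \in par Z) = \big[addb/false]_(v : T) \big[addb/false]_(e in Z) (v \in e).
  apply: eq_bigr => v _; rewrite inE odd_card [RHS]big_mkcond; apply: eq_bigr => e _.
  by rewrite inE; case: (e \in Z).
rewrite exchange_big big1 // => e eZ.
by rewrite -odd_card sZ.
Qed.

Lemma edge_at E v e : simple_graph E -> e \in E -> v \in e -> exists2 u, erel E v u & e = [set v; u].
Proof.
move=> sE eE ve; have /cards2P [x [y [xy ee]]] : #|e| == 2 by rewrite sE.
move: ve; rewrite ee !inE => /orP [] /eqP ->.
  by exists y; rewrite // /erel xy -ee.
by exists x; rewrite /erel 1?eq_sym ?xy setUC // -ee.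
Qed.

Lemma deg_card E v : simple_graph E -> #|[set u | erel E v u]| = #|[set e in E | v \in e]|.
Proof.
move=> sE; have -> : [set e in E | v \in e] = [set [set v; u] | u in [set u | erel E v u]].
  apply/setP => e; rewrite inE; apply/andP/imsetP.
    by case=> eE ve; have [u vu ->] := edge_at sE eE ve; exists u; rewrite ?inE.
  by case=> u; rewrite inE => /andP [_ h] ->; rewrite h !inE eqxx.
rewrite card_in_imset // => u w; rewrite !inE => /andP [vu _] /andP [vw _] h.
have : u \in [set v; w] by rewrite -h !inE eqxx orbT.
by rewrite !inE eq_sym (negbTE vu) => /eqP.
Qed.

Definition darts E : {set T * T} := [set d | erel E d.1 d.2].

Lemma sum_deg E : #|darts E| = \sum_v #|[set u | erel E v u]|.
Proof.
rewrite -sum1_card (eq_bigl (fun d : T * T => erel E d.1 d.2)); last by move=> d; rewrite inE.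
rewrite -(pair_big_dep xpredT (fun v u => erel E v u) (fun _ _ => 1)) /=.
by apply: eq_bigr => v _; rewrite sum1_card cardsE.
Qed.

Lemma card_darts E : simple_graph E -> #|darts E| = (2 * #|E|)%N.
Proof.
move=> sE; rewrite sum_deg (eq_bigr (fun v => \sum_(e in E) (v \in e))); last first.
  move=> v _; rewrite deg_card // -sum1_card big_mkcond [RHS]big_mkcond; apply: eq_bigr => e _.
  by rewrite inE; case: (e \in E); case: (v \in e).
rewrite exchange_big /= (eq_bigr (fun=> 2)) => [|e /sE <-]; last first.
  by rewrite -sum1_card [RHS]big_mkcond; apply: eq_bigr => v _; case: (v \in e).
by rewrite sum_nat_const mulnC.
Qed.

Definition evens E : {set {set {set T}}} := [set Z in powerset E | par Z == set0].

(** Sort the edge sets by their odd vertices other than [r]; there are at most 2^(|S|-1) classes.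
    Two edge sets of one class differ by an even subgraph: the difference can only be odd at [r],
    and the number of odd vertices is even. *)
Lemma evens_lower E (S : {set T}) : simple_graph E -> (forall x y, erel E x y -> x \in S) ->
  0 < #|S| -> 2 ^ #|E| <= 2 ^ #|S|.-1 * #|evens E|.
Proof.
move=> sE ES /card_gt0P [r rS].
rewrite -card_powerset.
pose g Z := par Z :\ r.
have im Z : Z \in powerset E -> g Z \in powerset (S :\ r).
  rewrite inE => ZE; rewrite inE; apply/subsetP => v; rewrite !inE => /andP [-> /=].
  case: (set_0Vmem [set e in Z | v \in e]) => [->|[e]]; first by rewrite cards0.
  rewrite inE => /andP [eZ ve] _.
  by have [u vu _] := edge_at sE (subsetP ZE e eZ) ve; apply: ES vu.
rewrite -sum1_card (partition_big g (mem (powerset (S :\ r)))) //=.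
have -> : 2 ^ #|S|.-1 = #|powerset (S :\ r)|.
  by rewrite card_powerset (cardsD1 r S) rS.
rewrite -sum_nat_const; apply: leq_sum => A _.
rewrite sum1_card; case: (pickP (fun Z => (Z \in powerset E) && (g Z == A))) => [Z0|none]; last first.
  by rewrite eq_card0.
case/andP; rewrite inE => Z0E /eqP gZ0.
rewrite -(card_in_imset (f := fun Z => symd Z Z0)) => [|Z1 Z2 _ _ h]; last first.
  by rewrite -(symdK Z1 Z0) h symdK.
apply/subset_leq_card/subsetP => _ /imsetP [Z + ->].
rewrite !inE => /andP [ZE /eqP gZ]; rewrite inE in ZE.
have sub := symd_sub ZE Z0E; rewrite sub par_symd /=.
have pr : symd (par Z) (par Z0) \subset [set r].
  apply/subsetP => v; rewrite in_set1; apply: contraLR => vr.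
  have : v \in g Z = (v \in g Z0) by rewrite gZ gZ0.
  by rewrite !in_setD1 vr /= [in X in _ -> X]inE => ->; rewrite addbb.
have := par_even (simple_sub sE sub); rewrite par_symd.
by move: pr; rewrite subset1 => /orP [/eqP ->|//]; rewrite cards1.
Qed.

Lemma par1 u v : u != v -> par [set [set u; v]] = symd [set u] [set v].
Proof.
move=> uv; apply/setP => w; rewrite !inE.
have -> : [set e in [set [set u; v]] | w \in e] = if w \in [set u; v] then [set [set u; v]] else set0.
  apply/setP => e; rewrite !inE; case: (e =P [set u; v]) => [->|ne] /=.
    by rewrite !inE; case: ifP; rewrite ?inE ?eqxx.
  by case: ifP; rewrite ?inE //; move/eqP/negbTE: ne.
rewrite !inE; case: (w =P u) => [->|_] /=; first by rewrite (negbTE uv) cards1.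
by case: (w =P v) => _ /=; rewrite ?cards1 ?cards0.
Qed.

Lemma par0 : par set0 = set0.
Proof.
apply/setP => w; rewrite !inE eq_card0 // => e; by rewrite !inE.
Qed.

(** Connectedness is expressed by predicates that are constant along edges. Here it is applied to
    being joined to [r] by an edge set with the right parities, so no path has to be built. *)
Lemma join_exists E r a : (forall A : pred T, (forall x y, erel E x y -> A x = A y) ->
    forall x y, A x -> A y) ->
  exists2 J : {set {set T}}, J \subset E & par J = symd [set r] [set a].
Proof.
move=> conn; pose A y := [exists J : {set {set T}}, (J \subset E) && (par J == symd [set r] [set y])].
suff /existsP [J /andP [JE /eqP Jp]] : A a by exists J.
have step x y : erel E x y -> A x -> A y.
  move=> xy /existsP [J /andP [JE /eqP Jp]]; apply/existsP; exists (symd J [set [set x; y]]).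
  case/andP: xy => xy xyE; rewrite symd_sub ?sub1set //= par_symd Jp par1 //.
  by rewrite symdA symdK.
apply: (conn A _ r).
  by move=> x y xy; apply/idP/idP; apply: step; rewrite // erel_sym.
apply/existsP; exists set0; rewrite sub0set par0 /=; apply/eqP/setP => w.
by rewrite !inE addbb.
Qed.

(** For every vertex set [A] fix an edge set [J A] whose odd vertices are those of [A], up to [r].
    The sums of a [J A] and an even subgraph are pairwise different: the parities recover [A], and
    subtracting [J A] recovers the even subgraph. *)
Lemma evens_upper E : (forall A : pred T, (forall x y, erel E x y -> A x = A y) ->
    forall x y, A x -> A y) -> 0 < #|T| ->
  2 ^ #|T|.-1 * #|evens E| <= 2 ^ #|E|.
Proof.
move=> conn /card_gt0P [r _].
have /fin_all_exists [J JP] : forall A : {set T}, exists J : {set {set T}},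
    J \subset E /\ par J :\ r = A :\ r.
  move=> A; have [n] := ubnP #|A|; elim: n A => // n IH A An.
  case: (set_0Vmem A) => [->|[a aA]].
    by exists set0; rewrite sub0set par0.
  have [|J [JE Jp]] := IH (A :\ a); first by rewrite (cardsD1 a A) aA in An.
  have [K KE Kp] := join_exists r a conn.
  exists (symd J K); split; first exact: symd_sub.
  apply/setP => w; have := congr1 (fun X : {set T} => w \in X) Jp.
  rewrite par_symd Kp !in_setD1; case: (w =P r) => //= wr.
  rewrite [w \in symd _ _]inE [w \in symd [set r] _]inE !in_set1 => ->.
  have -> : (w == r) = false by apply/eqP.
  by case: (w =P a) => [->|_] /=; rewrite ?aA // addbF.
have -> : 2 ^ #|T|.-1 = #|powerset ([set: T] :\ r)|.
  by rewrite card_powerset -cardsT (cardsD1 r [set: T]) inE.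
rewrite -cardsX -card_powerset.
rewrite -(card_in_imset (f := fun d : {set T} * {set {set T}} => symd d.2 (J d.1))).
  apply/subset_leq_card/subsetP => _ /imsetP [[A Z] + ->] /=.
  rewrite !inE /= => /andP [_ /andP [ZE _]].
  by apply: symd_sub => //; case: (JP A).
move=> [A Z] [B Y]; rewrite !inE /= => /andP [Ar /andP [_ /eqP pZ]] /andP [Br /andP [_ /eqP pY]] h.
have rec (X : {set T}) (W : {set {set T}}) : X \subset [set: T] :\ r -> par W = set0 ->
    par (symd W (J X)) :\ r = X.
  move=> Xr pW; rewrite par_symd pW; case: (JP X) => _ e1.
  have -> : symd set0 (par (J X)) = par (J X) by apply/setP => w; rewrite [LHS]inE inE addFb.
  rewrite e1; apply/setP => w; rewrite !inE; case: eqP => //= ->.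
  by apply/esym/negP => /(subsetP Xr); rewrite !inE eqxx.
have AB : A = B by rewrite -(rec A Z) // -(rec B Y) // h.
by rewrite AB in h *; congr pair; rewrite -(symdK Z (J B)) h symdK.
Qed.

End Parity.

Lemma next_inj (T : eqType) (p : seq T) : uniq p -> injective (next p).
Proof. by move=> up; apply: can_inj (prev_next up). Qed.

Lemma set2_inj (T : finType) (u v x y : T) : u != v -> [set u; v] = [set x; y] ->
  u = x /\ v = y \/ u = y /\ v = x.
Proof.
move=> uv h; have : u \in [set x; y] by rewrite -h !inE eqxx.
have : v \in [set x; y] by rewrite -h !inE eqxx orbT.
rewrite !inE => /orP [] /eqP vE /orP [] /eqP uE; rewrite ?vE ?uE ?eqxx // in uv *; auto.
Qed.

(** * Euler's formula *)

Section Faces.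
Variables (T : finType) (E : {set {set T}}) (rot : T -> seq T).
Hypotheses (sE : simple_graph E) (PR : planar_rot (erel E) rot).

Lemma planar_rot_uniq v : uniq (rot v). Proof. by case: PR. Qed.
Lemma planar_rot_mem v u : (u \in rot v) = erel E v u. Proof. by case: PR. Qed.

Lemma next_erel v u : erel E v u -> erel E v (next (rot v) u).
Proof. by rewrite -!planar_rot_mem mem_next. Qed.

(** Pairs that are not darts are fixed, which makes the map injective on the whole of [T * T], as
    needed for its orbits to be symmetric. *)
Definition face (d : T * T) : T * T :=
  if erel E d.1 d.2 then (d.2, next (rot d.2) d.1) else d.

Lemma face_dart d : (face d \in darts E) = (d \in darts E).
Proof.
rewrite !inE /face; case: ifP => h /=; last by rewrite h.
by rewrite next_erel // erel_sym.
Qed.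

Lemma face_inj : injective face.
Proof.
move=> d d' h; have := face_dart d; rewrite h face_dart !inE.
move: h; rewrite /face; case: d d' => [u v] [u' v'] /=.
case: ifP; case: ifP => //= h1 h2 [<-] /(next_inj (planar_rot_uniq v)) -> //.
Qed.

Definition faces := equivalence_partition (fconnect face) (darts E).

Let frefl : {in darts E & &, equivalence_rel (fconnect face)}.
Proof.
move=> x y z _ _ _; split; first exact: connect0.
move=> xy; apply/idP/idP => h.
  by apply: connect_trans h; rewrite (fconnect_sym face_inj).
exact: connect_trans xy h.
Qed.

Lemma faces_partition : partition faces (darts E).
Proof. exact: equivalence_partitionP frefl. Qed.

Lemma fclosed_darts : fclosed face (mem (darts E)).
Proof. by move=> x y /eqP <-; rewrite /= face_dart. Qed.

Lemma faceP B : reflect (exists2 d, d \in darts E & B = [set y | fconnect face d y]) (B \in faces).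
Proof.
apply: (iffP imsetP) => -[d dD ->]; exists d => //; apply/setP => y; rewrite !inE.
  have h := closed_connect fclosed_darts (y := y) (x := d).
  case: (boolP (fconnect face d y)) => [/h /=|]; rewrite ?andbF // !inE => <-.
  by move: dD; rewrite inE => ->.
have h := closed_connect fclosed_darts (y := y) (x := d).
case: (boolP (fconnect face d y)) => [/h /=|]; rewrite ?andbF // !inE => <-.
by move: dD; rewrite inE => ->.
Qed.

(** The unions of faces. There are 2^|faces| of them, so both halves of Euler's formula become
    comparisons of powers of two. *)
Definition fclosedb (A : {set T * T}) :=
  (A \subset darts E) && [forall d, (d \in A) == (face d \in A)].

Lemma fclosedP A : fclosedb A -> fclosed face (mem A).
Proof. by case/andP => _ /forallP h x y /eqP <-; apply/eqP. Qed.

Lemma card_fclosed : #|[set A | fclosedb A]| = 2 ^ #|faces|.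
Proof.
rewrite -card_powerset.
pose g (A : {set T * T}) := [set B in faces | B \subset A].
have gK : {in [set A | fclosedb A], cancel g (@cover _)}.
  move=> A; rewrite inE => cA; apply/setP => x; apply/bigcupP/idP.
    by case=> B; rewrite inE => /andP [_ /subsetP BA] /BA.
  move=> xA; exists [set y | fconnect face x y]; last by rewrite inE connect0.
  rewrite inE; apply/andP; split.
    apply/faceP; exists x => //; case/andP: cA => /subsetP h _; exact: h.
  apply/subsetP => y; rewrite inE => xy.
  by rewrite -(closed_connect (fclosedP cA) xy).
have cK : {in powerset faces, cancel (@cover _) g}.
  move=> X; rewrite inE => /subsetP XF; apply/setP => B; rewrite inE.
  have /and3P [_ tI _] := faces_partition.
  apply/andP/idP => [[BF Bc]|BX]; last by split; [exact: XF|apply: bigcup_sup].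
  case/faceP: (BF) => d dD dB.
  have dB' : d \in B by rewrite dB inE connect0.
  have /bigcupP [C CX dC] := subsetP Bc d dB'.
  have : B = C; last by move=> ->.
  by rewrite -(def_pblock tI BF dB') -(def_pblock tI (XF C CX) dC).
apply/eqP; rewrite eqn_leq; apply/andP; split.
  rewrite -(card_in_imset (can_in_inj gK)); apply/subset_leq_card/subsetP => _ /imsetP [A _ ->].
  by rewrite inE; apply/subsetP => B; rewrite inE => /andP [].
rewrite -(card_in_imset (can_in_inj cK)); apply/subset_leq_card/subsetP => _ /imsetP [X + ->].
rewrite !inE => /subsetP XF; apply/andP; split.
  apply/subsetP => x /bigcupP [B /XF /faceP [d dD ->]]; rewrite inE => h.
  by rewrite -[x \in _](closed_connect fclosed_darts h).
apply/forallP => d; apply/eqP; apply/bigcupP/bigcupP => -[B BX dB]; exists B => //.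
  case/faceP: (XF B BX) => d' _ E1; move: dB; rewrite E1 !inE => h.
  exact: connect_trans h (fconnect1 _ _).
case/faceP: (XF B BX) => d' _ E1; move: dB; rewrite E1 !inE => h.
by apply: connect_trans h _; rewrite (fconnect_sym face_inj) fconnect1.
Qed.

Lemma erel_sub (Z : {set {set T}}) : Z \subset E -> subrel (erel Z) (erel E).
Proof. by move=> /subsetP ZE x y /andP [xy /ZE xyE]; apply/andP. Qed.

(* Each even subgraph yields two 2-colourings of the faces, and distinct ones are
   obtained in this way; so there are at least as many faces as independent
   cycles, plus one. *)
Lemma euler_ge (S : {set T}) : (forall x y, erel E x y -> x \in S) -> E != set0 ->
  #|E| + 2 <= #|faces| + #|S|.
Proof.
move=> ES /set0Pn [e0 e0E].
have [a [b [ab _]]] : exists a b, erel E a b /\ e0 = [set a; b].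
  have /cards2P [x [y [xy ee]]] : #|e0| == 2 by rewrite sE.
  by exists x, y; split=> //; apply/andP; rewrite -ee.
have S0 : 0 < #|S| by apply/card_gt0P; exists a; apply: ES ab.
have /fin_all_exists [F FP] : forall Z : {set {set T}}, exists F : T -> T -> bool, Z \in evens E ->
    forall u v, erel E u v -> F v u = F u v (+) erel Z u v /\ F v (next (rot v) u) = F u v.
  move=> Z; case: (boolP (Z \in evens E)) => [|_]; last by exists (fun _ _ => false).
  rewrite !inE => /andP [ZE /eqP pZ].
  case: PR => _ _ /(_ (erel Z) (@erel_sym _ _) (erel_sub ZE)) []; last by move=> F FP; exists F.
  move=> v; rewrite (deg_card _ (simple_sub sE ZE)).
  have := in_set0 v; rewrite -pZ inE => ->//.
(* The colouring given by an even subgraph, or its complement. The two darts of an edge get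
   different colours exactly if the edge is in the subgraph, so the colouring determines it. *)
pose h (x : bool * {set {set T}}) := [set d in darts E | F x.2 d.1 d.2 (+) x.1].
have hin b1 Z : Z \in evens E -> h (b1, Z) \in [set A | fclosedb A].
  move=> Ze; rewrite inE; apply/andP; split; first by apply/subsetP => d; rewrite inE => /andP [].
  apply/forallP => -[u v]; apply/eqP; rewrite [LHS]inE [RHS]inE face_dart inE /=.
  case: (boolP (erel E u v)) => //= uv; rewrite /face /= uv /=.
  by rewrite (FP Z Ze u v uv).2.
have hinj : {in setX [set: bool] (evens E) &, injective h}.
  move=> [b1 Z] [b2 Y]; rewrite !inE /= => /andP [ZE pZ] /andP [YE pY] hh.
  have Ze : Z \in evens E by rewrite !inE ZE.
  have Ye : Y \in evens E by rewrite !inE YE.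
  have key u v : erel E u v -> F Z u v (+) b1 = F Y u v (+) b2.
    by move=> uv; have := congr1 (fun A : {set T * T} => (u, v) \in A) hh; rewrite !inE /= uv.
  have ZY : Z = Y.
    apply/setP => e; case: (boolP (e \in E)) => eE; last first.
      have -> : e \in Z = false by apply: contraNF eE; apply: (subsetP ZE).
      by have -> : e \in Y = false by apply: contraNF eE; apply: (subsetP YE).
    have /cards2P [x [y [xy ee]]] : #|e| == 2 by rewrite sE.
    have xyE : erel E x y by rewrite /erel xy -ee.
    have yxE : erel E y x by rewrite erel_sym.
    have := key _ _ xyE; have := key _ _ yxE.
    rewrite (FP Z Ze x y xyE).1 (FP Y Ye x y xyE).1 /erel xy -ee /=.
    by case: (F Z x y) (F Y x y) (e \in Z) (e \in Y) b1 b2 {hh key} => [] [] [] [] [] [].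
  subst Y; congr pair; have := key a b ab.
  by case: (F Z a b) b1 b2 {hh key} => [] [] [].
have le1 : 2 * #|evens E| <= 2 ^ #|faces|.
  rewrite -card_fclosed -card_bool -cardsT -cardsX -(card_in_imset hinj).
  apply/subset_leq_card/subsetP => _ /imsetP [[b1 Z] + ->].
  by rewrite in_setX => /andP [_ Ze]; apply: hin.
have le2 := evens_lower sE ES S0.
have : 2 ^ (#|E| + 2) <= 2 ^ (#|faces| + #|S|).
  rewrite !expnD -[in X in _ <= _ * X](prednK S0).
  apply: leq_trans (leq_mul le2 (leqnn (2 ^ 2))) _.
  have -> : 2 ^ #|S|.-1 * #|evens E| * 2 ^ 2 = (2 * #|evens E|) * (2 * 2 ^ #|S|.-1) by ring.
  rewrite expnS; exact: (leq_mul le1 (leqnn _)).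
by rewrite leq_exp2l.
Qed.

(* Conversely the boundary of a set of faces is even, and in a connected graph it
   determines the set up to complementation. *)
Lemma euler_le : (forall A : pred T, (forall x y, erel E x y -> A x = A y) -> forall x y, A x -> A y) ->
  0 < #|T| -> #|faces| + #|T| <= #|E| + 2.
Proof.
move=> conn T0.
pose bd (A : {set T * T}) := [set e in E | [exists d, [&& d \in A, e == [set d.1; d.2] & (d.2, d.1) \notin A]]].
have bdE A u v : erel E u v -> ([set u; v] \in bd A) = ((u, v) \in A) (+) ((v, u) \in A).
  move=> uv; have := uv; case/andP => uv' uvE; rewrite inE uvE /=.
  apply/existsP/idP.
    case=> -[x y] /= /and3P [xyA /eqP /(set2_inj uv') [] [-> ->] nA]; rewrite xyA (negbTE nA) //.
  case uvA : ((u, v) \in A); case vuA : ((v, u) \in A) => //= _.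
    by exists (u, v); rewrite uvA vuA eqxx.
  by exists (v, u); rewrite vuA uvA setUC eqxx.
have bdpar A : fclosedb A -> bd A \in evens E.
  move=> cA; rewrite !inE; have bE : bd A \subset E by apply/subsetP => e; rewrite inE => /andP [].
  rewrite bE /=; apply/eqP/setP => v; rewrite !inE -(deg_card _ (simple_sub sE bE)).
  (* The darts of [A] leaving [v] and those entering [v] are equally many, since [next (rot v)]
     matches them; hence the boundary has even degree at [v]. *)
  have -> : [set u | erel (bd A) v u] = symd [set u | (v, u) \in A] [set u | (u, v) \in A].
    apply/setP => u; rewrite !inE; case: (boolP (erel E v u)) => vu.
      by rewrite -bdE // /erel; case/andP: vu => ->.
    have /subsetP AD : A \subset darts E by case/andP: cA.
    have -> : (v, u) \in A = false by apply: contraNF vu => /AD; rewrite inE.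
    have -> : (u, v) \in A = false by apply: contraNF vu => /AD; rewrite inE erel_sym.
    by apply: contraNF vu => /andP [vu /(subsetP bE) h]; rewrite /erel vu.
  rewrite odd_symd.
  have -> : [set u | (u, v) \in A] = next (rot v) @^-1: [set u | (v, u) \in A].
    apply/setP => u; rewrite !inE.
    case: (boolP (erel E u v)) => uv.
      have /andP [_ /forallP /(_ (u, v))] := cA; rewrite /face /= uv => /eqP ->.
      by [].
    have /subsetP AD : A \subset darts E by case/andP: cA.
    have -> : (u, v) \in A = false by apply: contraNF uv => /AD; rewrite inE.
    apply/esym; apply: contraNF uv => /AD; rewrite inE /= -planar_rot_mem mem_next planar_rot_mem.
    by rewrite erel_sym.
  by rewrite card_preimset ?addbb //; apply/next_inj/planar_rot_uniq.
have bdfib A B : fclosedb A -> fclosedb B -> bd A = bd B -> A = B \/ A = darts E :\: B.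
  (* The difference of two sets with the same boundary is closed under [face] and under reversing
     darts. So it is constant around each vertex and along each edge: it is empty or contains all
     darts. *)
  move=> cA cB bAB; pose C := symd A B.
  have CE d : (d \in C) = (face d \in C).
    have /andP [_ /forallP /(_ d) /eqP h1] := cA; have /andP [_ /forallP /(_ d) /eqP h2] := cB.
    by rewrite !inE h1 h2.
  have Csw u v : erel E u v -> ((u, v) \in C) = ((v, u) \in C).
    move=> uv; have := bdE A u v uv; rewrite bAB bdE // !inE.
    by case: (_ \in A) (_ \in A) (_ \in B) (_ \in B) => [] [] [] [].
  have Cnext u v : erel E v u -> ((v, u) \in C) = ((v, next (rot v) u) \in C).
    by move=> vu; rewrite Csw // CE /face /= erel_sym vu.
  have /subsetP AD : A \subset darts E by case/andP: cA.
  have /subsetP BD : B \subset darts E by case/andP: cB.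
  have Call v u w : erel E v u -> erel E v w -> ((v, u) \in C) = ((v, w) \in C).
    move=> vu vw.
    have cn : fconnect (next (rot v)) u w.
      have cy := cycle_next (planar_rot_uniq v).
      have uin : u \in rot v by rewrite planar_rot_mem.
      by rewrite (fconnect_cycle cy uin) planar_rot_mem.
    have it n : erel E v (iter n (next (rot v)) u) /\ ((v, u) \in C) = ((v, iter n (next (rot v)) u) \in C).
      elim: n => [|n [i1 i2]] //=; split; first exact: next_erel.
      by rewrite i2 Cnext.
    by case/iter_findex: cn => <-; case: (it (findex (next (rot v)) u w)).
  pose vA v := [exists u, erel E v u && ((v, u) \in C)].
  have vAe x y : erel E x y -> vA x = vA y.
    move=> xy; have yx : erel E y x by rewrite erel_sym.
    apply/existsP/existsP => -[u /andP [xu h]].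
      by exists x; rewrite yx Csw // -(Call x u y xu xy).
    by exists y; rewrite xy Csw // -(Call y u x xu yx).
  have eqC d : d \in C -> d \in darts E.
    by rewrite inE; case dA : (d \in A); [move=> _; apply: AD|rewrite addFb; apply: BD].
  case: (set_0Vmem C) => [C0|[[u v] uvC]]; [left|right].
    apply/setP => d; have := in_set0 d; rewrite -C0 inE.
    by case: (d \in A) (d \in B) => [] [].
  have uv := eqC _ uvC; rewrite inE /= in uv.
  have allC d : d \in darts E -> d \in C.
    case: d => x y; rewrite inE /= => xy.
    have : vA x by apply: (conn vA vAe u); apply/existsP; exists v; rewrite uv.
    by case/existsP => w /andP [xw]; rewrite (Call x w y xw xy).
  apply/setP => d; rewrite in_setD; case: (boolP (d \in darts E)) => dD.
    have := allC _ dD; rewrite inE andbT.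
    by case: (d \in A) (d \in B) => [] [].
  by rewrite andbF; apply: contraNF dD; apply: AD.
have le1 : 2 ^ #|faces| <= 2 * #|evens E|.
  rewrite -card_fclosed -sum1_card (partition_big bd (mem (evens E))) /=; last first.
    by move=> A; rewrite inE; apply: bdpar.
  rewrite mulnC -sum_nat_const; apply: leq_sum => Z _; rewrite sum1_card.
  case: (pickP (fun A => (A \in [set A | fclosedb A]) && (bd A == Z))) => [B /andP [cB /eqP bB]|none]; last first.
    by rewrite eq_card0.
  rewrite inE in cB; apply: leq_trans (card_size [:: B; darts E :\: B]).
  apply/subset_leq_card/subsetP => A; rewrite inE => /andP [cA /eqP bA]; rewrite inE in cA.
  by rewrite !inE; case: (bdfib A B cA cB _) => [|->|->]; rewrite ?eqxx ?orbT // bA bB.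
have le2 := evens_upper conn T0.
have : 2 ^ (#|faces| + #|T|) <= 2 ^ (#|E| + 2).
  rewrite !expnD -[in X in _ * X <= _](prednK T0) [2 ^ _.+1]expnS.
  apply: leq_trans (leq_mul le1 (leqnn _)) _.
  have -> : 2 * #|evens E| * (2 * 2 ^ #|T|.-1) = (2 ^ #|T|.-1 * #|evens E|) * 2 ^ 2 by ring.
  exact: (leq_mul le2 (leqnn _)).
by rewrite leq_exp2l.
Qed.

End Faces.

(** * Edge bounds *)

(** A component with a single edge has a face of length 2, and it is the only obstacle to faces
    having length at least 3. *)
Definition isolated_edge (T : finType) (E : {set {set T}}) u v :=
  [/\ erel E u v, forall w, erel E u w -> w = v & forall w, erel E v w -> w = u].

(** Rotations are required for all subgraphs at once, which spares deleting edges from a rotation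
    system. *)
Definition hplanar (T : finType) (E : {set {set T}}) : Prop :=
  forall E' : {set {set T}}, E' \subset E -> exists rot, planar_rot (erel E') rot.

Lemma hplanarW (T : finType) (E E' : {set {set T}}) : E' \subset E -> hplanar E -> hplanar E'.
Proof. by move=> s h E1 s1; apply: h; apply: subset_trans s. Qed.

Section Orders.
Variables (T : finType) (E : {set {set T}}) (rot : T -> seq T).
Hypotheses (sE : simple_graph E) (PR : planar_rot (erel E) rot).

Lemma next_fixed v u w : erel E v u -> next (rot v) u = u -> erel E v w -> w = u.
Proof.
move=> vu nu vw.
have : fconnect (next (rot v)) u w.
  by rewrite (fconnect_cycle (cycle_next (planar_rot_uniq PR v))) (planar_rot_mem PR).
by move/iter_findex => <-; elim: (findex _ _ _) => //= n ->.
Qed.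

Lemma face_order3 d : d \in darts E -> (forall u v, ~ isolated_edge E u v) -> 3 <= order (face E rot) d.
Proof.
case: d => u v; rewrite inE /= => uv noiso.
have o := iter_order (face_inj PR) (u, v).
have o0 := order_gt0 (face E rot) (u, v).
rewrite leqNgt; apply/negP => o3.
have vu : erel E v u by rewrite erel_sym.
have uNv : u != v by case/andP: uv.
have f1 : face E rot (u, v) = (v, next (rot v) u) by rewrite /face /= uv.
move: o o0 o3; case: (order _ _) => [|[|[|n]]] //= h _ _.
  by move: h; rewrite f1 => -[/eqP]; rewrite eq_sym (negbTE uNv).
have vn := next_erel PR vu.
move: h; rewrite f1 /face /= vn => -[h1 h2].
rewrite h1 in h2; apply: (noiso u v); split => // w hw.
  exact: next_fixed uv h2 hw.
exact: next_fixed vu h1 hw.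
Qed.

(** Along a face the two sides of the bipartition alternate, so its length is even. *)
Lemma face_order4 (B : pred T) d : (forall x y, erel E x y -> B x != B y) ->
  d \in darts E -> (forall u v, ~ isolated_edge E u v) -> 4 <= order (face E rot) d.
Proof.
move=> bip dD noiso; have o3 := face_order3 dD noiso.
have o := iter_order (face_inj PR) d.
have alt n : iter n (face E rot) d \in darts E /\ B (iter n (face E rot) d).1 = B d.1 (+) odd n.
  elim: n => [|n [i1 i2]]; first by rewrite addbF.
  rewrite iterS (face_dart PR); split => //.
  move: i1 i2; case: (iter n (face E rot) d) => x y; rewrite inE /= => xy i2.
  rewrite /face /= xy /=; have := bip _ _ xy; move: i2.
  by case: (B x) (B y) (B d.1) (odd n) => [] [] [] [].
have [_] := alt (order (face E rot) d); rewrite o => h.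
have : ~~ odd (order (face E rot) d) by move: h; case: (B _) (odd _) => [] [].
by move: o3; case: (order (face E rot) d) => [|[|[|[|n]]]].
Qed.

Lemma card_face B : B \in faces E rot -> exists2 d, d \in darts E & #|B| = order (face E rot) d.
Proof.
case/(faceP PR) => d dD ->; exists d => //; rewrite /order; apply: eq_card => y; by rewrite inE.
Qed.

Lemma faces_bound k : (forall d, d \in darts E -> k <= order (face E rot) d) -> k * #|faces E rot| <= 2 * #|E|.
Proof.
move=> h; rewrite -card_darts // (card_partition (faces_partition PR)) mulnC -sum_nat_const.
by apply: leq_sum => B /card_face [d dD ->]; apply: h.
Qed.

Lemma faces_exact k : (forall d, d \in darts E -> order (face E rot) d = k) -> k * #|faces E rot| = 2 * #|E|.
Proof.
move=> h; rewrite -card_darts // (card_partition (faces_partition PR)) mulnC -sum_nat_const.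
by apply: eq_bigr => B /card_face [d dD ->]; rewrite h.
Qed.

End Orders.

(** Without isolated edges, Euler's formula and counting darts by faces give the bound. An isolated
    edge is removed together with its ends, which lowers the right side by 2k and the left side only
    by k - 2. *)
Lemma planar_girth (T : finType) (E : {set {set T}}) (S : {set T}) k : 3 <= k ->
  simple_graph E -> hplanar E -> (forall x y, erel E x y -> x \in S) -> 3 <= #|S| ->
  (forall (E' : {set {set T}}) rot, E' \subset E -> planar_rot (erel E') rot -> (forall u v, ~ isolated_edge E' u v) ->
     forall d, d \in darts E' -> k <= order (face E' rot) d) ->
  (k - 2) * #|E| + 2 * k <= k * #|S|.
Proof.
move=> k3; have [n] := ubnP #|S|; elim: n E S => // n IH E S Sn sE hE ES S3 girth.
case: (pselect (exists u v, isolated_edge E u v)) => [[a [b [ab Na Nb]]]|noiso]; last first.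
  have [E0|En0] := eqVneq E set0; first by rewrite E0 cards0; nia.
  have [rot PR] := hE E (subxx _).
  have f1 := euler_ge sE PR ES En0.
  have f2 : k * #|faces E rot| <= 2 * #|E|.
    apply: (faces_bound sE PR) => d dD; apply: girth => // u v h; apply: noiso; by exists u, v.
  nia.
have /andP [aNb abE] := ab.
pose E' := E :\ [set a; b]; pose S' := S :\ a :\ b.
have E'E : E' \subset E by apply: subsetDl.
have cE : #|E| = #|E'|.+1 by rewrite (cardsD1 [set a; b] E) abE.
have aS : a \in S by apply: ES ab.
have bS : b \in S by apply: (ES b a); rewrite erel_sym.
have cS : #|S| = #|S'|.+2.
  by rewrite (cardsD1 a S) aS (cardsD1 b (S :\ a)) in_setD1 eq_sym aNb bS.
have ES' x y : erel E' x y -> x \in S'.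
  case/andP => xy; rewrite in_setD1 => /andP [ne xyE].
  have xyE' : erel E x y by rewrite /erel xy.
  rewrite !in_setD1 (ES _ _ xyE') andbT; apply/andP; split.
    apply: contraNneq ne => xb; subst x; have := Nb _ xyE' => ->; by rewrite setUC.
  by apply: contraNneq ne => xa; subst x; have := Na _ xyE' => ->.
have [S'3|S'3] := leqP 3 #|S'|.
  have Sn' : #|S'| < n by lia.
  have h : (k - 2) * #|E'| + 2 * k <= k * #|S'|.
    apply: (IH E' S' Sn' (simple_sub sE E'E) (hplanarW E'E hE) ES' S'3).
    move=> E1 rot E1E'; apply: girth; exact: subset_trans E'E.
  by rewrite cE cS; nia.
(* At most two vertices are left, too few for the induction hypothesis. *)
have E'1 : #|E'| <= 1.
  rewrite -(cards1 S'); apply/subset_leq_card/subsetP => e eE'; rewrite in_set1 eqEcard.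
  have ee := sE _ (subsetP E'E e eE').
  apply/andP; split; last by rewrite ee; lia.
  apply/subsetP => x xe; have [y xy _] := edge_at (simple_sub sE E'E) eE' xe.
  exact: ES' xy.
have : #|E'| = 0 \/ 2 <= #|S'|.
  case: (set_0Vmem E') => [->|[e eE']]; first by left; rewrite cards0.
  right; rewrite -(sE _ (subsetP E'E e eE')); apply/subset_leq_card/subsetP => x xe.
  have [y xy _] := edge_at (simple_sub sE E'E) eE' xe; exact: ES' xy.
rewrite cE cS => h; nia.
Qed.

Lemma planar_edges (T : finType) (E : {set {set T}}) (S : {set T}) :
  simple_graph E -> hplanar E -> (forall x y, erel E x y -> x \in S) -> 3 <= #|S| ->
  #|E| + 6 <= 3 * #|S|.
Proof.
move=> sE hE ES S3; have := @planar_girth T E S 3 isT sE hE ES S3.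
rewrite mul1n => -> // E' rot E'E PR noiso d dD.
exact: (face_order3 PR dD noiso).
Qed.

Lemma planar_bip_edges (T : finType) (E : {set {set T}}) (S : {set T}) (B : pred T) :
  simple_graph E -> hplanar E -> (forall x y, erel E x y -> x \in S) -> 3 <= #|S| ->
  (forall x y, erel E x y -> B x != B y) ->
  #|E| + 4 <= 2 * #|S|.
Proof.
move=> sE hE ES S3 bip.
suff h : (4 - 2) * #|E| + 2 * 4 <= 4 * #|S| by lia.
apply: planar_girth ES S3 _ => // E' rot E'E PR noiso d dD.
apply: (face_order4 PR (B := B)) => // x y /(erel_sub E'E); exact: bip.
Qed.

(** * Crossing paths and triangulations *)

Lemma subseq_split (T : eqType) (x : T) p s : subseq (x :: p) s ->
  exists l r, s = l ++ x :: r /\ subseq p r.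
Proof.
elim: s => //= y s IH; case: eqP => [-> h|_ /IH [l [r [-> h]]]].
  by exists [::], s.
by exists (y :: l), r.
Qed.

Section Rotation.
Variables (T : finType) (E : {set {set T}}) (rot : T -> seq T).
Hypotheses (sE : simple_graph E) (PR : planar_rot (erel E) rot).

Lemma rot_connected v (P : pred T) u w : (forall x, erel E v x -> P x -> P (next (rot v) x)) ->
  erel E v u -> erel E v w -> P u -> P w.
Proof.
move=> h vu vw Pu.
have : fconnect (next (rot v)) u w.
  by rewrite (fconnect_cycle (cycle_next (planar_rot_uniq PR v))) (planar_rot_mem PR).
move/iter_findex => <-; elim: (findex _ _ _) => [|n IH] //=.
suff : erel E v (iter n (next (rot v)) u) by move=> ?; apply: h.
by elim: (n) => //= k; apply: next_erel.
Qed.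

Lemma even_values (Z : {set {set T}}) : Z \subset E -> par Z = set0 ->
  exists F : T -> T -> bool, forall u v, erel E u v ->
    F v u = F u v (+) ([set u; v] \in Z) /\ F v (next (rot v) u) = F u v.
Proof.
move=> ZE pZ; case: PR => _ _ /(_ (erel Z) (@erel_sym _ _) (erel_sub ZE)) [|F FP].
  move=> v; rewrite (deg_card _ (simple_sub sE ZE)).
  by have := in_set0 v; rewrite -pZ inE => ->.
exists F => u v uv; have [-> ->] := FP u v uv; split => //.
by rewrite /erel; case/andP: uv => ->.
Qed.

Section Values.
Variables (Z : {set {set T}}) (F : T -> T -> bool).
Hypothesis FP : forall u v, erel E u v ->
    F v u = F u v (+) ([set u; v] \in Z) /\ F v (next (rot v) u) = F u v.

Lemma value_next v u : erel E v u -> F v (next (rot v) u) = F v u (+) ([set v; u] \in Z).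
Proof.
move=> vu; have uv : erel E u v by rewrite erel_sym.
by have [h ->] := FP uv; rewrite h setUC -addbA addbb addbF.
Qed.

Lemma value_const v u w : (forall x, erel E v x -> [set v; x] \notin Z) ->
  erel E v u -> erel E v w -> F v u = F v w.
Proof.
move=> nZ vu vw; apply/eqP.
apply: (rot_connected (P := fun x => F v u == F v x) _ vu vw) => // x vx /eqP ->.
by rewrite value_next // (negbTE (nZ x vx)) addbF.
Qed.

End Values.

Lemma path_join (A : pred T) a p : path [rel x y | [&& erel E x y, A x & A y]] a p ->
  exists J : {set {set T}}, [/\ J \subset E, par J = symd [set a] [set last a p] &
    forall e x, e \in J -> x \in e -> A x].
Proof.
elim: p a => [|b p IH] a /=.
  move=> _; exists set0; rewrite sub0set par0; split => //; last by move=> e x; rewrite inE.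
  by apply/setP => w; rewrite !inE addbb.
case/andP => /and3P [ab Aa Ab] /IH [J [JE Jp JA]].
have /andP [aNb abE] := ab.
exists (symd [set [set a; b]] J); split.
- by apply: symd_sub => //; rewrite sub1set.
- by rewrite par_symd Jp par1 // symdA symdK.
- move=> e x; rewrite inE in_set1; case: (e =P [set a; b]) => [->|_] /=.
    by move=> _; rewrite !inE => /orP [] /eqP ->.
  by move=> eJ; apply: JA.
Qed.

(* The path from [a] to [c] closes through [v] to an even subgraph, whose
   2-colouring of the faces separates [b] from [d] around [v]. *)
Lemma no_crossing (v a b c d : T) (A B : pred T) : subseq [:: a; b; c; d] (rot v) ->
  ~~ A v -> ~~ B v -> (forall x, A x -> ~~ B x) -> A a -> B b ->
  connect [rel x y | [&& erel E x y, A x & A y]] a c ->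
  connect [rel x y | [&& erel E x y, B x & B y]] b d -> False.
Proof.
move=> sub vA vB AB Aa Bb /connectP [p pA ec] bd.
have rv := planar_rot_uniq PR v.
have [l1 [r1 [e1 s1]]] := subseq_split sub.
have [l2 [r2 [e2 s2]]] := subseq_split s1.
have [l3 [r3 [e3 s3]]] := subseq_split s2.
have [l4 [r4 [e4 _]]] := subseq_split s3.
subst r1 r2 r3.
have va : erel E v a by rewrite -(planar_rot_mem PR) e1 mem_cat mem_head orbT.
have vb : erel E v b by rewrite -(planar_rot_mem PR) e1 !(mem_cat, inE) eqxx !orbT.
have vc : erel E v c by rewrite -(planar_rot_mem PR) e1 !(mem_cat, inE) eqxx !orbT.
have vd : erel E v d by rewrite -(planar_rot_mem PR) e1 !(mem_cat, inE) eqxx !orbT.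
have /andP [vNa vaE] := va; have /andP [vNc vcE] := vc.
have [J [JE Jp JA]] := path_join pA; rewrite -ec in Jp.
pose Z := symd (symd [set [set v; a]] [set [set v; c]]) J.
have ZE : Z \subset E by do 2 (apply: symd_sub => //); rewrite sub1set.
have pZ : par Z = set0.
  rewrite !par_symd Jp !par1 //; apply/setP => w; rewrite !inE.
  by case: (w == v) (w == a) (w == c) => [] [] [].
have [F FP] := even_values ZE pZ.
have aNc : a != c.
  move: rv; rewrite e1 cat_uniq => /and3P [_ _] /=; rewrite !(mem_cat, inE) !negb_or.
  by case/andP => /and5P [].
have ZB x y : B x -> [set x; y] \notin Z.
  move=> Bx; rewrite !inE.
  have xv : x != v by apply: contraNneq vB => <-.
  have xNa : x != a by apply: contraTneq Aa => <-; apply/negP => /AB; rewrite Bx.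
  have Ac : A c.
    rewrite ec; case: (p) pA => //= q p' /andP [/and3P [_ _ Aq]].
    elim: p' q Aq => //= z p' IH q Aq /andP [/and3P [_ _ Az]]; exact: IH.
  have xNc : x != c by apply: contraTneq Ac => <-; apply/negP => /AB; rewrite Bx.
  have n1 : [set x; y] == [set v; a] = false.
    by apply/eqP => h; have := set21 x y; rewrite h !inE (negbTE xv) (negbTE xNa).
  have n2 : [set x; y] == [set v; c] = false.
    by apply/eqP => h; have := set21 x y; rewrite h !inE (negbTE xv) (negbTE xNc).
  rewrite n1 n2 /=; apply/negP => h; have := JA _ _ h (set21 x y).
  by move/AB; rewrite Bx.
have ZvE x : erel E v x -> ([set v; x] \in Z) = (x == a) (+) (x == c).
  move=> /andP [vx _]; rewrite !inE.
  have -> : [set v; x] \in J = false.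
    by apply: contraNF vA => h; apply: JA h (set21 v x).
  have q y : ([set v; x] == [set v; y]) = (x == y).
    apply/eqP/eqP => [h|-> //]; have := set22 v x; rewrite h !inE.
    by rewrite eq_sym (negbTE vx) => /eqP.
  by rewrite !q addbF.
(* No edge at a vertex of [B] is in [Z], so the value is carried unchanged from [b] to [d] along the
   second path. *)
have valB x : connect [rel x y | [&& erel E x y, B x & B y]] b x ->
    B x /\ forall y, erel E x y -> F x y = F b v.
  case/connectP => q qB ->; elim/last_ind: q qB => [|q z IH] /=.
    move=> _; split => // y by'; apply: (value_const FP) => //; last by rewrite erel_sym.
    by move=> w _; apply: ZB.
  rewrite rcons_path last_rcons => /andP [/IH [Bl hl]] /= /and3P [lz _ Bz]; split => // y zy.
  have zl : erel E z (last b q) by rewrite erel_sym.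
  rewrite (value_const FP (w := last b q)) //; last by move=> w _; apply: ZB.
  by have [-> _] := FP _ _ lz; rewrite (negbTE (ZB _ _ Bl)) addbF hl.
have [Bd hd] := valB d bd.
have dv : erel E d v by rewrite erel_sym.
have bv : erel E b v by rewrite erel_sym.
have E1 : F v b = F v d.
  have [-> _] := FP _ _ bv; have [-> _] := FP _ _ dv.
  by rewrite (negbTE (ZB b v Bb)) (negbTE (ZB d v Bd)) (hd v dv).
pose G := F v.
(* The rotation at [v] is cut open in front of [b]. From there to [d] it passes [c] but not [a], so
   the value changes exactly once, against [E1]. *)
have pathG : path (fun x y => G y == G x (+) (x == a) (+) (x == c)) b (l3 ++ c :: l4 ++ d :: r4).
  have cyc : cycle (fun x y => next (rot v) x == y) (rot v) := cycle_next rv.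
  have : cycle (fun x y => G y == G x (+) (x == a) (+) (x == c)) (rot v).
    have mem x : x \in rot v -> erel E v x by rewrite (planar_rot_mem PR).
    refine (sub_in_cycle (P := [pred x | x \in rot v]) _ _ cyc); last by apply/allP.
    move=> x y /= /mem vx _ /eqP <-; apply/eqP.
    by rewrite /G (value_next FP) // ZvE // addbA.
  have -> : rot v = (l1 ++ a :: l2) ++ b :: l3 ++ c :: l4 ++ d :: r4.
    by rewrite e1 -!catA.
  case: (l1 ++ a :: l2) => [|x0 l0] /=; first by rewrite rcons_path => /andP [].
  by rewrite rcons_path cat_path /= => /andP [/andP [_ /andP [_ ->]]].
have nota : a \notin b :: l3 ++ c :: l4 ++ d :: r4.
  move: rv; rewrite e1 cat_uniq => /and3P [_ _] /=; rewrite mem_cat negb_or => /andP [/andP [_ h] _].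
  by rewrite !(mem_cat, inE) in h *.
have notc : c \notin b :: l3.
  move: rv; rewrite e1 -cat_cons catA cat_uniq => /and3P [_ _].
  rewrite -cat_cons cat_uniq => /and3P [_ h _].
  by apply: contra h => h; apply/hasP; exists c; rewrite ?mem_head.
have notc' : c \notin l4 ++ d :: r4.
  move: rv; rewrite e1 -cat_cons catA cat_uniq => /and3P [_ _].
  by rewrite -cat_cons cat_uniq => /and3P [_ _ /andP [] ].
have flat x s : path (fun x y => G y == G x (+) (x == a) (+) (x == c)) x s ->
    a \notin x :: s -> c \notin belast x s -> G (last x s) = G x.
  elim: s x => //= y s IH x /andP [/eqP e0 ys]; rewrite !inE !negb_or => /and3P [ax ay as'] /andP [cx cs].
  rewrite IH // ?inE ?negb_or ?ay //.
  by rewrite e0 eq_sym (negbTE ax) eq_sym (negbTE cx) !addbF.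
move: pathG; rewrite cat_path /= => /and3P [p1 /eqP pc].
rewrite cat_path /= => /and3P [p2 /eqP pd _].
have sp1 : G c = G b.
  have := flat b (rcons l3 c); rewrite rcons_path p1 /= last_rcons belast_rcons => -> //.
  - by rewrite pc.
  - by move: nota; rewrite !(mem_cat, inE, mem_rcons) !negb_or => /and4P [-> -> ->].
have sp2 : G d = ~~ G c.
  have h2 : path (fun x y => G y == G x (+) (x == a) (+) (x == c)) c (rcons l4 d).
    by rewrite rcons_path p2 /= pd.
  have ca : (c == a) = false by rewrite eq_sym (negbTE aNc).
  have nota4 : a \notin rcons l4 d.
    by move: nota; rewrite !(mem_cat, inE, mem_rcons) !negb_or => /and5P [_ _ _ -> /andP [->]].
  have notc4 : c \notin rcons l4 d.
    by move: notc'; rewrite !(mem_cat, inE, mem_rcons) !negb_or => /and3P [-> ->].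
  move: h2 nota4 notc4; case El : (rcons l4 d) => [|y l]; first by case: (l4) El.
  move=> /= /andP [/eqP e0 h2] nota4 notc4.
  have -> : d = last y l by rewrite -[last y l]/(last c (y :: l)) -El last_rcons.
  rewrite flat //; last by apply: contra notc4 => /mem_belast.
  by rewrite e0 ca eqxx addbF addbT.
by move: sp2; rewrite sp1 /G E1; case: (F v d).
Qed.

Section Triangulation.
Hypothesis next_adj : forall v u, erel E v u -> next (rot v) u != u -> erel E u (next (rot v) u).
Hypothesis conn : forall A : pred T, (forall x y, erel E x y -> A x = A y) -> forall x y, A x -> A y.
Hypothesis T3 : 3 <= #|T|.

(** Suppose that [u] is the only neighbour of [v]. Then [v] is also the only neighbour of [u], and
    the connected graph has two vertices; or the neighbour following [v] around [u] is adjacent to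
    [v], hence equals [u], which is absurd. *)
Lemma next_neq v u : erel E v u -> next (rot v) u != u.
Proof.
move=> vu; have uv : erel E u v by rewrite erel_sym.
apply/eqP => nu; have onlyu w : erel E v w -> w = u := next_fixed PR vu nu.
case: (eqVneq (next (rot u) v) v) => [nv|nv].
  have onlyv w : erel E u w -> w = v := next_fixed PR uv nv.
  have all x : x \in [set u; v].
    apply: (conn (A := fun x => x \in [set u; v]) _ (x := u)); last by rewrite !inE eqxx.
    move=> y z yz; rewrite !inE; apply/idP/idP => /orP [] /eqP e; subst.
    - by rewrite (onlyv _ yz) eqxx orbT.
    - by rewrite (onlyu _ yz) eqxx.
    - by move: yz; rewrite erel_sym => /onlyv ->; rewrite eqxx orbT.
    - by move: yz; rewrite erel_sym => /onlyu ->; rewrite eqxx.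
  have : #|T| <= #|[set u; v]| by apply/subset_leq_card/subsetP => x _; exact: all.
  by rewrite cards2; move: T3; case: (u != v) => /=; lia.
have /onlyu e := next_adj uv nv; have := next_erel PR uv.
by rewrite e erel_irr.
Qed.

(* Otherwise the 2-colouring of the faces bounded by the triangle [u v w]
   gives different values to the next neighbour [t] of [w] seen from [v] and
   from [w]. *)
Lemma next_next u v : erel E u v -> next (rot (next (rot v) u)) v = u.
Proof.
move=> uv; have vu : erel E v u by rewrite erel_sym.
set w := next (rot v) u; set t := next (rot w) v.
have vw : erel E v w by apply: next_erel vu.
have wv : erel E w v by rewrite erel_sym.
have uw : erel E u w by apply: next_adj vu (next_neq vu).
have wt : erel E w t by apply: next_erel wv.
have tv : erel E v t by apply: next_adj wv (next_neq wv).
apply/eqP/negP => tu.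
have ne x y : erel E x y -> x != y by case/andP.
have uE x y : erel E x y -> [set x; y] \in E by case/andP.
pose Z := symd (symd [set [set u; v]] [set [set v; w]]) [set [set u; w]].
have ZE : Z \subset E by apply: symd_sub; [apply: symd_sub|]; rewrite sub1set uE.
have pZ : par Z = set0.
  rewrite !par_symd !par1 ?ne //; apply/setP => x; rewrite !inE.
  by case: (x == u) (x == v) (x == w) => [] [] [].
have [F FP] := even_values ZE pZ.
have setE x y z s : x != y -> x != z -> x != s -> ([set x; y] == [set z; s]) = false.
  by move=> _ xz xs; apply/eqP => h; have := set21 x y; rewrite h !inE (negbTE xz) (negbTE xs).
have tZ x : [set t; x] \notin Z.
  rewrite !inE; have tx y z : t != y -> t != z -> ([set t; x] == [set y; z]) = false.
    by move=> ty tz; apply/eqP => h; have := set21 t x; rewrite h !inE (negbTE ty) (negbTE tz).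
  have tNw : t != w by rewrite eq_sym ne.
  have tNv : t != v by rewrite eq_sym ne.
  have tNu : t != u by apply/negP.
  by rewrite !tx.
have vZ x : erel E v x -> ([set v; x] \in Z) = (x == u) (+) (x == w).
  move=> vx; have vNx := ne _ _ vx; rewrite !inE.
  have q y : ([set v; x] == [set v; y]) = (x == y).
    apply/eqP/eqP => [h|-> //]; have := set22 v x; rewrite h !inE.
    by rewrite eq_sym (negbTE vNx) => /eqP.
  rewrite [[set u; v]]setUC !q.
  have -> : ([set v; x] == [set u; w]) = false.
    apply/eqP => h; have := set21 v x; rewrite h !inE => /orP [] /eqP e.
      by move: vu; rewrite -e erel_irr.
    by move: vw; rewrite -e erel_irr.
  by rewrite addbF.
have f1 : F v w = F u v by have [_ ->] := FP _ _ uv.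
have f2 : F w t = F v w by have [_ ->] := FP _ _ vw.
have f3 : F t w = F w t by have [-> _] := FP _ _ wt; rewrite setUC (negbTE (tZ w)) addbF.
have tv' : erel E t v by rewrite erel_sym.
have f4 : F t w = F t v by apply: (value_const FP) => //; rewrite erel_sym.
have f5 : F v t = F t v by have [-> _] := FP _ _ tv'; rewrite (negbTE (tZ v)) addbF.
have f6 : F v u = ~~ F u v by have [-> _] := FP _ _ uv; rewrite setUC vZ // eqxx (negbTE (ne _ _ uw)) addbT.
have : (t == w) || (F v t == ~~ F u v).
  apply: (rot_connected (P := fun x => (x == w) || (F v x == ~~ F u v)) _ vu tv); last by rewrite f6 eqxx orbT.
  move=> x vx; rewrite (value_next FP vx) vZ //.
  case: (eqVneq x u) => [->|xu]; first by rewrite eqxx.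
  case: (eqVneq x w) => [->|xw] /=; first by rewrite f1 addbT eqxx orbT.
  by rewrite addbF => ->; rewrite orbT.
rewrite f5 -f4 f3 f2 f1 eq_sym (negbTE (ne _ _ wt)) /=; by case: (F u v).
Qed.

(** All faces are triangles, so three times their number is [2 * #|E|]; the conclusion uses the half
    of Euler's formula that requires connectedness. *)
Lemma triangulation_edges : 3 * #|T| <= #|E| + 6.
Proof.
have f1 := euler_le sE PR conn (leq_trans (isT : 0 < 3) T3).
suff f2 : 3 * #|faces E rot| = 2 * #|E| by lia.
apply: (faces_exact sE PR) => -[u v]; rewrite inE /= => uv.
have vu : erel E v u by rewrite erel_sym.
set w := next (rot v) u.
have vw : erel E v w by apply: next_erel vu.
have wv : erel E w v by rewrite erel_sym.
have uw : erel E u w by apply: next_adj vu (next_neq vu).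
have wu : erel E w u by rewrite erel_sym.
have h1 : next (rot w) v = u by apply: next_next.
have h2 : next (rot u) w = v by have := next_next vw; rewrite -/w h1.
have -> : 3 = size [:: (u, v); (v, w); (w, u)] by [].
apply: order_cycle; last by rewrite mem_head.
  by rewrite /= /face /= uv vw wu h1 h2 !eqxx.
have ne x y : erel E x y -> x != y by case/andP.
by rewrite /= !inE !xpair_eqE (negbTE (ne _ _ uv)) (negbTE (ne _ _ uw)) (negbTE (ne _ _ vw)) !andbF.
Qed.

End Triangulation.
End Rotation.

(** * Five colours *)

Definition induced_edges (T : finType) (E : {set {set T}}) (S : {set T}) := [set e in E | e \subset S].

Lemma erel_induced (T : finType) (E : {set {set T}}) (S : {set T}) x y :
  erel (induced_edges E S) x y = [&& erel E x y, x \in S & y \in S].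
Proof. by rewrite /erel inE subUset !sub1set andbA. Qed.

Lemma induced_sub (T : finType) (E : {set {set T}}) (S : {set T}) : induced_edges E S \subset E.
Proof. by apply/subsetP => e; rewrite inE => /andP []. Qed.

Section Colouring.
Variables (T : finType) (E : {set {set T}}).
Hypotheses (sE : simple_graph E) (hE : hplanar E).

(** With all degrees at least 6, the induced subgraph would have at least 3|S| edges. *)
Lemma small_degree (S : {set T}) : S != set0 ->
  exists2 v, v \in S & #|[set u | erel (induced_edges E S) v u]| <= 5.
Proof.
move=> S0; case: (pickP (fun v => (v \in S) && (#|[set u | erel (induced_edges E S) v u]| <= 5))) => [v /andP [vS h]|none].
  by exists v.
have big v : v \in S -> 6 <= #|[set u | erel (induced_edges E S) v u]|.
  by move=> vS; have := none v; rewrite vS /= ltnNge => ->.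
have sS : simple_graph (induced_edges E S) := simple_sub sE (induced_sub _ _).
have eS x y : erel (induced_edges E S) x y -> x \in S by rewrite erel_induced => /and3P [].
have h1 : 6 * #|S| <= 2 * #|induced_edges E S|.
  rewrite -card_darts // sum_deg (bigID (mem S)) /= mulnC -sum_nat_const.
  by apply: leq_trans (leq_addr _ _); apply: leq_sum => v; exact: big.
have S3 : 3 <= #|S|.
  have /set0Pn [v vS] := S0; have := big v vS.
  have : #|[set u | erel (induced_edges E S) v u]| <= #|S|; last by move=> *; lia.
  by apply/subset_leq_card/subsetP => u; rewrite inE erel_induced => /and3P [].
have := planar_edges sS (hplanarW (induced_sub _ _) hE) eS S3; lia.
Qed.

(** The two colours are exchanged on the component of [a] in the subgraph that they span; [c] lies
    outside this component, so afterwards [a] and [c] have the same colour. *)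
Lemma kempe (S : {set T}) (col : T -> 'I_5) (a c : T) :
  (forall x y, x \in S -> y \in S -> erel E x y -> col x != col y) -> a \in S ->
  let A := [pred x | (x \in S) && ((col x == col a) || (col x == col c))] in
  ~~ connect [rel x y | [&& erel E x y, A x & A y]] a c ->
  exists col' : T -> 'I_5, [/\ forall x y, x \in S -> y \in S -> erel E x y -> col' x != col' y,
    col' a = col c, col' c = col c &
    forall x, col x != col a -> col x != col c -> col' x = col x].
Proof.
move=> pc aS A nac.
set r := [rel x y | _] in nac; pose K := connect r a.
have KA x : K x -> A x.
  case/connectP => p; elim/last_ind: p => [|p z _]; first by move=> _ ->; rewrite /= aS eqxx.
  by rewrite rcons_path last_rcons => /andP [_ /and3P [_ _ Az]] ->.
exists (fun x => if K x then tperm (col a) (col c) (col x) else col x); split.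
- move=> x y xS yS xy; case Kx : (K x); case Ky : (K y).
  + by rewrite (inj_eq perm_inj); apply: pc.
  + have := KA x Kx; rewrite /= xS /= => Ax.
    have nAy : ~~ A y.
      apply: (contraFN _ Ky) => Ay; apply: (connect_trans Kx); apply: connect1.
      by apply/and3P; split => //; apply: KA.
    move: nAy; rewrite /= yS /= negb_or => /andP [ya yc].
    by case/orP: Ax => /eqP ->; rewrite ?tpermL ?tpermR eq_sym.
  + have := KA y Ky; rewrite /= yS /= => Ay.
    have nAx : ~~ A x.
      apply: (contraFN _ Kx) => Ax; apply: (connect_trans Ky); apply: connect1.
      by apply/and3P; split => //; [rewrite erel_sym|apply: KA].
    move: nAx; rewrite /= xS /= negb_or => /andP [xa xc].
    by case/orP: Ay => /eqP ->; rewrite ?tpermL ?tpermR.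
  + exact: pc.
- by rewrite /K connect0 tpermL.
- by rewrite /K (negbTE nac).
- by move=> x xa xc; case: ifP => // _; rewrite tpermD // eq_sym.
Qed.

Theorem five_colour : exists col : T -> 'I_5, forall x y, erel E x y -> col x != col y.
Proof.
suff [col h] : exists col : T -> 'I_5, forall x y, x \in [set: T] -> y \in [set: T] -> erel E x y -> col x != col y.
  by exists col => x y; apply: h; rewrite inE.
move: [set: T] => S; have [n] := ubnP #|S|; elim: n S => // n IH S Sn.
have [->|S0] := eqVneq S set0; first by exists (fun _ => ord0) => x y; rewrite inE.
have [v vS dv] := small_degree S0.
have [|col pc] := IH (S :\ v); first by move: Sn; rewrite (cardsD1 v S) vS; lia.
set N := [set u | erel (induced_edges E S) v u] in dv.
suff [col' [c [pc' cN]]] : exists (col' : T -> 'I_5) c,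
    (forall x y, x \in S :\ v -> y \in S :\ v -> erel E x y -> col' x != col' y) /\
    (forall u, u \in N -> col' u != c).
  have NE u : u \in S -> erel E v u -> u \in N by move=> uS vu; rewrite inE erel_induced vu vS uS.
  exists (fun x => if x == v then c else col' x) => x y xS yS xy.
  case: (eqVneq x v) => xv; case: (eqVneq y v) => yv.
  - by move: xy; rewrite xv yv erel_irr.
  - by rewrite eq_sym; apply: cN; apply: NE; rewrite // -xv.
  - by apply: cN; apply: NE; rewrite // -yv erel_sym.
  - by apply: pc'; rewrite // in_setD1 ?xv ?yv.
case: (pickP (fun c => [forall u in N, col u != c])) => [c /forallP h|all].
  by exists col, c; split => // u uN; have := h u; rewrite uN.
have [rot PR] := hE (induced_sub E S).
have sS : simple_graph (induced_edges E S) := simple_sub sE (induced_sub _ _).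
have memN u : (u \in rot v) = (u \in N) by rewrite (planar_rot_mem PR) inE.
have rv := planar_rot_uniq PR v.
have szN : size (rot v) = #|N| by rewrite -(card_uniqP rv); apply: eq_card.
have imN : #|col @: N| = 5.
  transitivity #|[set: 'I_5]|; last by rewrite cardsT card_ord.
  congr #|pred_of_set _|; apply/setP => c; rewrite inE.
  have /negbT := all c; rewrite negb_forall => /existsP [u]; rewrite negb_imply negbK => /andP [uN /eqP <-].
  by apply/imsetP; exists u.
have sz5 : #|N| = 5 by apply/eqP; rewrite eqn_leq dv -imN leq_imset_card.
have cinj : {in N &, injective col} by apply/imset_injP; rewrite imN sz5.
move: szN rv memN; rewrite sz5.
case Er : (rot v) => [|a1 [|a2 [|a3 [|a4 [|a5 [|]]]]]] //= _ rv memN.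
have N1 : a1 \in N by rewrite -memN !inE eqxx.
have N2 : a2 \in N by rewrite -memN !inE eqxx !orbT.
have N3 : a3 \in N by rewrite -memN !inE eqxx !orbT.
have N4 : a4 \in N by rewrite -memN !inE eqxx !orbT.
have NS u : u \in N -> u \in S :\ v.
  by rewrite inE erel_induced => /and3P [/andP [uv _] _ uS]; rewrite in_setD1 eq_sym uv.
have swap a c : a \in N -> c \in N -> a != c ->
    ~~ connect [rel x y | [&& erel E x y, [pred x | (x \in S :\ v) && ((col x == col a) || (col x == col c))] x
         & [pred x | (x \in S :\ v) && ((col x == col a) || (col x == col c))] y]] a c ->
    exists (col' : T -> 'I_5) c,
    (forall x y, x \in S :\ v -> y \in S :\ v -> erel E x y -> col' x != col' y) /\
    (forall u, u \in N -> col' u != c).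
  move=> aN cN ac /(kempe pc (NS a aN)) [col' [p1 p2 p3 p4]].
  have cac : col a != col c by apply: contra ac => /eqP /(cinj _ _ aN cN) ->.
  exists col', (col a); split => // u uN.
  have [->|ua] := eqVneq u a; first by rewrite p2 eq_sym.
  have [->|uc] := eqVneq u c; first by rewrite p3 eq_sym.
  have q1 : col u != col a by apply: contra ua => /eqP /(cinj _ _ uN aN) ->.
  have q2 : col u != col c by apply: contra uc => /eqP /(cinj _ _ uN cN) ->.
  by rewrite p4.
have cne i j : i \in N -> j \in N -> i != j -> col i != col j.
  by move=> iN jN; apply: contra => /eqP /(cinj _ _ iN jN) ->.
move: rv; rewrite !inE !negb_or => /and5P [/and4P [d12 d13 d14 d15] /and3P [d23 d24 d25] /andP [d34 d35] _ _].
(* Either exchange frees a colour for [v]. If both are blocked, two Kempe chains with disjoint pairs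
   of colours join alternating neighbours of [v], so they cross. *)
case: (boolP (connect _ a1 a3)) (swap a1 a3 N1 N3 d13) => [c13 _|_]; last exact.
case: (boolP (connect _ a2 a4)) (swap a2 a4 N2 N4 d24) => [c24 _|_]; last exact.
have lift (A : pred T) x y : (forall z, A z -> z \in S) ->
    connect [rel x y | [&& erel E x y, A x & A y]] x y ->
    connect [rel x y | [&& erel (induced_edges E S) x y, A x & A y]] x y.
  move=> AS; apply: connect_sub => {x y} x y /and3P [xy Ax Ay]; apply: connect1.
  by rewrite /= erel_induced xy !AS // Ax.
have SvS z : z \in S :\ v -> z \in S by rewrite in_setD1 => /andP [].
exfalso; apply: (no_crossing sS PR (v := v) (a := a1) (b := a2) (c := a3) (d := a4) _ _ _ _ _ _ (lift _ _ _ _ c13) (lift _ _ _ _ c24)).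
- by rewrite Er /= !eqxx.
- by rewrite /= !inE eqxx.
- by rewrite /= !inE eqxx.
- move=> x /= /andP [-> /orP [] /eqP ->]; by rewrite negb_or !cne // 1?eq_sym.
- by rewrite /= (NS a1 N1) eqxx.
- by rewrite /= (NS a2 N2) eqxx.
- by move=> z /= /andP [/SvS].
- by move=> z /= /andP [/SvS].
Qed.

End Colouring.

(** * Degrees *)

Definition deg (T : finType) (E : {set {set T}}) v := #|[set u | erel E v u]|.

Definition cross (T : finType) (E : {set {set T}}) (B : {set T}) :=
  [set e in E | [exists x in B, exists y, (y \notin B) && (e == [set x; y])]].

Section Degrees.
Variables (T : finType) (E : {set {set T}}).
Hypothesis sE : simple_graph E.

Lemma cross_sub B : cross E B \subset E.
Proof. by apply/subsetP => e; rewrite inE => /andP []. Qed.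

Lemma erel_cross (B : {set T}) x y : erel (cross E B) x y = erel E x y && ((x \in B) != (y \in B)).
Proof.
rewrite /erel inE -andbA; case: (eqVneq x y) => //= xy; congr (_ && _).
apply/existsP/idP.
  case=> a /andP [aB /existsP [b /andP [bB /eqP /(set2_inj xy) [] [-> ->]]]]; rewrite aB (negbTE bB) //.
case xB : (x \in B); case yB : (y \in B) => //= _.
  by exists x; rewrite xB; apply/existsP; exists y; rewrite yB eqxx.
by exists y; rewrite yB; apply/existsP; exists x; rewrite xB setUC eqxx.
Qed.

Lemma card_cross (B : {set T}) : #|cross E B| = \sum_(x in B) #|[set u | erel E x u & u \notin B]|.
Proof.
pose D := [set d : T * T | [&& erel E d.1 d.2, d.1 \in B & d.2 \notin B]].
have finj : {in D &, injective (fun d : T * T => [set d.1; d.2])}.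
  move=> [a b] [c d]; rewrite !inE /= => /and3P [/andP [ab _] aB bB] /and3P [_ cB dB].
  by case/(set2_inj ab) => -[e1 e2]; subst; rewrite ?cB ?aB // in bB dB *.
have -> : cross E B = [set [set d.1; d.2] | d in D].
  apply/setP => e; apply/idP/imsetP.
    rewrite inE => /andP [eE /existsP [x /andP [xB /existsP [y /andP [yB /eqP ee]]]]].
    exists (x, y) => //; rewrite inE /= xB yB /erel -ee eE !andbT.
    by apply: contraNneq yB => <-.
  case=> -[x y]; rewrite inE /= => /and3P [/andP [_ xyE] xB yB] ->; rewrite inE xyE.
  by apply/existsP; exists x; rewrite xB; apply/existsP; exists y; rewrite yB eqxx.
rewrite (card_in_imset finj) -sum1_card (partition_big fst (mem B)) /=; last first.
  by move=> d; rewrite inE => /and3P [].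
apply: eq_bigr => x xB; rewrite sum1_card -(card_imset (mem [set u | erel E x u & u \notin B]) (f := pair x)); last by move=> a b [].
apply: eq_card => -[a b]; rewrite -topredE /= inE /=; apply/idP/imsetP.
  by case/andP => /and3P [ab aB bB] /eqP e; subst a; exists b => //; rewrite inE ab bB.
by case=> u; rewrite inE => /andP [xu uB] [-> ->]; rewrite xu xB uB eqxx.
Qed.

Lemma card_induced1 u : #|E| = #|induced_edges E [set~ u]| + deg E u.
Proof.
rewrite /deg deg_card // addnC -(cardsID [set e : {set T} | u \in e] E); congr (_ + _).
  by apply: eq_card => e; rewrite !inE.
apply: eq_card => e; rewrite !inE andbC; congr (_ && _).
by rewrite -setTD subsetD1 subsetT.
Qed.

Hypotheses (hE : hplanar E) (mE : #|E| + 6 = 3 * #|T|) (T5 : 5 <= #|T|).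

Lemma cross_bound (B : {set T}) : #|cross E B| + 4 <= 2 * #|T|.
Proof.
rewrite -cardsT; apply: (planar_bip_edges (B := mem B) (simple_sub sE (cross_sub B))
  (hplanarW (cross_sub B) hE)) => [x y|| x y].
- by rewrite inE.
- by rewrite cardsT; apply: leq_trans T5.
- by rewrite erel_cross => /andP [].
Qed.

Lemma sum_degE : \sum_v deg E v = 2 * #|E|.
Proof. by rewrite -card_darts // sum_deg. Qed.

Lemma deg_ge3 v : 3 <= deg E v.
Proof.
have e1 := card_induced1 v.
have eS x y : erel (induced_edges E [set~ v]) x y -> x \in [set~ v] by rewrite erel_induced => /and3P [].
have cS : #|[set~ v]| = #|T|.-1 by rewrite cardsC1.
have := planar_edges (simple_sub sE (induced_sub _ _)) (hplanarW (induced_sub _ _) hE) eS.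
by rewrite cS; lia.
Qed.

End Degrees.

Section MidDegree.
Variables (T : finType) (E : {set {set T}}).
Hypotheses (sE : simple_graph E) (hE : hplanar E) (mE : #|E| + 6 = 3 * #|T|) (T5 : 5 <= #|T|).

(** Deleting both ends removes 5 edges, which leaves 3n - 11 edges on n - 2 vertices, one more than
    3(n - 2) - 6. *)
Lemma deg3_independent u w : erel E u w -> deg E u = 3 -> deg E w = 3 -> False.
Proof.
move=> uw du dw; have /andP [uNw _] := uw.
pose E1 := induced_edges E [set~ u]; pose E2 := induced_edges E1 [set~ w].
have s1 : simple_graph E1 := simple_sub sE (induced_sub _ _).
have c1 : #|E| = #|E1| + deg E u := card_induced1 sE u.
have c2 : #|E1| = #|E2| + deg E1 w := card_induced1 s1 w.
have dw1 : deg E w = (deg E1 w).+1.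
  rewrite /deg (cardsD1 u) inE erel_sym uw add1n; congr _.+1.
  apply: eq_card => x; rewrite !inE erel_induced !inE [w == u]eq_sym uNw /=.
  by rewrite andbC.
have E2E : E2 \subset E by apply: subset_trans (induced_sub _ _) (induced_sub _ _).
have eS x y : erel E2 x y -> x \in ~: [set u; w].
  by rewrite !erel_induced !inE negb_or => /and3P [/and3P [_ -> _] -> _].
have cS : #|~: [set u; w]| + 2 = #|T| by rewrite -(cardsC [set u; w]) cards2 uNw addnC.
have := planar_edges (simple_sub sE E2E) (hplanarW E2E hE) eS; lia.
Qed.

(** Otherwise the vertices of degree 3 form an independent set [B] with 3|B| <= 2n - 4, and all
    others have degree at least 12. The degrees then sum to at least 12n - 9|B| >= 6n + 12, but they
    sum to 6n - 12. *)
Lemma mid_degree : exists v, 4 <= deg E v <= 11.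
Proof.
case: (pickP (fun v => 4 <= deg E v <= 11)) => [v h|none]; first by exists v.
pose B := [set v | deg E v == 3].
have big v : v \notin B -> 12 <= deg E v.
  rewrite inE; have := none v; have := deg_ge3 sE hE mE T5 v.
  by move=> h1 /negbT; rewrite negb_and -!ltnNge => h2 h3; lia.
have c1 : #|cross E B| = 3 * #|B|.
  rewrite card_cross mulnC -sum_nat_const; apply: eq_bigr => x; rewrite inE => /eqP dx.
  rewrite -dx; apply: eq_card => u; rewrite !inE; case: (boolP (erel E x u)) => //= xu.
  by apply/eqP => du; apply: deg3_independent xu dx du.
have c2 := cross_bound sE hE T5 B.
have c3 := sum_degE sE.
have : 3 * #|B| + 12 * #|~: B| <= \sum_v deg E v.
  rewrite (bigID (mem B)) /=; apply: leq_add.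
    by rewrite mulnC -sum_nat_const; apply: leq_sum => x; rewrite inE => /eqP ->.
  rewrite mulnC -sum_nat_const; apply: (@leq_trans (\sum_(i in ~: B) deg E i)).
    by apply: leq_sum => x; rewrite inE; apply: big.
  by rewrite (eq_bigl (fun i => i \notin B)) // => x; rewrite inE.
have := cardsC B; lia.
Qed.

End MidDegree.

(** * Triangles avoiding a wheel or at a vertex of large degree *)

Lemma subseq_nth (T : eqType) (x0 : T) s p a i : a <= i -> i < size s ->
  subseq p (drop i.+1 s) -> subseq (nth x0 s i :: p) (drop a s).
Proof.
move=> ai isz sub; apply: (@subseq_trans _ (drop i s)).
  by rewrite (drop_nth x0 isz) /= eqxx.
by rewrite -(subnK ai) -drop_drop; apply: drop_subseq.
Qed.

Lemma next_nth_succ (T : eqType) (x0 : T) s i : uniq s -> i.+1 < size s ->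
  next s (nth x0 s i) = nth x0 s i.+1.
Proof.
move=> us isz; rewrite next_nth mem_nth ?(ltnW isz) // index_uniq ?(ltnW isz) //.
by case: s us isz => //= y s _ isz; apply: set_nth_default.
Qed.

Section Triangles.
Variables (T : finType) (E : {set {set T}}) (rot : T -> seq T).
Hypotheses (sE : simple_graph E) (PR : planar_rot (erel E) rot).
Hypothesis next_adj : forall v u, erel E v u -> erel E u (next (rot v) u).

(** Each dart [(u, v)] gives a triangle with third corner [next (rot v) u]. For each of the three
    corners, the darts that put this corner into [P] are at most as many as the darts leaving
    [P]. *)
Lemma avoiding_triangle (P : {set T}) : 3 * (\sum_(p in P) deg E p) < 2 * #|E| ->
  exists u v w, [/\ erel E u v, erel E v w, erel E u w & [/\ u \notin P, v \notin P & w \notin P]].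
Proof.
move=> lt; pose A1 := [set d in darts E | d.1 \in P]; pose A2 := [set d in darts E | d.2 \in P].
pose A3 := [set d in darts E | (face E rot d).2 \in P].
have c1 : #|A1| = \sum_(p in P) deg E p.
  rewrite -sum1_card (partition_big fst (mem P)) /=; last by move=> d; rewrite inE => /andP [].
  apply: eq_bigr => p pP; rewrite /deg sum1_card -(card_imset (mem [set u | erel E p u]) (f := pair p)); last by move=> a b [].
  apply: eq_card => -[a b]; rewrite -topredE /= !inE /=; apply/idP/imsetP.
    by case/andP => /andP [ab aP] /eqP e; subst a; exists b => //; rewrite inE.
  by case=> u; rewrite inE => pu [-> ->]; rewrite pu pP eqxx.
have c2 : #|A2| <= #|A1|.
  rewrite -(card_imset (mem A2) (f := fun d : T * T => (d.2, d.1))); last by move=> [a b] [c d] [-> ->].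
  apply/subset_leq_card/subsetP => _ /imsetP [[a b] h ->]; move: h; rewrite !inE /=.
  by rewrite erel_sym.
have c3 : #|A3| <= #|A2|.
  rewrite -(card_imset (mem A3) (face_inj PR)).
  apply/subset_leq_card/subsetP => _ /imsetP [d /setIdP [hd hP] ->].
  by apply/setIdP; rewrite (face_dart PR).
case: (pickP (mem (darts E :\: (A1 :|: A2 :|: A3)))) => [[u v]|none].
  rewrite /= !inE !negb_or => /andP [/andP [/andP [n1 n2] n3] /= uv].
  rewrite uv /= in n1 n2 n3; rewrite /face /= uv /= in n3.
  have vu : erel E v u by rewrite erel_sym.
  by exists u, v, (next (rot v) u); split => //; [apply: next_erel vu|apply: next_adj].
have := cardsID (A1 :|: A2 :|: A3) (darts E); rewrite (card_darts sE).
have -> : #|darts E :\: (A1 :|: A2 :|: A3)| = 0 by apply: eq_card0.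
have h1 : #|darts E :&: (A1 :|: A2 :|: A3)| <= #|A1 :|: A2 :|: A3| := subset_leq_card (subsetIr _ _).
have [h2 _] := leq_card_setU (A1 :|: A2) A3; have [h3 _] := leq_card_setU A1 A2.
rewrite addn0 => h4; exfalso; move: lt; rewrite -h4 -c1 ltnNge => /negP; apply.
apply: leq_trans h1 (leq_trans h2 _); apply: leq_trans (leq_add h3 c3) _.
by lia.
Qed.

Hypothesis hE : hplanar E.

(** Nine edges exceed the bound 2 * 6 - 4 for bipartite planar graphs. *)
Lemma K33 (p q s v z1 z2 : T) : uniq [:: p; q; s; v; z1; z2] ->
  (forall a b, a \in [:: p; q; s] -> b \in [:: v; z1; z2] -> erel E a b) -> False.
Proof.
move=> un adj; pose S := [set x in [:: p; q; s; v; z1; z2]]; pose B := [set x in [:: p; q; s]].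
pose E1 := cross (induced_edges E S) B.
have E1E : E1 \subset E := subset_trans (cross_sub _ _) (induced_sub _ _).
have inS a : (a \in S) = (a \in [:: p; q; s]) || (a \in [:: v; z1; z2]) by rewrite inE -mem_cat.
have cS : #|S| = 6 by rewrite cardsE; apply: (card_uniqP un).
have uB : uniq [:: p; q; s] by apply: (subseq_uniq _ un); exact: (prefix_subseq [:: p; q; s] [:: v; z1; z2]).
have uZ : uniq [:: v; z1; z2] by apply: (subseq_uniq _ un); exact: (suffix_subseq [:: p; q; s] [:: v; z1; z2]).
have ZB z : z \in [:: v; z1; z2] -> z \notin [:: p; q; s].
  move=> zZ; apply/negP => zB; move: un; rewrite -[[:: p, _ & _]]/([:: p; q; s] ++ [:: v; z1; z2]) cat_uniq.
  by case/and3P => _ /hasPn /(_ z zZ); rewrite /= zB.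
have cB : #|B| = 3 by rewrite cardsE; apply: (card_uniqP uB).
have c1 : #|B| * 3 <= #|E1|.
  rewrite /E1 card_cross -sum_nat_const; apply: leq_sum => x; rewrite inE => xB.
  rewrite -[3](card_uniqP uZ); apply/subset_leq_card/subsetP => z zZ.
  rewrite in_set; apply/andP; split; last by rewrite in_set (ZB z zZ).
  by rewrite erel_induced adj // !inS xB zZ orbT.
have eS x y : erel E1 x y -> x \in S by rewrite erel_cross erel_induced => /andP [/and3P []].
have := planar_bip_edges (B := mem B) (simple_sub sE E1E) (hplanarW E1E hE) eS.
rewrite cS; move=> /(_ isT) h; have : #|E1| + 4 <= 2 * 6.
  by apply: h => x y; rewrite erel_cross => /andP [].
by rewrite cB in c1; lia.
Qed.

(* At most five neighbours of [p] are excluded or common to [q] and [s] (no K33),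
   so three of eight disjoint consecutive pairs remain. If each of them meets
   both N(q) and N(s), two do it in the same order, and the paths through [q]
   and [s] cross. *)
Lemma good_pair (p q s v r : T) : uniq [:: p; q; s; v] -> 16 <= deg E p ->
  erel E p v -> erel E q v -> erel E s v -> erel E p q -> erel E p s ->
  exists x y, [/\ erel E p x, erel E p y, erel E x y,
    [/\ x \notin [:: v; q; r; s] & y \notin [:: v; q; r; s]] &
    ~~ erel E x q && ~~ erel E y q \/ ~~ erel E x s && ~~ erel E y s].
Proof.
move=> un dp pv qv sv pq ps.
have sz : 16 <= size (rot p).
  rewrite -(card_uniqP (planar_rot_uniq PR p)); apply: leq_trans dp _.
  by apply/subset_leq_card/subsetP => u; rewrite inE (planar_rot_mem PR).
have rp := planar_rot_uniq PR p.
pose com := [set z | [&& erel E p z, erel E q z, erel E s z & z != v]].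
have ccom : #|com| <= 1.
  rewrite leqNgt; apply/card_gt1P => -[z1 [z2 []]]; rewrite !inE.
  case/and4P => pz1 qz1 sz1 z1v /and4P [pz2 qz2 sz2 z2v] z12.
  have neq a b : erel E a b -> a == b = false by case/andP => /negbTE.
  apply: (@K33 p q s v z1 z2).
    move: un; rewrite /= !inE !negb_or => /and4P [/and3P [-> -> ->] /andP [-> ->] -> _].
    by rewrite ![v == _]eq_sym z1v z2v z12 !neq.
  by move=> a b; rewrite !inE => /or3P [] /eqP -> /or3P [] /eqP ->.
pose x0 := p; pose R i := nth x0 (rot p) i.
pose bad z := z \in [set v; q; r; s] :|: com.
have cbad : #|[set v; q; r; s] :|: com| <= 5.
  apply: leq_trans (leq_card_setU _ _).1 _; rewrite -[5]/(4 + 1); apply: leq_add => //.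
  apply: leq_trans (card_size [:: v; q; r; s]); apply/subset_leq_card/subsetP => z.
  by rewrite !inE -!orbA.
have iR i : i < 16 -> index (R i) (rot p) = i by move=> h; rewrite index_uniq // (leq_trans h).
have eR i : i < 16 -> erel E p (R i) by move=> h; rewrite -(planar_rot_mem PR) mem_nth // (leq_trans h).
have nbad i : i < 16 -> ~~ bad (R i) ->
    [/\ R i \notin [:: v; q; r; s], R i != q, R i != s & ~~ (erel E (R i) q && erel E (R i) s)].
  move=> i16; rewrite /bad in_setU negb_or [_ \in com]in_set => /andP [n nc].
  have [n1 n2 n3 n4] : [/\ R i != v, R i != q, R i != r & R i != s].
    by apply/and4P; move: n; rewrite !inE !negb_or -!andbA.
  rewrite eR // n1 andbT in nc; split => //; last by rewrite (erel_sym E _ q) (erel_sym E _ s).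
  by rewrite !inE !negb_or n1 n2 n3.
(* Sixteen neighbours of [p] form eight disjoint consecutive pairs; a bad vertex spoils at most one
   of them, found by halving its position. *)
pose Jb := [set j : 'I_8 | bad (R j.*2) || bad (R j.*2.+1)].
have j16 (j : 'I_8) : j.*2 < 16 /\ j.*2.+1 < 16 by have := ltn_ord j; lia.
have cJ : #|Jb| <= 5.
  apply: leq_trans cbad; apply: leq_trans (leq_imset_card (fun z => inord (index z (rot p))./2 : 'I_8) _).
  apply/subset_leq_card/subsetP => j; rewrite inE => jb; have [j1 j2] := j16 j.
  apply/imsetP; case/orP: jb => h; [exists (R j.*2)|exists (R j.*2.+1)] => //.
    by rewrite iR // doubleK inord_val.
  by rewrite iR //= uphalf_double inord_val.
pose good x y := ~~ erel E x q && ~~ erel E y q || ~~ erel E x s && ~~ erel E y s.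
case: (pickP (fun j : 'I_8 => (j \notin Jb) && good (R j.*2) (R j.*2.+1))) => [j|none].
  rewrite inE negb_or => /andP [/andP [b1 b2] g]; have [j1 j2] := j16 j.
  have [n1 _ _ _] := nbad _ j1 b1; have [n2 _ _ _] := nbad _ j2 b2.
  exists (R j.*2), (R j.*2.+1); split; try exact: eR; try (by split); last by apply/orP.
  have := next_adj (eR _ j1); rewrite /R next_nth_succ // (leq_trans _ sz) //; lia.
exfalso.
pose G (A B : T) := [set j : 'I_8 | (j \notin Jb) && [&& erel E (R j.*2) A, ~~ erel E (R j.*2) B, erel E (R j.*2.+1) B & ~~ erel E (R j.*2.+1) A]].
(* In a remaining pair that is not good, some member is adjacent to [q] and some member to [s], but
   no member to both; so each has exactly one of them as a neighbour, and not the same one. *)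
have cover : ~: Jb \subset G q s :|: G s q.
  apply/subsetP => j; rewrite in_setC => jJ; have := none j; rewrite jJ /good /= => /negbT g.
  rewrite in_setU [j \in G q s]in_set [j \in G s q]in_set jJ; move: jJ g; rewrite in_set negb_or => /andP [b1 b2]; have [j1 j2] := j16 j.
  have [_ _ _ ] := nbad _ j1 b1; have [_ _ _] := nbad _ j2 b2.
  by case: (erel E (R j.*2) q) (erel E (R j.*2) s) (erel E (R j.*2.+1) q) (erel E (R j.*2.+1) s) => [] [] [] [].
have big : 2 <= #|G q s| \/ 2 <= #|G s q|.
  have h1 := subset_leq_card cover; have [h2 _] := leq_card_setU (G q s) (G s q).
  have h3 := cardsC Jb; rewrite card_ord in h3.
  have h4 := leq_trans h1 h2; apply/orP; rewrite -[_ || _]negbK negb_or -!ltnNge; apply/negP => /andP [h5 h6].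
  by move: h3 h4 h5 h6 cJ; rewrite -[#|~: Jb|]/#|~: Jb|; lia.
have two (A B : T) : 1 < #|G A B| -> A != B -> A != p -> B != p ->
  (forall i, i < 16 -> ~~ bad (R i) -> R i != A /\ R i != B) -> False.
  move=> /card_gt1P [i0 [k0 [i0G k0G ik0]]] AB Ap Bp nAB.
  have [i [k [iG kG ik]]] : exists i k, [/\ i \in G A B, k \in G A B & i < k].
    by case: (ltngtP i0 k0) => [h|h|/val_inj h]; [exists i0, k0|exists k0, i0|rewrite h eqxx in ik0].
  move: iG kG; rewrite !in_set => /andP [iJ /and4P [iA iB iB' iA']] /andP [kJ /and4P [kA kB kB' kA']].
  move: iJ kJ; rewrite !negb_or => /andP [i1 i2] /andP [k1 k2].
  have [i3 i4] := j16 i; have [k3 k4] := j16 k.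
  have lt x : x < 16 -> x < size (rot p) by move=> h; apply: leq_trans h sz.
  have inj x y : x < 16 -> y < 16 -> x != y -> R x != R y.
    by move=> hx hy; rewrite /R nth_uniq // lt.
  have pR x : x < 16 -> p != R x by move/eR => /andP [].
  have [a1 a2] := nAB _ i3 i1; have [a3 a4] := nAB _ i4 i2; have [a5 a6] := nAB _ k3 k1; have [a7 a8] := nAB _ k4 k2.
  have [e1 e2 e3 e4] : [/\ i.*2 != i.*2.+1, i.*2 != k.*2.+1, k.*2 != i.*2.+1 & k.*2 != k.*2.+1].
    by move: (nat_of_ord i) (nat_of_ord k) ik; clear => a b ab; split; lia.
  have d1 := inj _ _ i3 i4 e1; have d2 := inj _ _ i3 k4 e2.
  have d3 := inj _ _ k3 i4 e3; have d4 := inj _ _ k3 k4 e4.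
  apply: (no_crossing sE PR (v := p) (a := R i.*2) (b := R i.*2.+1) (c := R k.*2) (d := R k.*2.+1)
     (A := mem [:: R i.*2; A; R k.*2]) (B := mem [:: R i.*2.+1; B; R k.*2.+1])).
  - rewrite -[rot p]drop0; apply: (@subseq_nth _ x0 _ _ 0 i.*2) => //; first exact: lt.
    apply: (@subseq_nth _ x0 _ _ _ i.*2.+1) => //; first exact: lt.
    apply: (@subseq_nth _ x0 _ _ _ k.*2); [by rewrite -doubleS leq_double|exact: lt|].
    apply: (@subseq_nth _ x0 _ _ _ k.*2.+1) => //; [exact: lt|exact: sub0seq].
  - by rewrite /= !inE !negb_or !pR // eq_sym Ap.
  - by rewrite /= !inE !negb_or !pR // eq_sym Bp.
  - move=> x /=; rewrite !inE => /or3P [] /eqP ->; rewrite !negb_or.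
    + by rewrite d1 a2 d2.
    + by rewrite AB ![A == _]eq_sym a3 a7.
    + by rewrite d3 a6 d4.
  - by rewrite /= inE eqxx.
  - by rewrite /= inE eqxx.
  - apply: (@connect_trans _ _ A); apply: connect1; rewrite /= !inE !eqxx ?orbT //= ?iA // erel_sym kA //.
  - apply: (@connect_trans _ _ B); apply: connect1; rewrite /= !inE !eqxx ?orbT //= ?iB' // erel_sym kB' //.
have [qs sp qp] : [/\ q != s, s != p & q != p].
  move: un; rewrite /= !inE !negb_or => /and4P [/and3P [h1 h2 _] /andP [h3 _] _ _].
  by split => //; rewrite eq_sym.
case: big => h.
  by apply: (two q s h) => // i i16 /nbad [].
by apply: (two s q h) => //; [rewrite eq_sym|move=> i i16 /nbad []].
Qed.

End Triangles.

(** * Counting edges outside a frame *)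

Lemma sum_shift5 (f : nat -> nat) (a : 'I_5) : \sum_(c < 5) f ((a + c) %% 5) = \sum_(c < 5) f c.
Proof. by rewrite [RHS](reindex_inj (@GRing.addrI 'I_5 a)). Qed.

Section Counting.
Variables (T : finType) (E : {set {set T}}) (s : seq T) (x0 : T) (col : T -> 'I_5).
Variable sep : nat -> nat -> bool.
Hypotheses (sE : simple_graph E) (us : uniq s) (proper : forall x y, erel E x y -> col x != col y).
Hypothesis sep_regions : forall r r' : 'I_5, r != r' -> sep (size s + r) (size s + r').

(* Cells: [i < size s] is the vertex number [i] of the frame [s], and
   [size s + r] is the region [r]; [sep i j] means that a drawing extending the
   frame has no edge between the cells [i] and [j]. *)
Definition cell_of_reg (reg : T -> nat) u := if u \in s then index u s else size s + reg u.

Definition outdeg u := #|[set w | erel E u w & w \notin s]|.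

(** The number of regions visible from the cell [i]. Over the five shifts, an outer neighbour of [i]
    lies in a visible region exactly this many times. *)
Definition region_mult i := \sum_(r < 5) ~~ sep i (size s + r).

(* Put the colour classes into the regions, and average over the five cyclic
   shifts of the colours. *)
Lemma shift_bound : exists2 reg : T -> nat, forall u, reg u < 5 &
  forall H : {set {set T}}, H \subset E ->
    (forall x y, erel H x y -> ~~ sep (cell_of_reg reg x) (cell_of_reg reg y)) ->
    5 * #|H| <= 5 * #|induced_edges H [set x in s]| + \sum_(i < size s) region_mult i * outdeg (nth x0 s i).
Proof.
pose reg (c : 'I_5) u := (col u + c) %% 5.
pose cost c := \sum_(x in [set x in s]) #|[set u | [&& erel E x u, u \notin s & ~~ sep (index x s) (size s + reg c u)]]|.
have sumcost : \sum_(c < 5) cost c = \sum_(i < size s) region_mult i * outdeg (nth x0 s i).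
  rewrite exchange_big /= (eq_bigl (fun x => x \in s)); last by move=> x; rewrite inE.
  rewrite -big_uniq //= (big_nth x0) big_mkord; apply: eq_bigr => i _.
  rewrite index_uniq //; set x := nth x0 s i.
  rewrite (eq_bigr (fun c : 'I_5 => \sum_(u in [set u | erel E x u & u \notin s]) ~~ sep i (size s + reg c u))); last first.
    move=> c _; rewrite -sum1_card big_mkcond [RHS]big_mkcond; apply: eq_bigr => u _.
    by rewrite !inE andbA; case: (erel E x u && _) => //=; case: (sep _ _).
  rewrite exchange_big /= mulnC /outdeg -sum_nat_const; apply: eq_bigr => u _.
  exact: (sum_shift5 (fun r => ~~ sep i (size s + r))).
have [c cost5] : exists c, 5 * cost c <= \sum_(c < 5) cost c.
  case: (pickP (fun c => 5 * cost c <= \sum_(c < 5) cost c)) => [c|none]; first by exists c.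
  have lt c : \sum_(c < 5) cost c < 5 * cost c by rewrite ltnNge none.
  have : \sum_(c0 < 5) (\sum_(c < 5) cost c).+1 <= \sum_(c < 5) 5 * cost c by apply: leq_sum => c _.
  by rewrite -big_distrr sum_nat_const card_ord /=; lia.
exists (reg c) => [u|H HE Hsep]; first by rewrite /reg ltn_mod.
rewrite -sumcost; apply: leq_trans (leq_add (leqnn _) cost5).
rewrite -mulnDr leq_mul2l /= -(cardsID (induced_edges H [set x in s]) H) (setIidPr (induced_sub _ _)) leq_add2l.
(* An edge of [H] with no end on the frame would join either two separated regions or two vertices
   of one region, which have the same colour. *)
have cH : H :\: induced_edges H [set x in s] \subset cross H [set x in s].
  apply/subsetP => e /setDP [eH eN]; rewrite inE eH /=.
  have /cards2P [x [y [xy ee]]] : #|e| == 2 by rewrite (sE (subsetP HE e eH)).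
  have xyH : erel H x y by rewrite /erel xy -ee.
  have [xs|xs] := boolP (x \in s); have [ys|ys] := boolP (y \in s).
  - by case/negP: eN; rewrite inE eH ee subUset !sub1set !inE xs ys.
  - by apply/existsP; exists x; rewrite inE xs; apply/existsP; exists y; rewrite inE ys ee eqxx.
  - by apply/existsP; exists y; rewrite inE ys; apply/existsP; exists x; rewrite inE xs ee setUC eqxx.
  - have := Hsep _ _ xyH; rewrite /cell_of_reg (negbTE xs) (negbTE ys).
    have := proper (erel_sub HE xyH); case: (eqVneq (Ordinal (ltn_pmod (col x + c) (isT : 0 < 5)))
      (Ordinal (ltn_pmod (col y + c) (isT : 0 < 5)))) => [h|h _]; last by have := sep_regions h => /= ->.
    case/eqP; apply: val_inj; have /eqP := congr1 val h.
    by rewrite /= eqn_modDr !modn_small // => /eqP.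
apply: leq_trans (subset_leq_card cH) _; rewrite card_cross; apply: leq_sum => x; rewrite inE => xs.
apply/subset_leq_card/subsetP => u; rewrite in_set => /andP [xu us']; rewrite in_set in us'.
rewrite in_set (erel_sub HE xu) us' /=.
by have := Hsep _ _ xu; rewrite /cell_of_reg xs (negbTE us').
Qed.

End Counting.

(** * Frames around a hub *)

Section Hub.
Variables (T : finType) (E : {set {set T}}) (col : T -> 'I_5).
Hypotheses (sE : simple_graph E) (hE : hplanar E) (T5 : 5 <= #|T|).
Hypothesis proper : forall x y, erel E x y -> col x != col y.

Lemma outdeg_hub v P : uniq (v :: P) -> outdeg E (v :: P) v + count (erel E v) P = deg E v.
Proof.
move=> /andP [vP uP]; rewrite /deg -(cardsID [set u in P]) addnC; congr (_ + _).
  rewrite -size_filter -(card_uniqP (filter_uniq _ uP)); apply: eq_card => u.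
  by rewrite mem_filter in_setI !in_set.
apply: eq_card => u; rewrite in_setD !in_set in_cons negb_or andbC.
case: (boolP (erel E v u)) => [vu|]; last by rewrite !andbF.
by have /andP [+ _] := vu; rewrite eq_sym => ->; rewrite !andbT.
Qed.

(** The edges from [P] to the hub and those from [P] out of the frame are all edges between [P] and
    its complement, so together they obey the bipartite bound. *)
Lemma outdeg_rim v P : uniq (v :: P) ->
  \sum_(u <- P) outdeg E (v :: P) u + count (erel E v) P + 4 <= 2 * #|T|.
Proof.
move=> /andP [vP uP]; apply: leq_trans (cross_bound sE hE T5 [set x in P]); rewrite leq_add2r.
have -> : #|cross E [set x in P]| = \sum_(x <- P) #|[set u | erel E x u & u \notin [set x in P]]|.
  by rewrite card_cross big_uniq //; apply: eq_bigl => x; rewrite in_set.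
rewrite big_seq [X in _ <= X]big_seq -sum1_count [X in _ + X]big_mkcond [X in _ + X]big_seq -big_split /=; apply: leq_sum => x _.
rewrite [X in _ <= X](cardsD1 v) in_set in_set vP andbT addnC [erel E x v]erel_sym.
apply: leq_add; first by case: (erel E v x).
apply/subset_leq_card/subsetP => u; rewrite in_set in_cons negb_or => /and3P [xu uv uP'].
by rewrite in_setD1 uv !in_set xu.
Qed.

(** Let [c] be the number of frame vertices adjacent to the hub. The outer degree [deg E v - c] of
    the hub is charged five times and the outer degrees of the rest, at most 2n - 4 - c in total,
    twice; this yields 7c and 8. The vertex [p] is allowed to see [x] further regions. *)
Lemma hub_bound (v p : T) (P : seq T) (sep : nat -> nat -> bool) x (s := v :: p :: P) : uniq s ->
  (forall r r' : 'I_5, r != r' -> sep (size s + r) (size s + r')) ->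
  region_mult s sep 1 <= 2 + x -> (forall i, i < size P -> region_mult s sep i.+2 <= 2) ->
  exists2 reg : T -> nat, forall u, reg u < 5 & forall H : {set {set T}}, H \subset E ->
    (forall y z, erel H y z -> ~~ sep (cell_of_reg s reg y) (cell_of_reg s reg z)) ->
    5 * #|H| + 8 + 7 * count (erel E v) (p :: P) <=
      5 * #|induced_edges H [set y in s]| + 5 * deg E v + 4 * #|T| + x * outdeg E s p.
Proof.
move=> us regs m1 mP.
have [reg regP bound] := @shift_bound T E s v col sep sE us proper regs.
exists reg => // H HE Hsep; have := bound H HE Hsep.
have -> : \sum_(i < size s) region_mult s sep i * outdeg E s (nth v s i) = region_mult s sep 0 * outdeg E s v +
    (region_mult s sep 1 * outdeg E s p + \sum_(i < size P) region_mult s sep i.+2 * outdeg E s (nth v P i)).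
  by rewrite /s /= big_ord_recl big_ord_recl.
have h1 := outdeg_hub us; have h2 := outdeg_rim us.
have h3 : \sum_(i < size P) region_mult s sep i.+2 * outdeg E s (nth v P i) <= 2 * \sum_(u <- P) outdeg E s u.
  rewrite (big_nth v) big_mkord big_distrr /=; apply: leq_sum => i _.
  by rewrite leq_mul2r mP ?orbT.
have h4 : region_mult s sep 0 <= 5.
  apply: (@leq_trans (\sum_(r < 5) 1)); last by rewrite sum_nat_const card_ord.
  by apply: leq_sum => r _; case: (sep _ _).
rewrite big_cons in h2.
have h5 := leq_mul h4 (leqnn (outdeg E s v)); have h6 := leq_mul m1 (leqnn (outdeg E s p)).
move: h1 h2 h3 h5 h6; rewrite -/s.
move: (count _ _) (outdeg E s v) (outdeg E s p) (region_mult s sep 0 * _) (region_mult s sep 1 * _) (\sum_(u <- P) _) => c ov op a b S.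
move: (\sum_(i < _) _) (deg E v) #|H| #|induced_edges _ _| #|T| => S2 d h ind n; clear; nia.
Qed.

End Hub.

(* Vertex 0 is the hub and 1, 2, ... are neighbours of it in cyclic order. In
   [far_edges] 5, 6, 7 is a triangle disjoint from the wheel; in [near_edges] the
   triangle 1, 5, 6 is drawn inside the face 0, 1, 2. *)
Definition fan_edges := [:: (0, 1); (0, 2); (0, 3); (0, 4); (0, 5); (0, 6); (1, 2); (2, 3); (3, 4); (4, 5); (5, 6)].
Definition wheel5_edges := [:: (0, 1); (0, 2); (0, 3); (0, 4); (0, 5); (1, 2); (2, 3); (3, 4); (4, 5); (5, 1)].
Definition wheel4_edges := [:: (0, 1); (0, 2); (0, 3); (0, 4); (1, 2); (2, 3); (3, 4); (4, 1)].
Definition far_edges := wheel4_edges ++ [:: (5, 6); (6, 7); (5, 7)].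
Definition near_edges := wheel4_edges ++ [:: (1, 5); (1, 6); (5, 6)].

(** The interface between counting and drawing: [sep] comes from the geometry of a fixed frame,
    while [s] and [reg] are chosen in the graph. The bound has to hold for every edge set that
    respects [sep], because the outcome of the saturation is not under control. *)
Definition admissible (T : finType) (E : {set {set T}}) k (edges : seq (nat * nat)) (sep : nat -> nat -> bool) :=
  exists (s : seq T) (reg : T -> nat) (x0 : T), [/\ uniq s, size s = k, forall u, reg u < 5,
    forall e, e \in edges -> [set nth x0 s e.1; nth x0 s e.2] \in E &
    forall H : {set {set T}}, H \subset E ->
      (forall y z, erel H y z -> ~~ sep (cell_of_reg s reg y) (cell_of_reg s reg z)) -> #|H| <= #|T| + 7].

(** * The four frames in a triangulation *)

Section Cases.
Variables (T : finType) (E : {set {set T}}) (rot : T -> seq T).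
Hypotheses (sE : simple_graph E) (hE : hplanar E) (mE : #|E| + 6 = 3 * #|T|) (T47 : 47 <= #|T|).
Hypotheses (PR : planar_rot (erel E) rot).
Hypothesis next_adj : forall v u, erel E v u -> erel E u (next (rot v) u).

Lemma erel_rot_cycle v : cycle (erel E) (rot v).
Proof.
apply: (sub_in_cycle (P := [pred x | x \in rot v]) _ _ (cycle_next (planar_rot_uniq PR v))); last by apply/allP.
by move=> x y /=; rewrite (planar_rot_mem PR) => vx _ /eqP <-; apply: next_adj.
Qed.

Lemma size_rotation v : size (rot v) = deg E v.
Proof. by rewrite -(card_uniqP (planar_rot_uniq PR v)); apply: eq_card => u; rewrite (planar_rot_mem PR) inE. Qed.

Lemma induced_bound (H : {set {set T}}) (s : seq T) : H \subset E -> uniq s -> 3 <= size s ->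
  #|induced_edges H [set y in s]| + 6 <= 3 * size s.
Proof.
move=> HE us s3; have IE : induced_edges H [set y in s] \subset E := subset_trans (induced_sub _ _) HE.
have cs : #|[set y in s]| = size s by rewrite cardsE; apply: (card_uniqP us).
rewrite -cs; apply: (planar_edges (simple_sub sE IE) (hplanarW IE hE)); last by rewrite cs.
by move=> x y; rewrite erel_induced => /and3P [].
Qed.

Lemma T5 : 5 <= #|T|. Proof. exact: leq_trans T47. Qed.

(** The constant 48 is 8 + 5 * 8: together with [hub_bound] the last hypothesis gives
    [5 * #|H| < 5 * (#|T| + 8)]. *)
Lemma hub_admissible k edges (sep : nat -> nat -> bool) v p P x (s := v :: p :: P) :
  uniq s -> size s = k ->
  (forall r r' : 'I_5, r != r' -> sep (k + r) (k + r')) ->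
  \sum_(r < 5) ~~ sep 1 (k + r) <= 2 + x ->
  (forall i, i < size P -> \sum_(r < 5) ~~ sep i.+2 (k + r) <= 2) ->
  all (fun e : nat * nat => erel E (nth v s e.1) (nth v s e.2)) edges ->
  (forall (H : {set {set T}}) reg, H \subset E ->
    (forall y z, erel H y z -> ~~ sep (cell_of_reg s reg y) (cell_of_reg s reg z)) ->
    5 * #|induced_edges H [set y in s]| + 5 * deg E v + 4 * #|T| + x * outdeg E s p < 5 * #|T| + 48 + 7 * count (erel E v) (p :: P)) ->
  admissible E k edges sep.
Proof.
move=> us sk regs m1 mP ed fin.
have [col proper] := five_colour sE hE.
have [|||reg regP bound] := @hub_bound T E col sE hE T5 proper v p P sep x us.
- by rewrite -/s sk.
- by rewrite /region_mult -/s sk.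
- by move=> i iP; rewrite /region_mult -/s sk; apply: mP.
exists s, reg, v; split => // [e /(allP ed) /andP [] //|H HE Hsep].
have := bound H HE Hsep; have := fin H reg HE Hsep; rewrite -/s.
move: (count _ _) #|induced_edges _ _| (outdeg _ _ _) => c i o; lia.
Qed.

Lemma fan_admissible (sep : nat -> nat -> bool) v : 6 <= deg E v <= 11 ->
  (forall r r' : 'I_5, r != r' -> sep (7 + r) (7 + r')) ->
  (forall i, 0 < i < 7 -> \sum_(r < 5) ~~ sep i (7 + r) <= 2) ->
  admissible E 7 fan_edges sep.
Proof.
rewrite -size_rotation => dv regs mu.
have := erel_rot_cycle v; have := planar_rot_uniq PR v; have := planar_rot_mem PR v; move: (size_rotation v) dv.
case: (rot v) => [|p1 [|p2 [|p3 [|p4 [|p5 [|p6 tl]]]]]] // dE dv mem un cyc.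
have adj u : u \in [:: p1, p2, p3, p4, p5, p6 & tl] -> erel E v u by rewrite mem.
have vN : v \notin [:: p1, p2, p3, p4, p5, p6 & tl] by rewrite mem erel_irr.
have pre : subseq [:: p1; p2; p3; p4; p5; p6] [:: p1, p2, p3, p4, p5, p6 & tl].
  exact: (prefix_subseq [:: p1; p2; p3; p4; p5; p6] tl).
have all6 : all (erel E v) [:: p1; p2; p3; p4; p5; p6].
  by apply/allP => u /(mem_subseq pre) /adj.
have us : uniq [:: v; p1; p2; p3; p4; p5; p6].
  by rewrite cons_uniq (subseq_uniq pre un) andbT; apply: contra vN; apply: mem_subseq.
move: cyc => /=; rewrite rcons_path => /and5P [c1 c2 c3 c4 /and3P [c5 _ _]].
move: (all6) => /= /and5P [a1 a2 a3 a4 /and3P [a5 a6 _]].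
apply: (@hub_admissible 7 fan_edges sep v p1 [:: p2; p3; p4; p5; p6] 0) => //.
- exact: mu.
- by move=> i i5; apply: mu.
- by rewrite /= a1 a2 a3 a4 a5 a6 c1 c2 c3 c4 c5.
move=> H reg HE _; have := induced_bound HE us isT.
have -> : count (erel E v) [:: p1; p2; p3; p4; p5; p6] = 6 by move: all6; rewrite all_count => /eqP.
(* Seven vertices span at most 15 edges and the hub has degree at most 11, so the inequality follows
   from 75 + 55 + 4n < 5n + 48 + 42. *)
rewrite -dE; move: dv; rewrite /=; move: (T47); move: #|T| #|induced_edges _ _| (size tl); clear; lia.
Qed.

Lemma wheel5_admissible (sep : nat -> nat -> bool) v : deg E v = 5 ->
  (forall r r' : 'I_5, r != r' -> sep (6 + r) (6 + r')) ->
  (forall i, 0 < i < 6 -> \sum_(r < 5) ~~ sep i (6 + r) <= 2) ->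
  admissible E 6 wheel5_edges sep.
Proof.
rewrite -size_rotation => dv regs mu.
have := erel_rot_cycle v; have := planar_rot_uniq PR v; have := planar_rot_mem PR v; move: (size_rotation v) dv.
case: (rot v) => [|p1 [|p2 [|p3 [|p4 [|p5 [|]]]]]] // dE _ mem un /= /and5P [c1 c2 c3 c4 /andP [c5 _]].
have all5 : all (erel E v) [:: p1; p2; p3; p4; p5] by apply/allP => u; rewrite mem.
have us : uniq [:: v; p1; p2; p3; p4; p5] by rewrite cons_uniq un mem erel_irr.
move: (all5) => /= /and5P [a1 a2 a3 a4 /andP [a5 _]].
apply: (@hub_admissible 6 wheel5_edges sep v p1 [:: p2; p3; p4; p5] 0) => //.
- exact: mu.
- by move=> i i4; apply: mu.
- by rewrite /= a1 a2 a3 a4 a5 c1 c2 c3 c4 c5.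
move=> H reg HE _; have := induced_bound HE us isT.
have -> : count (erel E v) [:: p1; p2; p3; p4; p5] = 5 by move: all5; rewrite all_count => /eqP.
(* Six vertices span at most 12 edges: 60 + 25 + 4n < 5n + 48 + 35. *)
by rewrite -dE /=; move: (T47); move: #|T| #|induced_edges _ _|; clear; lia.
Qed.

Section Degree4.
Variables v p q r s : T.
Hypotheses (nbr : forall u, erel E v u = (u \in [:: p; q; r; s])) (un : uniq [:: p; q; r; s]).
Hypotheses (pq : erel E p q) (qr : erel E q r) (rs : erel E r s) (sp : erel E s p).

Lemma hub4 : [/\ uniq [:: v; p; q; r; s], deg E v = 4, erel E v p, erel E v q & erel E v r /\ erel E v s].
Proof.
rewrite cons_uniq un -nbr erel_irr !nbr !inE !eqxx !orbT; split => //.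
rewrite /deg -[4]/(size [:: p; q; r; s]) -(card_uniqP un); by apply: eq_card => u; rewrite inE nbr.
Qed.

Lemma far_admissible (sep : nat -> nat -> bool) a b c :
  erel E a b -> erel E b c -> erel E a c ->
  a \notin [:: v; p; q; r; s] -> b \notin [:: v; p; q; r; s] -> c \notin [:: v; p; q; r; s] ->
  (forall r r' : 'I_5, r != r' -> sep (8 + r) (8 + r')) ->
  (forall i, 0 < i < 8 -> \sum_(r < 5) ~~ sep i (8 + r) <= 2) ->
  admissible E 8 far_edges sep.
Proof.
have [us dv vp vq [vr vs]] := hub4; move=> ab bc ac aK bK cK regs mu.
have ne x y : erel E x y -> x == y = false by case/andP => /negbTE.
have us8 : uniq ([:: v; p; q; r; s] ++ [:: a; b; c]).
  rewrite cat_uniq us /= (negbTE aK) (negbTE bK) (negbTE cK) !inE.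
  by rewrite (ne _ _ ab) (ne _ _ bc) (ne _ _ ac).
apply: (@hub_admissible 8 far_edges sep v p [:: q; r; s; a; b; c] 0) => //.
- exact: mu.
- by move=> i i6; apply: mu.
- by rewrite /= vp vq vr vs pq qr rs sp ab bc ac.
move=> H reg HE _; have := induced_bound HE us8 isT.
(* Eight vertices span at most 18 edges, and only four of them are adjacent to the hub: 90 + 20 + 4n
   < 5n + 48 + 28. *)
rewrite dv /= vp vq vr vs /=; move: (T47); move: #|T| #|induced_edges _ _|; clear; lia.
Qed.

(* As [x] and [y] are drawn inside the triangle [v p q], they are not joined to [r]
   and [s]; this gives the 12 = 9 + 3 edges inside the frame that make the bound
   n + 7 tight. *)
Lemma near_admissible (sep : nat -> nat -> bool) x y :
  erel E p x -> erel E p y -> erel E x y ->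
  x \notin [:: v; q; r; s] -> y \notin [:: v; q; r; s] -> ~~ erel E x q -> ~~ erel E y q ->
  (forall r r' : 'I_5, r != r' -> sep (7 + r) (7 + r')) ->
  \sum_(r < 5) ~~ sep 1 (7 + r) <= 3 ->
  (forall i, 1 < i < 7 -> \sum_(r < 5) ~~ sep i (7 + r) <= 2) ->
  sep 5 3 -> sep 5 4 -> sep 6 3 -> sep 6 4 ->
  admissible E 7 near_edges sep.
Proof.
have [us dv vp vq [vr vs]] := hub4; move=> px py xy xK yK xq yq regs mu1 mu s53 s54 s63 s64.
have ne a b : erel E a b -> a == b = false by case/andP => /negbTE.
have xK' : x \notin [:: v; p; q; r; s].
  by move: xK; rewrite !inE !negb_or [x == p]eq_sym (ne _ _ px).
have yK' : y \notin [:: v; p; q; r; s].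
  by move: yK; rewrite !inE !negb_or [y == p]eq_sym (ne _ _ py).
have vx : erel E v x = false.
  by rewrite nbr; apply/negbTE; apply: contra xK' => h; rewrite in_cons h orbT.
have vy : erel E v y = false.
  by rewrite nbr; apply/negbTE; apply: contra yK' => h; rewrite in_cons h orbT.
have us7 : uniq ([:: v; p; q; r; s] ++ [:: x; y]).
  by rewrite cat_uniq us /= (negbTE xK') (negbTE yK') !inE (ne _ _ xy).
apply: (@hub_admissible 7 near_edges sep v p [:: q; r; s; x; y] 1) => //.
- by move=> i i5; apply: mu.
- by rewrite /= vp vq vr vs pq qr rs sp px py xy.
move=> H reg HE Hsep; have := induced_bound HE us isT.
have ix : index x [:: v, p & [:: q; r; s; x; y]] = 5 := index_uniq v (isT : 5 < size ([:: v; p; q; r; s] ++ [:: x; y])) us7.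
have iy : index y [:: v, p & [:: q; r; s; x; y]] = 6 := index_uniq v (isT : 6 < size ([:: v; p; q; r; s] ++ [:: x; y])) us7.
have ir : index r [:: v, p & [:: q; r; s; x; y]] = 3 := index_uniq v (isT : 3 < size ([:: v; p; q; r; s] ++ [:: x; y])) us7.
have is' : index s [:: v, p & [:: q; r; s; x; y]] = 4 := index_uniq v (isT : 4 < size ([:: v; p; q; r; s] ++ [:: x; y])) us7.
have op : outdeg E [:: v, p & [:: q; r; s; x; y]] p + 7 <= #|T|.
  have cK : #|[set u in [:: v; p; q; r; s; x; y]]| = 7 by rewrite cardsE; apply: (card_uniqP us7).
  rewrite -(cardsC [set u in [:: v; p; q; r; s; x; y]]) cK addnC leq_add2l.
  by apply/subset_leq_card/subsetP => u; rewrite !in_set => /andP [].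
have ind : #|induced_edges H [set z in [:: v, p & [:: q; r; s; x; y]]]| <= #|induced_edges H [set z in [:: v; p; q; r; s]]| + 3.
  have s3 : #|[set [set p; x]; [set p; y]; [set x; y]]| <= 3.
    apply: leq_trans (card_size [:: [set p; x]; [set p; y]; [set x; y]]).
    by apply/subset_leq_card/subsetP => e; rewrite !inE -orbA.
  apply: leq_trans _ (leq_add (leqnn _) s3); apply: leq_trans _ (leq_card_setU _ _).1.
  apply/subset_leq_card/subsetP => e; rewrite inE => /andP [eH eK].
  have eE := subsetP HE e eH; have /cards2P [a [b [ab ee]]] : #|e| == 2 by rewrite (sE eE).
  have abH : erel H a b by rewrite /erel ab -ee.
  have baH : erel H b a by rewrite erel_sym.
  (* Inside the frame, [x] and [y] keep only the edges of the triangle [p x y]: they are not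
     adjacent to [v] and [q], and separated from [r] and [s]. *)
  have far z w : z \in [:: x; y] -> erel H z w -> w \in [:: v; p; q; r; s; x; y] -> w \in [:: p; x; y].
    move=> zin zw; have zwE := erel_sub HE zw.
    have nzv : erel E z v = false by rewrite erel_sym; move: zin; rewrite in_cons inE => /orP [] /eqP ->.
    have nzq : erel E z q = false by move: zin; rewrite in_cons inE => /orP [] /eqP ->; apply/negbTE.
    have zs : sep (index z [:: v, p & [:: q; r; s; x; y]]) 3 && sep (index z [:: v, p & [:: q; r; s; x; y]]) 4.
      by move: zin; rewrite !inE => /orP [] /eqP ->; rewrite ?ix ?iy ?s53 ?s54 ?s63 ?s64.
    have zin' : z \in [:: v, p & [:: q; r; s; x; y]].
      by rewrite -[_ :: _]/([:: v; p; q; r; s] ++ [:: x; y]) mem_cat zin orbT.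
    have := Hsep _ _ zw; rewrite /cell_of_reg zin'.
    rewrite !inE => + /orP [/eqP we|/orP [->|/orP [/eqP we|/orP [/eqP we|/orP [/eqP we|->]]]]] //; rewrite ?orbT //.
    - by rewrite we nzv in zwE.
    - by rewrite we nzq in zwE.
    - by rewrite we eqxx !orbT ir; case/andP: zs => ->.
    - by rewrite we eqxx !orbT is'; case/andP: zs => _ ->.
  have [aK bK] : a \in [:: v; p; q; r; s; x; y] /\ b \in [:: v; p; q; r; s; x; y].
    by move: eK; rewrite ee subUset !sub1set !in_set => /andP [].
  have K5 c : c \in [:: v; p; q; r; s; x; y] -> c \in [:: x; y] \/ c \in [:: v; p; q; r; s].
    by rewrite -[_ :: _]/([:: v; p; q; r; s] ++ [:: x; y]) mem_cat => /orP []; [right|left].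
  have tri c d : c \in [:: x; y] -> erel H c d -> d \in [:: p; x; y] -> [set c; d] \in [set [set p; x]; [set p; y]; [set x; y]].
    rewrite in_cons mem_seq1 => cxy cd dp; rewrite !in_setU !in_set1.
    move: cxy dp cd; rewrite !in_cons orbF => /orP [] /eqP -> /or3P [] /eqP -> cd'.
    - by rewrite setUC eqxx.
    - by move: cd'; rewrite erel_irr.
    - by rewrite eqxx !orbT.
    - by rewrite setUC eqxx !orbT.
    - by rewrite setUC eqxx !orbT.
    - by move: cd'; rewrite erel_irr.
  rewrite in_setU; case: (K5 a aK) => aS.
    by rewrite ee tri ?orbT // (far a).
  case: (K5 b bK) => bS.
    by rewrite ee setUC tri ?orbT // (far b).
  by rewrite inE eH ee subUset !sub1set !in_set aS bS.
(* At most 12 edges inside the frame, and outer degree at most n - 7 at [p]: 60 + 20 + 4n + (n - 7)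
   < 5n + 48 + 28. *)
rewrite dv /= vp vq vr vs vx vy /=; move: op ind (T47).
move: #|T| #|induced_edges _ _| #|induced_edges _ _| (outdeg _ _ _); clear; lia.
Qed.

End Degree4.
End Cases.

(** * Choice of the frame *)

Section Choice.
Variables (T : finType) (E : {set {set T}}) (rot : T -> seq T).
Hypotheses (sE : simple_graph E) (hE : hplanar E) (mE : #|E| + 6 = 3 * #|T|) (T47 : 47 <= #|T|).
Hypotheses (PR : planar_rot (erel E) rot).
Hypothesis next_adj : forall v u, erel E v u -> erel E u (next (rot v) u).
Variables sep1 sep2 sep3 sep4 : nat -> nat -> bool.
Hypotheses (regs1 : forall r r' : 'I_5, r != r' -> sep1 (7 + r) (7 + r'))
  (mult1 : forall i, 0 < i < 7 -> \sum_(r < 5) ~~ sep1 i (7 + r) <= 2).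
Hypotheses (regs2 : forall r r' : 'I_5, r != r' -> sep2 (6 + r) (6 + r'))
  (mult2 : forall i, 0 < i < 6 -> \sum_(r < 5) ~~ sep2 i (6 + r) <= 2).
Hypotheses (regs3 : forall r r' : 'I_5, r != r' -> sep3 (8 + r) (8 + r'))
  (mult3 : forall i, 0 < i < 8 -> \sum_(r < 5) ~~ sep3 i (8 + r) <= 2).
Hypotheses (regs4 : forall r r' : 'I_5, r != r' -> sep4 (7 + r) (7 + r'))
  (mult41 : \sum_(r < 5) ~~ sep4 1 (7 + r) <= 3)
  (mult4 : forall i, 1 < i < 7 -> \sum_(r < 5) ~~ sep4 i (7 + r) <= 2)
  (sep53 : sep4 5 3) (sep54 : sep4 5 4) (sep63 : sep4 6 3) (sep64 : sep4 6 4).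

(** If [x] and [y] avoid [s] instead of [q], the cycle of neighbours is read backwards; its
    direction does not matter for [near_admissible]. *)
Lemma near_rim v p q r s : (forall u, erel E v u = (u \in [:: p; q; r; s])) -> uniq [:: p; q; r; s] ->
  erel E p q -> erel E q r -> erel E r s -> erel E s p -> 16 <= deg E p ->
  admissible E 7 near_edges sep4.
Proof.
move=> nbr un pq qr rs sp dp.
have [us _ vp vq [vr vs]] := hub4 nbr un.
have ps : erel E p s by rewrite erel_sym.
have pv : erel E p v by rewrite erel_sym.
have qv : erel E q v by rewrite erel_sym.
have sv : erel E s v by rewrite erel_sym.
have us4 : uniq [:: p; q; s; v].
  apply: (subseq_uniq (s2 := [:: p; q; r; s; v])); first exact: cat_subseq (subseq_refl [:: p; q]) (subseq_cons [:: s; v] r).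
  by rewrite -(rot_uniq 4).
have [x [y [px py xy [xK yK]]]] := good_pair sE PR next_adj hE r us4 dp pv qv sv pq ps.
case=> /andP [nx ny].
  exact: (near_admissible sE hE mE T47 nbr un pq qr rs sp px py xy xK yK nx ny).
have nbr' u : erel E v u = (u \in [:: p; s; r; q]).
  by rewrite nbr !inE; case: (u == p) (u == q) (u == r) (u == s) => [] [] [] [].
have un' : uniq [:: p; s; r; q].
  by rewrite -[[:: p; s; r; q]]/(p :: rev [:: q; r; s]) cons_uniq mem_rev rev_uniq.
have flip z : z \notin [:: v; q; r; s] -> z \notin [:: v; s; r; q].
  have e : [:: s; r; q] =i [:: q; r; s] by move=> w; rewrite -[[:: s; r; q]]/(rev [:: q; r; s]) mem_rev.
  by rewrite [_ \in v :: _]in_cons [_ \in [:: v, s & _]]in_cons e.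
have sr : erel E s r by rewrite erel_sym.
have rq : erel E r q by rewrite erel_sym.
have qp : erel E q p by rewrite erel_sym.
exact: (near_admissible sE hE mE T47 nbr' un' ps sr rq qp px py xy (flip _ xK) (flip _ yK) nx ny).
Qed.

Theorem some_admissible : admissible E 7 fan_edges sep1 \/ admissible E 6 wheel5_edges sep2 \/
  admissible E 8 far_edges sep3 \/ admissible E 7 near_edges sep4.
Proof.
have T5 : 5 <= #|T| := leq_trans (isT : 5 <= 47) T47.
have [v /andP [d4 d11]] := mid_degree sE hE mE T5.
have [d6|d5] := leqP 6 (deg E v).
  have d611 : 6 <= deg E v <= 11 by rewrite d6.
  by left; apply: (fan_admissible sE hE mE T47 PR next_adj d611 regs1 mult1).
have [d5'|d4'] := eqVneq (deg E v) 5.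
  by right; left; apply: (wheel5_admissible sE hE mE T47 PR next_adj d5' regs2 mult2).
have dv : deg E v = 4 by lia.
right; right.
have := erel_rot_cycle PR next_adj v; have := planar_rot_uniq PR v; have := planar_rot_mem PR v; move: (size_rotation PR v); rewrite dv.
case: (rot v) => [|p [|q [|r [|s [|]]]]] // _ mem un /= /and5P [pq qr rs sp _].
have nbr u : erel E v u = (u \in [:: p; q; r; s]) by rewrite mem.
have rot1 w (a b c d : T) : (forall u, erel E w u = (u \in [:: a; b; c; d])) -> forall u, erel E w u = (u \in [:: b; c; d; a]).
  by move=> h u; rewrite h -(mem_rot 1).
have rotu (a b c d : T) : uniq [:: a; b; c; d] -> uniq [:: b; c; d; a].
  by rewrite -(rot_uniq 1).
have [dp|dp] := leqP 16 (deg E p); first by right; apply: near_rim nbr un pq qr rs sp dp.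
have nbr2 := rot1 _ _ _ _ _ nbr; have un2 := rotu _ _ _ _ un.
have [dq|dq] := leqP 16 (deg E q); first by right; apply: near_rim nbr2 un2 qr rs sp pq dq.
have nbr3 := rot1 _ _ _ _ _ nbr2; have un3 := rotu _ _ _ _ un2.
have [dr|dr] := leqP 16 (deg E r); first by right; apply: near_rim nbr3 un3 rs sp pq qr dr.
have nbr4 := rot1 _ _ _ _ _ nbr3; have un4 := rotu _ _ _ _ un3.
have [ds|ds] := leqP 16 (deg E s); first by right; apply: near_rim nbr4 un4 sp pq qr rs ds.
left; have [us _ vp vq [vr vs]] := hub4 nbr un.
(* All four neighbours have degree at most 15, so the condition follows from 3 * (4 + 4 * 15) = 192
   < 6n - 12. *)
have [|a [b [c [ab bc ac [aP bP cP]]]]] := avoiding_triangle sE PR next_adj (P := [set x in [:: v; p; q; r; s]]).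
  rewrite (eq_bigl (fun x => x \in [:: v; p; q; r; s])); last by move=> x; rewrite inE.
  rewrite -big_uniq // !big_cons big_nil dv; move: dp dq dr ds mE T47; clear.
  by rewrite /=; move: (deg E p) (deg E q) (deg E r) (deg E s) #|E| #|T|; lia.
rewrite !in_set in aP bP cP.
exact: (far_admissible sE hE mE T47 nbr un pq qr rs sp ab bc ac aP bP cP regs3 mult3).
Qed.

End Choice.

(** * Lattice drawings *)

Import Order.TTheory GRing.Theory Num.Theory.

Local Open Scope ring_scope.

Notation ipoint := (int * int)%type.

Definition east (a : ipoint) : ipoint := (a.1 + 1, a.2).
Definition north (a : ipoint) : ipoint := (a.1, a.2 + 1).
Definition west (a : ipoint) : ipoint := (a.1 - 1, a.2).
Definition south (a : ipoint) : ipoint := (a.1, a.2 - 1).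

Definition adj (a b : ipoint) := [|| b == east a, b == north a, b == west a | b == south a].

(* A cell is named by its lower left corner. *)
Definition lcell (a b : ipoint) : ipoint :=
  if b == east a then a else if b == north a then west a
  else if b == west a then south (west a) else south a.

Definition cwnext (b x : ipoint) : ipoint :=
  if x == north b then east b else if x == east b then south b
  else if x == south b then west b else north b.

Lemma adjE (a b : ipoint) :
  adj a b = (b.1 == a.1 + 1) && (b.2 == a.2) || (b.1 == a.1) && (b.2 == a.2 + 1)
     || (b.1 == a.1 - 1) && (b.2 == a.2) || (b.1 == a.1) && (b.2 == a.2 - 1).
Proof. by case: a b => [a1 a2] [b1 b2]; rewrite /adj !xpair_eqE -!orbA. Qed.

Lemma adj_sym (a b : ipoint) : adj a b = adj b a.
Proof. by rewrite !adjE; lia. Qed.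

Lemma adjP (a b : ipoint) : adj a b -> [\/ b = east a, b = north a, b = west a | b = south a].
Proof.
by case/or4P=> /eqP ->; [apply: Or41|apply: Or42|apply: Or43|apply: Or44].
Qed.

Lemma pt_eqE (a b : ipoint) : (a == b) = (a.1 == b.1) && (a.2 == b.2).
Proof. by case: a b => [a1 a2] [b1 b2]; rewrite xpair_eqE. Qed.

Lemma dir_neq (b : ipoint) :
  (((north b == east b) = false) * ((west b == east b) = false) * ((south b == east b) = false) *
  ((east b == north b) = false) * ((west b == north b) = false) * ((south b == north b) = false) *
  ((east b == west b) = false) * ((north b == west b) = false) * ((south b == west b) = false) *
  ((east b == south b) = false) * ((north b == south b) = false) * ((west b == south b) = false))%type.
Proof. by case: b => b1 b2; do ?split; rewrite !xpair_eqE; lia. Qed.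

Definition dirE := (dir_neq, eqxx).

Lemma cwnextE (b : ipoint) :
  ((cwnext b (north b) = east b) * (cwnext b (east b) = south b) * (cwnext b (south b) = west b) *
  (cwnext b (west b) = north b))%type.
Proof. by rewrite /cwnext !dirE. Qed.

Lemma lcellE (b : ipoint) :
  ((lcell b (north b) = west b) * (lcell b (east b) = b) * (lcell b (south b) = south b) *
  (lcell b (west b) = south (west b)))%type.
Proof. by rewrite /lcell !dirE. Qed.

Lemma dirK (b : ipoint) :
  ((east (west b) = b) * (west (east b) = b) * (north (south b) = b) * (south (north b) = b))%type.
Proof.
by case: b => b1 b2; do ?split; rewrite /east /west /north /south /=; congr pair; lia.
Qed.

Lemma dirC (b : ipoint) :
  ((east (north b) = north (east b)) * (west (north b) = north (west b)) *
   (east (south b) = south (east b)) * (west (south b) = south (west b)))%type.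
Proof. by []. Qed.

Lemma lcellEr (b : ipoint) :
  ((lcell (north b) b = b) * (lcell (east b) b = south b) * (lcell (south b) b = south (west b)) *
  (lcell (west b) b = west b))%type.
Proof.
have h := lcellE (north b); have := lcellE (east b); have := lcellE (south b).
have := lcellE (west b); rewrite !dirK !dirC !dirK in h * => h1 h2 h3.
by rewrite !h !h1 !h2 !h3.
Qed.

(** [lcell a b] is the cell to the left of the step from [a] to [b]. To the right of a step leaving
    [b] lies the cell that is to the left of the next step clockwise. *)
Lemma lcell_cw (b x : ipoint) : adj b x -> lcell x b = lcell b (cwnext b x).
Proof. by case/adjP => ->; rewrite cwnextE lcellEr lcellE. Qed.

Lemma adj_cw (b x : ipoint) : adj b x -> adj b (cwnext b x).
Proof. by case/adjP => ->; rewrite cwnextE /adj !dirE. Qed.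

Lemma cw_orbit (b x c : ipoint) : adj b x -> adj b c -> 
  [\/ c = x, c = cwnext b x, c = cwnext b (cwnext b x) |
      c = cwnext b (cwnext b (cwnext b x))].
Proof.
by case/adjP => -> /adjP [] ->; rewrite !cwnextE;
 (by apply: Or41) || (by apply: Or42) || (by apply: Or43) || (by apply: Or44).
Qed.

(** * Functions on cells that change only across walls *)

Section Flat.
Variables (W : rel ipoint) (f : ipoint -> bool).
Hypothesis flat : forall a b, adj a b -> ~~ W a b -> f (lcell a b) = f (lcell b a).

Lemma turn_cw (b x : ipoint) : adj b x -> ~~ W b x -> f (lcell b x) = f (lcell b (cwnext b x)).
Proof. by move=> h /(flat h) ->; rewrite lcell_cw. Qed.

(** A path from [x] through [b] to [c] has the same value on its left before and after [b], as only
    edges that are not walls lie between the two cells. *)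
Lemma turn (b x c : ipoint) : adj b x -> adj b c -> c != x ->
  (forall y, adj b y -> y != x -> y != c -> ~~ W b y) ->
  f (lcell x b) = f (lcell b c).
Proof.
move=> bx bc cx nw; rewrite lcell_cw //.
have ax := adj_cw bx; have axx := adj_cw ax; have axxx := adj_cw axx.
have go y : adj b y -> y != x -> y != c -> f (lcell b y) = f (lcell b (cwnext b y)).
  by move=> h1 h2 h3; apply: turn_cw => //; apply: nw.
case: (cw_orbit bx bc) => ec; subst c; rewrite ?eqxx // in cx *.
- by apply: go => //; move: cx; move/adjP: bx => [] ->; rewrite !cwnextE !dirE.
- by rewrite [LHS]go 1?[LHS]go //; move: cx; move/adjP: bx => [] ->; rewrite !cwnextE !dirE.
Qed.

End Flat.

Definition degpar (Z : rel ipoint) (b : ipoint) : bool :=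
  Z b (east b) (+) Z b (north b) (+) Z b (west b) (+) Z b (south b).

Lemma xor_shift a b c d e :
  a (+) b (+) (c (+) d) (+) e = false -> c (+) b (+) (d (+) e) = a.
Proof. by case: a b c d e => [] [] [] [] []. Qed.

Lemma xor_swap8 a b c d e f g h :
  (a (+) b) (+) (c (+) d) (+) (e (+) f) (+) (g (+) h) =
  (a (+) c (+) e (+) g) (+) (b (+) d (+) f (+) h).
Proof. by case: a b c d e f g h => [] [] [] [] [] [] [] []. Qed.

Section Parity.
Variables (Z : rel ipoint) (M : nat).
Hypothesis Zsym : symmetric Z.
Hypothesis Zeven : forall b, degpar Z b = false.
Hypothesis Zfin : forall a b, (a.1 < - M%:Z) -> Z a b = false.

Let g (n : nat) (j : int) : bool :=
  \big[addb/false]_(m < n) Z (m%:Z - M%:Z, j) (m%:Z - M%:Z, j + 1).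

Let nn (x : int) : nat := if x is Posz n then n else 0%N.

Let gh (n : nat) (j : int) :
  g n j (+) g n (j - 1) = Z (n%:Z - M%:Z - 1, j) (n%:Z - M%:Z, j).
Proof.
elim: n => [|n IH]; first by rewrite /g !big_ord0 Zfin //=; lia.
rewrite /g !big_ord_recr /= -/(g n j) -/(g n (j - 1)).
have -> : n.+1%:Z - M%:Z - 1 = n%:Z - M%:Z by lia.
have -> : n.+1%:Z - M%:Z = n%:Z - M%:Z + 1 by lia.
have -> : j - 1 + 1 = j by lia.
have /= := Zeven (n%:Z - M%:Z, j).
rewrite /degpar /east /north /west /south /=.
rewrite [X in _ (+) _ (+) X (+) _]Zsym [X in _ (+) _ (+) _ (+) X]Zsym -IH.
exact: xor_shift.
Qed.

(** The value of a cell is the parity of the number of vertical edges of [Z] on the ray from the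
    cell to the west, which [Zfin] makes finite. Between two rows it differs by the horizontal edge
    of [Z] at the cell, since all degrees further west are even. *)
Lemma parity_exists :
  exists f : ipoint -> bool, forall a b, adj a b -> f (lcell a b) (+) f (lcell b a) = Z a b.
Proof.
pose f (c : ipoint) := g (nn (c.1 + M%:Z + 1)) c.2.
have hor a : f a (+) f (south a) = Z a (east a).
  rewrite /f /= gh; case: a => i j /=; rewrite /east /=.
  case E : (i + M%:Z + 1) => [n|n] /=.
    have -> : i = n%:Z - M%:Z - 1 by lia.
    by congr (Z _ (_, _)); lia.
  by rewrite !Zfin //=; lia.
have ver a : f (west a) (+) f a = Z a (north a).
  rewrite /f /=; case: a => i j /=; rewrite /north /=.
  have -> : i - 1 + M%:Z + 1 = i + M%:Z by lia.
  have [x0|x0] := lerP 0 (i + M%:Z).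
    have [n E] : exists n : nat, i = n%:Z - M%:Z by exists `|(i + M%:Z)%R|%N; lia.
    have -> : i + M%:Z = n%:Z by lia.
    have -> : n%:Z + 1 = n.+1%:Z by lia.
    by rewrite /nn /g big_ord_recr /= -/(g n j) addbA addbb addFb E.
  rewrite Zfin /=; last by lia.
  have -> : nn (i + M%:Z + 1) = 0%N by case E2 : (i + M%:Z + 1) => [m|m] //=; lia.
  have -> : nn (i + M%:Z) = 0%N by case E2 : (i + M%:Z) => [m|m] //=; lia.
  by rewrite addbb.
exists f => a b /adjP [] ->; rewrite lcellE lcellEr //.
- have := hor (west a); rewrite dirK Zsym => <-; by rewrite addbC.
- have := ver (south a); rewrite dirK Zsym => <-; by rewrite addbC.
Qed.

End Parity.

(** The parity of the number of times the walk uses the edge between [a] and [b]; repeated edges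
    cancel, so overlapping walks can be added. *)
Fixpoint walkpar (s : seq ipoint) (a b : ipoint) : bool :=
  if s is x :: s' then
    (if s' is y :: _ then
      ((a == x) && (b == y)) (+) ((a == y) && (b == x)) (+) walkpar s' a b
     else false)
  else false.

Lemma walkpar_sym s : symmetric (walkpar s).
Proof.
move=> a b; elim: s => //= x [|y s] //= ->.
congr (_ (+) _); rewrite addbC; congr (_ (+) _); by rewrite andbC.
Qed.

Lemma walkpar_mem s a b : walkpar s a b -> (a \in s) && (b \in s).
Proof.
elim: s => //= x [|y s] // IH.
case E : (walkpar (y :: s) a b).
  by move: (IH E) => /andP [ha hb] _; rewrite inE ha orbT /= inE hb orbT.
rewrite addbF => h.
have /orP [] : (a == x) && (b == y) || (a == y) && (b == x) by move: h; do 2 case: (_ && _).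
  by case/andP=> /eqP -> /eqP ->; rewrite !inE !eqxx !orbT.
by case/andP=> /eqP -> /eqP ->; rewrite !inE !eqxx !orbT.
Qed.

Lemma degparD (Z1 Z2 : rel ipoint) b :
  degpar (fun x y => Z1 x y (+) Z2 x y) b = degpar Z1 b (+) degpar Z2 b.
Proof. exact: xor_swap8. Qed.

Lemma walkpar_deg x s b : path adj x s ->
  degpar (walkpar (x :: s)) b = (b == x) (+) (b == last x s).
Proof.
elim: s x => [|y s IH] x /=; first by rewrite addbb.
case/andP=> xy /IH {}IH.
have -> : degpar (fun a b0 => (a == x) && (b0 == y) (+) (a == y) && (b0 == x) (+) walkpar (y :: s) a b0) b
  = (b == x) (+) (b == y) (+) degpar (walkpar (y :: s)) b.
  rewrite degparD; congr (_ (+) _).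
  rewrite degparD; congr (_ (+) _).
    case: (b =P x) => [->|]; last by rewrite /degpar => /eqP/negbTE ->.
    by move/adjP: xy => [] ->; rewrite /degpar eqxx !dirE.
  case: (b =P y) => [->|]; last by rewrite /degpar => /eqP/negbTE ->.
  rewrite adj_sym in xy; by move/adjP: xy => [] ->; rewrite /degpar eqxx !dirE.
rewrite IH; by case: (b == x) (b == y) (b == last y s) => [] [] [].
Qed.

(** * Square boxes and their boundary *)

Definition inbox (r : nat) (c z : ipoint) : bool :=
  [&& c.1 - r%:Z <= z.1, z.1 <= c.1 + r%:Z, c.2 - r%:Z <= z.2 & z.2 <= c.2 + r%:Z].

(** The boundary points of the box, clockwise from the upper right corner; the index [8 * r] gives
    the corner again. *)
Definition ring_pt (r : nat) (c : ipoint) (k : nat) : ipoint :=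
  if (k <= 2 * r)%N then (c.1 + r%:Z, c.2 + r%:Z - k%:Z)
  else if (k <= 4 * r)%N then (c.1 + 3 * r%:Z - k%:Z, c.2 - r%:Z)
  else if (k <= 6 * r)%N then (c.1 - r%:Z, c.2 - 5 * r%:Z + k%:Z)
  else (c.1 - 7 * r%:Z + k%:Z, c.2 + r%:Z).

Lemma ring_pt_per r c : (0 < r)%N -> ring_pt r c (8 * r) = ring_pt r c 0.
Proof.
move=> r0; rewrite /ring_pt; do ! (case: ifP => ? //; try lia).
all: apply/eqP; rewrite xpair_eqE; lia.
Qed.

Lemma ring_pt_box r c k : (k < 8 * r)%N -> inbox r c (ring_pt r c k).
Proof.
by move=> kr; rewrite /ring_pt /inbox; do ! case: ifP => ? /=; lia.
Qed.

Lemma ring_pt_inj r c k l : (k < 8 * r)%N -> (l < 8 * r)%N ->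
  ring_pt r c k = ring_pt r c l -> k = l.
Proof.
by move=> kr lr /eqP; rewrite /ring_pt; do ! (case: ifP => ? /=); rewrite xpair_eqE; lia.
Qed.

Lemma ring_pt_onto r c z y : (0 < r)%N -> inbox r c z -> adj z y -> ~~ inbox r c y ->
  exists2 k, (k < 8 * r)%N & ring_pt r c k = z.
Proof.
case: c z y => c1 c2 [z1 z2] [y1 y2]; rewrite adjE /inbox /= => r0 h1 h2 h3.
case: (boolP (z1 == c1 + r%:Z)) => e1.
  exists (`|(c2 + r%:Z - z2)%R|%N); first by lia.
  by rewrite /ring_pt /=; case: ifP => ?; last lia; apply/eqP; rewrite xpair_eqE; lia.
case: (boolP (z2 == c2 - r%:Z)) => e2.
  exists (`|(c1 + 3 * r%:Z - z1)%R|%N); first by lia.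
  rewrite /ring_pt /=; case: ifP => ?; first lia; case: ifP => ?; last lia.
  by apply/eqP; rewrite xpair_eqE; lia.
case: (boolP (z1 == c1 - r%:Z)) => e3.
  exists (`|(z2 - c2 + 5 * r%:Z)%R|%N); first by lia.
  rewrite /ring_pt /=; do 2 (case: ifP => ?; first lia); case: ifP => ?; last lia.
  by apply/eqP; rewrite xpair_eqE; lia.
exists (`|(z1 - c1 + 7 * r%:Z)%R|%N); first by lia.
rewrite /ring_pt /=; do 3 (case: ifP => ?; first lia).
by apply/eqP; rewrite xpair_eqE; lia.
Qed.

Definition ring_nxt (r k : nat) := if (k.+1 == 8 * r)%N then 0%N else k.+1.

(** The boundary point [b] lies on one of four sides or in one of four corners. The eight cases
    record its predecessor, its successor and its outward directions, so that the turning lemmas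
    need no arithmetic. *)
Lemma ring_dirs r c k : (0 < r)%N -> (k < 8 * r)%N ->
  let x := ring_pt r c k in let b := ring_pt r c k.+1 in
  let d := ring_pt r c (ring_nxt r k).+1 in
  let out z := ~~ inbox r c z in
  exists2 m : nat, (m < 8)%N & 
  match m with
  | 0 => [/\ x = north b, d = south b, out (east b) & ~~ out (west b)]
  | 1 => [/\ x = north b, d = west b, out (east b) & out (south b)]
  | 2 => [/\ x = east b, d = west b, out (south b) & ~~ out (north b)]
  | 3 => [/\ x = east b, d = north b, out (south b) & out (west b)]
  | 4 => [/\ x = south b, d = north b, out (west b) & ~~ out (east b)]
  | 5 => [/\ x = south b, d = east b, out (west b) & out (north b)]
  | 6 => [/\ x = west b, d = east b, out (north b) & ~~ out (south b)]
  | _ => [/\ x = west b, d = south b, out (north b) & out (east b)]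
  end.
Proof.
case: c => c1 c2 r0 kr x b d out.
pose m := if (k.+1 < 2 * r)%N then 0%N else if (k.+1 == 2 * r)%N then 1%N else
  if (k.+1 < 4 * r)%N then 2%N else if (k.+1 == 4 * r)%N then 3%N else
  if (k.+1 < 6 * r)%N then 4%N else if (k.+1 == 6 * r)%N then 5%N else
  if (k.+1 < 8 * r)%N then 6%N else 7%N.
exists m; first by rewrite /m; do ! case: ifP => _.
rewrite /m /x /b /d /out /ring_nxt /north /south /east /west /inbox.
case: ifP => h1; last case: ifP => h2; last case: ifP => h3; last case: ifP => h4;
 last case: ifP => h5; last case: ifP => h6; last case: ifP => h7;
 (case: ifP => h8; [try (exfalso; lia)|try (exfalso; lia)]); rewrite /ring_pt /=;
 do ! (case: ifP => ? /=; try (exfalso; lia)); split => //=; try (congr pair; lia); lia.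
Qed.

Lemma ring_pt_box' r c k : (k <= 8 * r)%N -> inbox r c (ring_pt r c k).
Proof.
by move=> kr; rewrite /ring_pt /inbox; do ! case: ifP => ? /=; lia.
Qed.

Lemma ring_nxt_lt r k : (k < 8 * r)%N -> (ring_nxt r k < 8 * r)%N.
Proof. by rewrite /ring_nxt; case: ifP; lia. Qed.

Section RingTurn.
Variables (W : rel ipoint) (f : ipoint -> bool) (r : nat) (c : ipoint) (k : nat).
Hypothesis flat : forall a b, adj a b -> ~~ W a b -> f (lcell a b) = f (lcell b a).
Hypotheses (r_gt0 : (0 < r)%N) (kr : (k < 8 * r)%N).
Let x := ring_pt r c k.
Let b := ring_pt r c k.+1.
Let d := ring_pt r c (ring_nxt r k).+1.

Let xin : inbox r c x. Proof. exact: ring_pt_box. Qed.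
Let din : inbox r c d. Proof. exact/ring_pt_box'/ring_nxt_lt. Qed.
Let adjd : (adj b (east b) * adj b (north b) * adj b (west b) * adj b (south b))%type.
Proof. by rewrite /adj !eqxx !orbT. Qed.

(** Clockwise round the box the outside is on the left, and the value there can change only at a
    point where a path leaves. *)
Lemma ring_turn : (forall y, adj b y -> ~~ inbox r c y -> ~~ W b y) ->
  f (lcell x b) = f (lcell b d).
Proof.
move=> nw.
have fl y : adj b y -> ~~ inbox r c y -> f (lcell b y) = f (lcell y b).
  by move=> h1 h2; apply: flat => //; apply: nw.
have := ring_dirs c r_gt0 kr; rewrite -/x -/b -/d /=.
case=> [] [|[|[|[|[|[|[|[|m]]]]]]]] // _ [-> -> o1 o2].
all: have := fl _ _ o1; rewrite !adjd => /(_ isT).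
all: try (have := fl _ _ o2; rewrite !adjd => /(_ isT)).
all: clear o1 o2 fl nw; by rewrite ?lcellE ?lcellEr; congruence.
Qed.

Lemma ring_turn_exit y0 : adj b y0 -> ~~ inbox r c y0 ->
  (forall y, adj b y -> ~~ inbox r c y -> y != y0 -> ~~ W b y) ->
  f (lcell x b) = f (lcell b y0) /\ f (lcell y0 b) = f (lcell b d).
Proof.
move=> by0 y0out nw.
have fl y : adj b y -> ~~ inbox r c y -> y != y0 -> f (lcell b y) = f (lcell y b).
  by move=> h1 h2 h3; apply: flat => //; apply: nw.
have y0x : y0 != x by apply: contraNneq y0out => ->.
have y0d : y0 != d by apply: contraNneq y0out => ->.
have := ring_dirs c r_gt0 kr; rewrite -/x -/b -/d /=.
case=> [] [|[|[|[|[|[|[|[|m]]]]]]]] // _ [ex ed o1 o2].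
all: rewrite ex ed in y0x y0d *.
all: have := fl _ _ o1; rewrite !adjd => /(_ isT).
all: try (have := fl _ _ o2; rewrite !adjd => /(_ isT)).
all: move: y0x y0d y0out; case/adjP: by0 => ->; rewrite ?dirE //= => _ _ y0out.
all: try by rewrite y0out in o2.
all: rewrite ?lcellE ?lcellEr; try (move=> h1; try have {}h1 := h1 isT).
all: try (move=> h2; try have {}h2 := h2 isT); by split; congruence.
Qed.

End RingTurn.

Fixpoint pedge (s : seq ipoint) (a b : ipoint) : bool :=
  if s is x :: s' then
    (if s' is y :: _ then (a == x) && (b == y) || pedge s' a b else false)
  else false.

Lemma pedgeP (s : seq ipoint) (a b : ipoint) :
  reflect (exists2 i, (i.+1 < size s)%N & a = nth 0 s i /\ b = nth 0 s i.+1) (pedge s a b).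
Proof.
elim: s => [|x [|y s] IH]; try by apply: (iffP idP) => // -[].
apply: (iffP orP) => [[/andP [/eqP -> /eqP ->]|/IH [i h1 h2]]|[[|i] h1 [h2 h3]]].
- by exists 0%N.
- by exists i.+1.
- by left; rewrite h2 h3 /= !eqxx.
- by right; apply/IH; exists i.
Qed.

Lemma walkpar_pedge (s : seq ipoint) (a b : ipoint) :
  walkpar s a b -> pedge s a b || pedge s b a.
Proof.
elim: s => // x [|y s] // IH.
rewrite /= -/(walkpar (y :: s) a b) -/(pedge (y :: s) a b) -/(pedge (y :: s) b a).
rewrite [_ && (b == x)]andbC.
case E : (walkpar (y :: s) a b); first by case/orP: (IH E) => ->; rewrite ?orbT.
by rewrite addbF; do 2 (case: (_ && _); rewrite /= ?orbT).
Qed.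

Lemma nth_pt_inj (s : seq ipoint) i j : uniq s -> (i < size s)%N -> (j < size s)%N ->
  nth 0 s i = nth 0 s j -> i = j.
Proof. by move=> us si sj /eqP; rewrite nth_uniq // => /eqP. Qed.

Lemma walkpar_fst (x y : ipoint) (s : seq ipoint) : uniq [:: x, y & s] ->
  walkpar [:: x, y & s] x y.
Proof.
move=> /andP [xs _].
have h : walkpar (y :: s) x y = false.
  by apply/negP => /walkpar_mem /andP []; rewrite (negbTE xs).
have xy : x == y = false by move: xs; rewrite inE; case: eqP.
by move: h => /= ->; rewrite !eqxx xy.
Qed.

Lemma inbox_ctr r c : inbox r c c.
Proof. by rewrite /inbox; lia. Qed.

Lemma box_walk (r : nat) (c z : ipoint) : inbox r c z ->
  exists s, [/\ path adj z s, last z s = c & all (inbox r c) (z :: s)].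
Proof.
have [n] := ubnP (`|(z.1 - c.1)%R| + `|(z.2 - c.2)%R|)%N.
elim: n z => // n IH z zn zin.
have step z' : adj z z' -> inbox r c z' ->
    (`|(z'.1 - c.1)%R| + `|(z'.2 - c.2)%R| < `|(z.1 - c.1)%R| + `|(z.2 - c.2)%R|)%N ->
    exists s, [/\ path adj z s, last z s = c & all (inbox r c) (z :: s)].
  move=> h1 h2 h3; case: (IH z') => //; first by lia.
  by move=> s [s1 s2 s3]; exists (z' :: s); rewrite /= h1 zin.
case: (z =P c) => [->|zc]; first by exists [::]; rewrite /= inbox_ctr.
move/eqP: zc; rewrite pt_eqE => zc.
case: (ltrP z.1 c.1) => h1.
  by apply: (step (east z)); rewrite ?adjE /inbox /= in zin *; lia.
case: (ltrP c.1 z.1) => h2.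
  by apply: (step (west z)); rewrite ?adjE /inbox /= in zin *; lia.
case: (ltrP z.2 c.2) => h3.
  by apply: (step (north z)); rewrite ?adjE /inbox /= in zin *; lia.
by apply: (step (south z)); rewrite ?adjE /inbox /= in zin *; lia.
Qed.

(** [Q j] is the value just before the j-th boundary point. It passes from [A u] to [B u] at the
    exit of [u] and stays constant between exits, so the values at consecutive exits match. *)
Lemma pmap_cycle (T : eqType) (ex : nat -> option T) (A B : T -> bool) (Q : nat -> bool) N :
  (forall j, (j < N)%N -> if ex j is Some u then A u = Q j /\ B u = Q j.+1 else Q j.+1 = Q j) ->
  Q N = Q 0%N -> cycle (fun x y => B x == A y) (pmap ex (iota 0 N)).
Proof.
move=> h QN.
have claim n m : (m + n <= N)%N ->
    match pmap ex (iota m n) with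
    | [::] => Q (m + n)%N = Q m
    | u :: s => [/\ A u = Q m, path (fun x y => B x == A y) u s & B (last u s) = Q (m + n)%N]
    end.
  elim: n m => [|n IH] m mn; first by rewrite addn0.
  have /= := IH m.+1; rewrite addSnnS => /(_ mn).
  have := h m; case: (ex m) => [u|] /=; last first.
    case: (pmap _ _) => [|v s] H; rewrite H //; lia.
  move=> H; have {H} [Hu1 Hu2] := H ltac:(lia).
  case: (pmap _ _) => [|v s] /=; first by move=> ->.
  by case=> e1 e2 e3; split; rewrite // Hu2 e1 eqxx.
have := claim N 0%N; rewrite add0n leqnn => /(_ isT).
case: (pmap _ _) => [|u s] // [h1 h2 h3].
by rewrite /= rcons_path h2 h3 QN h1 /=.
Qed.

(* Vertices are disjoint square boxes of radius [rad], edges are lattice paths that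
   meet the boxes of their ends in one point and no other box. *)
Record lmodel (T : finType) (e : rel T) := LModel {
  ctr : T -> ipoint;
  rad : nat;
  pth : T -> T -> seq ipoint;
  rad_gt0 : (0 < rad)%N;
  box_inj : forall u v z, inbox rad (ctr u) z -> inbox rad (ctr v) z -> u = v;
  pth_rev : forall u v, e u v -> pth v u = rev (pth u v);
  pth_size : forall u v, e u v -> (1 < size (pth u v))%N;
  pth_adj : forall u v i, e u v -> (i.+1 < size (pth u v))%N ->
    adj (nth 0 (pth u v) i) (nth 0 (pth u v) i.+1);
  pth_uniq : forall u v, e u v -> uniq (pth u v);
  pth_box : forall u v i w, e u v -> (i < size (pth u v))%N ->
    inbox rad (ctr w) (nth 0 (pth u v) i) =
      (w == u) && (i == 0%N) || (w == v) && (i.+1 == size (pth u v));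
  pth_disj : forall u v u' v' z, e u v -> e u' v' -> z \in pth u v -> z \in pth u' v' ->
    u = u' /\ v = v' \/ u = v' /\ v = u'
}.

Section Model.
Variables (T : finType) (e : rel T).
Hypotheses (e_sym : symmetric e) (eirr : irreflexive e).
Variable L : lmodel e.
Local Notation inb v := (inbox (rad L) (ctr L v)).
Local Notation pt u v := (pth L u v).

Definition port u v := nth 0 (pt u v) 0.
Definition port2 u v := nth 0 (pt u v) 1.

(** All lattice edges inside a box count as walls, so that the paths may be continued to its centre
    in any way. *)
Definition wall a b := [exists v, inb v a && inb v b] ||
  [exists u, exists v, e u v && pedge (pt u v) a b].

Lemma wallP a b : wall a b -> (exists v, inb v a /\ inb v b) \/
  (exists u v i, [/\ e u v, (i.+1 < size (pt u v))%N, a = nth 0 (pt u v) i & b = nth 0 (pt u v) i.+1]).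
Proof.
case/orP=> [/existsP [v /andP [h1 h2]]|/existsP [u /existsP [v /andP [uv /pedgeP [i h1 [h2 h3]]]]]].
  by left; exists v.
by right; exists u, v, i.
Qed.

Lemma size_pth_rev u v : e u v -> size (pt v u) = size (pt u v).
Proof. by move=> uv; rewrite (pth_rev L uv) size_rev. Qed.

Lemma nth_pth_rev u v i : e u v -> (i < size (pt u v))%N ->
  nth 0 (pt v u) i = nth 0 (pt u v) (size (pt u v) - i.+1).
Proof. by move=> uv iu; rewrite (pth_rev L uv) nth_rev. Qed.

Lemma port_in u v : e u v -> port u v \in pt u v.
Proof. by move=> uv; rewrite mem_nth // ltnW // pth_size. Qed.

Lemma port_box u v : e u v -> inb u (port u v).
Proof. by move=> uv; rewrite pth_box ?eqxx // ltnW // pth_size. Qed.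

Lemma port2_out u v : e u v -> ~~ inb u (port2 u v).
Proof.
move=> uv; rewrite pth_box ?pth_size // andbF /=.
by case: eqP uv => [->|//]; rewrite eirr.
Qed.

Lemma port_adj u v : e u v -> adj (port u v) (port2 u v).
Proof. by move=> uv; apply: pth_adj => //; apply: pth_size. Qed.

Lemma port_inj v u u' : e v u -> e v u' -> port v u = port v u' -> u = u'.
Proof.
move=> vu vu' E; have h1 := port_in vu; have h2 := port_in vu'; rewrite -E in h2.
case: (pth_disj vu vu' h1 h2) => [[] //|[eq _]].
by rewrite eq eirr in vu'.
Qed.

Lemma inner_not_wall u v i y : e u v -> (i.+2 < size (pt u v))%N ->
  y != nth 0 (pt u v) i -> y != nth 0 (pt u v) i.+2 -> ~~ wall (nth 0 (pt u v) i.+1) y.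
Proof.
move=> uv si y1 y2; apply/negP => /wallP [[w []]|[u' [v' [j [uv' sj bj yj]]]]].
  rewrite pth_box //=; last by lia.
  by rewrite andbF /= (ltn_eqF si) andbF.
have bin : nth 0 (pt u v) i.+1 \in pt u v by exact/mem_nth/ltnW.
have bin' : nth 0 (pt u v) i.+1 \in pt u' v' by rewrite bj; exact/mem_nth/ltnW.
case: (pth_disj uv uv' bin bin') => [[eu ev]|[eu ev]]; subst u' v'.
  have ej := nth_pt_inj (pth_uniq L uv) (ltnW si) (ltnW sj) bj.
  by rewrite yj -ej eqxx in y2.
rewrite (size_pth_rev uv) in sj.
rewrite [RHS](nth_pth_rev uv (ltnW sj)) in bj.
have ej : i.+1 = (size (pt u v) - j.+1)%N.
  have sj' : (size (pt u v) - j.+1 < size (pt u v))%N by lia.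
  exact: (nth_pt_inj (pth_uniq L uv) (ltnW si) sj' bj).
have ei : (size (pt u v) - j.+2 = i)%N by lia.
by move: y1; rewrite yj (nth_pth_rev uv sj) ei eqxx.
Qed.

Lemma port_not_wall v u y : e v u -> ~~ inb v y -> y != port2 v u -> ~~ wall (port v u) y.
Proof.
move=> vu yo y2; apply/negP => /wallP [[w [h1 h2]]|[u' [v' [j [uv' sj bj yj]]]]].
  by rewrite (box_inj h1 (port_box vu)) (negbTE yo) in h2.
have := port_box vu; rewrite bj pth_box //; last by lia.
case/orP=> [/andP [/eqP ev /eqP ej]|/andP [_]]; last by lia.
subst u' j; have eu := port_inj vu uv' bj; subst v'.
by rewrite yj eqxx in y2.
Qed.

Lemma ring_not_wall v b y : inb v b -> (forall u, e v u -> port v u != b) -> ~~ inb v y ->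
  ~~ wall b y.
Proof.
move=> vb np yo; apply/negP => /wallP [[w [h1 h2]]|[u' [v' [j [uv' sj bj yj]]]]].
  by rewrite (box_inj h1 vb) (negbTE yo) in h2.
move: vb; rewrite bj pth_box //; last by lia.
case/orP=> [/andP [/eqP ev /eqP ej]|/andP [_]]; last by lia.
by subst u' j; move: (np v' uv'); rewrite bj eqxx.
Qed.

Definition exit_at v k : option T :=
  if (k < 8 * rad L)%N then [pick u | e v u && (port v u == ring_pt (rad L) (ctr L v) k)]
  else None.

Definition rotation v : seq T := pmap (exit_at v) (iota 0 (8 * rad L)).

Lemma exit_atP v k u : exit_at v k = Some u ->
  [/\ (k < 8 * rad L)%N, e v u & port v u = ring_pt (rad L) (ctr L v) k].
Proof.
rewrite /exit_at; case: ifP => // kr; case: pickP => // u' /andP [h1 /eqP h2] [<-].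
by [].
Qed.

Lemma port_onto v u : e v u ->
  exists2 k, (k < 8 * rad L)%N & ring_pt (rad L) (ctr L v) k = port v u.
Proof.
move=> vu; apply: (@ring_pt_onto _ _ _ (port2 v u)).
- exact: rad_gt0.
- exact: port_box.
- exact: port_adj.
- exact: port2_out.
Qed.

Lemma mem_rotation v u : (u \in rotation v) = e v u.
Proof.
rewrite /rotation mem_pmap; apply/mapP/idP => [[k _ /esym /exit_atP []//]|vu].
have [k kr kE] := port_onto vu; exists k; first by rewrite mem_iota.
rewrite /exit_at kr; case: pickP => [u' /andP [vu' /eqP h]|/(_ u)].
  by congr Some; apply: (port_inj vu vu'); rewrite h kE.
by rewrite vu kE eqxx.
Qed.

Lemma rotation_uniq v : uniq (rotation v).
Proof.
pose s := mkseq (ring_pt (rad L) (ctr L v)) (8 * rad L).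
apply: (@pmap_uniq _ _ _ (fun u => index (port v u) s)); last exact: iota_uniq.
move=> k; case E : (exit_at v k) => [u|] //=.
case: (exit_atP E) => kr _ ->.
have us : uniq s.
  apply/mkseq_uniqP => i j; rewrite !inE => hi hj; exact: ring_pt_inj.
by rewrite -(@nth_mkseq _ 0 (ring_pt (rad L) (ctr L v)) (8 * rad L)) // index_uniq // size_mkseq.
Qed.

Section FlatModel.
Variable f : ipoint -> bool.
Hypothesis flat : forall a b, adj a b -> ~~ wall a b -> f (lcell a b) = f (lcell b a).

(** The value to the left of the path from [u] to [v], constant along it. These will be the face
    values demanded by [planar_rot]. *)
Definition dval u v := f (lcell (port u v) (port2 u v)).

Lemma dval_path_nth u v i : e u v -> (i.+1 < size (pt u v))%N ->
  f (lcell (nth 0 (pt u v) i) (nth 0 (pt u v) i.+1)) = dval u v.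
Proof.
move=> uv; elim: i => // i IH si; rewrite -IH; last by lia.
apply/esym/(turn flat).
- by rewrite adj_sym pth_adj //; lia.
- exact: pth_adj.
- by apply/eqP => /(nth_pt_inj (pth_uniq L uv) si (ltnW (ltnW si))); lia.
- by move=> y _ h1 h2; apply: inner_not_wall.
Qed.

Lemma dval_path u v : e u v -> f (lcell (port2 v u) (port v u)) = dval u v.
Proof.
move=> uv; have su := pth_size L uv.
rewrite /port2 /port !(nth_pth_rev uv) //; try lia.
rewrite -(@dval_path_nth u v (size (pt u v)).-2) //; last by lia.
by congr (f (lcell (nth _ _ _) (nth _ _ _))); lia.
Qed.

Lemma dval_next u v : e v u -> dval v (next (rotation v) u) = dval u v.
Proof.
move=> vu; have uv : e u v by rewrite e_sym.
pose R := rad L; have R0 : (0 < R)%N := rad_gt0 L.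
pose rp := ring_pt R (ctr L v).
pose prev j := if (j == 0)%N then (8 * R).-1 else j.-1.
(* The value on the outer side of the boundary step that arrives at the point [j]. *)
pose Q j := f (lcell (rp (prev j)) (rp j)).
have cyc : cycle (fun x y => dval x v == dval v y) (rotation v).
  apply: (@pmap_cycle _ _ (dval v) (dval^~ v) Q); last first.
    by rewrite /Q /prev /=; case: ifP => [|_]; [lia|rewrite /rp ring_pt_per].
  move=> j jr.
  have pj : (prev j < 8 * R)%N by rewrite /prev; case: ifP; lia.
  have pjS : rp (prev j).+1 = rp j.
    rewrite /prev; case: eqP => [->|j0]; last by congr rp; lia.
    by rewrite /rp (_ : _.-1.+1 = 8 * R)%N ?ring_pt_per //; lia.
  have pjN : ring_nxt R (prev j) = j.
    by rewrite /ring_nxt /prev; do 2 case: ifP; lia.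
  case E : (exit_at v j) => [w|].
    case/exit_atP: E => _ vw pw.
    have wout := port2_out vw.
    have pb : ring_pt R (ctr L v) (prev j).+1 = port v w by rewrite pw; exact: pjS.
    have := @ring_turn_exit wall f R (ctr L v) (prev j) flat R0 pj (port2 v w).
    rewrite pb pjN; case=> //; first exact: port_adj.
      by move=> y _ h1 h2; apply: port_not_wall.
    move=> h1 h2; split; first by rewrite /Q /rp -pw; exact: esym h1.
    by rewrite -dval_path 1?e_sym // h2 /Q /prev /= pw.
  have pbj : ring_pt R (ctr L v) (prev j).+1 = ring_pt R (ctr L v) j by exact: pjS.
  have := @ring_turn wall f R (ctr L v) (prev j) flat R0 pj.
  rewrite pbj pjN => H; apply/esym/H.
  move=> y _; apply: ring_not_wall; first exact: ring_pt_box.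
  move=> w vw; apply/negP => /eqP pw; move: E; rewrite /exit_at jr.
  by case: pickP => // /(_ w); rewrite vw pw eqxx.
by have /eqP <- := next_cycle cyc (etrans (mem_rotation v u) vu).
Qed.

End FlatModel.
End Model.

(** * Rotations from lattice models *)

Lemma seq_fst_bound (s : seq ipoint) : exists M : nat, forall z, z \in s -> - M%:Z <= z.1.
Proof.
elim: s => [|x s [M IH]]; first by exists 0%N.
exists (M + `|x.1|)%N => z; rewrite inE => /orP [/eqP ->|/IH h]; first by case: x => x y /=; lia.
by apply: le_trans h; lia.
Qed.

Lemma degpar_big (I : finType) (P : pred I) (Z : I -> rel ipoint) b :
  degpar (fun x y => \big[addb/false]_(i | P i) Z i x y) b =
  \big[addb/false]_(i | P i) degpar (Z i) b.
Proof. by rewrite /degpar !big_split. Qed.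

Section Parity.
Variables (T : finType) (e : rel T).
Hypotheses (e_sym : symmetric e) (eirr : irreflexive e).
Variable L : lmodel e.
Local Notation inb v := (inbox (rad L) (ctr L v)).

Lemma path_pth u v : e u v -> path adj (port L u v) (behead (pth L u v)).
Proof.
move=> uv; have := pth_size L uv; have := @pth_adj _ _ L u v ^~ uv.
rewrite /port; case: (pth L u v) => // x s h _ /=.
by apply/(pathP 0) => i si; apply: (h i).
Qed.

Lemma pth_cons u v : e u v -> pth L u v = port L u v :: behead (pth L u v).
Proof. by move/(pth_size L); rewrite /port; case: (pth L u v). Qed.

Lemma last_pth u v : e u v -> last (port L u v) (behead (pth L u v)) = port L v u.
Proof.
move=> uv; rewrite /(port L v u) (nth_pth_rev uv) 1?ltnW ?pth_size // subn1 nth_last.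
by rewrite [in RHS](pth_cons uv).
Qed.

(** The path is prolonged inside the two boxes to their centres. Edges at a common vertex then end
    in a common point, so the prolonged paths of an even subgraph add up to an even set of walls. *)
Lemma edge_parity u v : e u v -> exists Z : rel ipoint,
  [/\ symmetric Z, forall b, degpar Z b = (b == ctr L u) (+) (b == ctr L v),
      forall a b, Z a b -> [\/ inb u a && inb u b, inb v a && inb v b,
         pedge (pth L u v) a b | pedge (pth L u v) b a],
      Z (port L u v) (port2 L u v) & 
      exists M : nat, forall a b, Z a b -> - M%:Z <= a.1].
Proof.
move=> uv; have vu : e v u by rewrite e_sym.
have [s1 [p1 l1 a1]] := box_walk (port_box L uv).
have [s2 [p2 l2 a2]] := box_walk (port_box L vu).
have su := pth_size L uv.
have eP := pth_cons uv.
have eP2 : pth L u v = [:: port L u v, port2 L u v & behead (behead (pth L u v))].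
  by rewrite /port /port2; case: (pth L u v) su => // ? [].
have lastP := last_pth uv.
pose Z a b := walkpar (port L u v :: s1) a b (+) walkpar (pth L u v) a b
   (+) walkpar (port L v u :: s2) a b.
have supp a b : Z a b -> [\/ walkpar (port L u v :: s1) a b,
   walkpar (port L v u :: s2) a b | walkpar (pth L u v) a b].
  rewrite /Z; case: (walkpar (pth L u v) a b); first by move=> _; apply: Or33.
  rewrite addbF; case: (walkpar (port L u v :: s1) a b); first by move=> _; apply: Or31.
  by move=> /= ->; apply: Or32.
exists Z; split.
- by move=> a b; rewrite /Z !(walkpar_sym _ a b).
- move=> b.
  have -> : degpar Z b = degpar (walkpar (port L u v :: s1)) b (+)
      degpar (walkpar (pth L u v)) b (+) degpar (walkpar (port L v u :: s2)) b.
    by rewrite -!degparD.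
  have -> : degpar (walkpar (pth L u v)) b = (b == port L u v) (+) (b == port L v u).
    by rewrite eP walkpar_deg ?lastP //; apply: path_pth.
  rewrite !walkpar_deg // l1 l2.
  by case: (b == _) (b == _) (b == _) (b == _) => [] [] [] [].
- move=> a b /supp [/walkpar_mem /andP [ha hb]|/walkpar_mem /andP [ha hb]|/walkpar_pedge].
  + by apply: Or41; rewrite (allP a1 _ ha) (allP a1 _ hb).
  + by apply: Or42; rewrite (allP a2 _ ha) (allP a2 _ hb).
  + by case/orP => h; [apply: Or43|apply: Or44].
- have out := port2_out eirr L uv.
  have w2 : walkpar (pth L u v) (port L u v) (port2 L u v).
    by rewrite eP2 walkpar_fst // -eP2 pth_uniq.
  have w1 : walkpar (port L u v :: s1) (port L u v) (port2 L u v) = false.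
    apply/negP => /walkpar_mem /andP [_ h2].
    by rewrite (allP a1 _ h2) in out.
  have w3 : walkpar (port L v u :: s2) (port L u v) (port2 L u v) = false.
    apply/negP => /walkpar_mem /andP [h1 _].
    have E := box_inj (allP a2 _ h1) (port_box L uv).
    by move: uv; rewrite E eirr.
  by rewrite /Z w1 w2 w3.
- have [M hM] := seq_fst_bound (port L u v :: s1 ++ pth L u v ++ port L v u :: s2).
  exists M => a b /supp h; apply: hM; rewrite -cat_cons !mem_cat.
  by case: h => /walkpar_mem /andP [-> _]; rewrite ?orbT.
Qed.

(** The prolonged paths of the edges of [z] 2-colour the cells. The colour to the left of a path is
    the face value; it is carried round each box to the next exit because the colour changes only
    across walls. *)
Lemma planar_rotation : planar_rot e (rotation L).
Proof.
split; first exact: rotation_uniq.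
  exact: mem_rotation.
move=> z zsym ze zeven.
have /fin_all_exists [Zf ZP] : forall d : T * T, exists Z : rel ipoint, e d.1 d.2 ->
  [/\ symmetric Z, forall b, degpar Z b = (b == ctr L d.1) (+) (b == ctr L d.2),
      forall a b, Z a b -> [\/ inb d.1 a && inb d.1 b, inb d.2 a && inb d.2 b,
         pedge (pth L d.1 d.2) a b | pedge (pth L d.1 d.2) b a],
      Z (port L d.1 d.2) (port2 L d.1 d.2) & 
      exists M : nat, forall a b, Z a b -> - M%:Z <= a.1].
  case=> u v /=; case: (boolP (e u v)) => [/edge_parity [Z hZ]|_]; first by exists Z.
  by exists (fun _ _ => false).
(* One dart for each edge of [z], as using both would cancel modulo 2. *)
pose P (d : T * T) := z d.1 d.2 && (enum_rank d.1 < enum_rank d.2)%N.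
have PE d : P d -> e d.1 d.2 by case/andP=> /ze.
pose Z a b := \big[addb/false]_(d | P d) Zf d a b.
have Zsupp a b : Z a b -> exists2 d, P d & Zf d a b.
  case: (pickP (fun d => P d && Zf d a b)) => [d /andP [h1 h2]|none]; first by exists d.
  by rewrite /Z big1 // => d Pd; have := none d; rewrite Pd.
have Zsym : symmetric Z.
  by move=> a b; apply: eq_bigr => d /PE /ZP [].
have Zw a b : Z a b -> wall L a b.
  case/Zsupp => d /PE ed; case: (ZP d ed) => _ _ + _ _ => h /h [h1|h1|h1|h1]; apply/orP.
  - by left; apply/existsP; exists d.1.
  - by left; apply/existsP; exists d.2.
  - by right; apply/existsP; exists d.1; apply/existsP; exists d.2; rewrite ed.
  - right; apply/existsP; exists d.2; apply/existsP; exists d.1; rewrite e_sym ed /=.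
    case/pedgeP: h1 => i si [eb east]; apply/pedgeP.
    have sr := size_pth_rev L ed.
    exists (size (pth L d.1 d.2) - i.+2)%N; first by rewrite sr; lia.
    rewrite !(nth_pth_rev ed) //; try lia.
    by rewrite east eb; split; congr nth; lia.
have Zeven b : degpar Z b = false.
  rewrite degpar_big big_addb_odd.
  have -> : odd (\sum_(d | P d) degpar (Zf d) b)%N =
      odd (\sum_(d | P d) ((b == ctr L d.1) + (b == ctr L d.2)))%N.
    rewrite !(big_morph odd oddD (erefl : odd 0 = false)); apply: eq_bigr => d /PE /ZP [_ -> _ _ _].
    by do 2 case: (b == _).
  rewrite big_split /=.
  have -> : (\sum_(d | P d) (b == ctr L d.2) =
      \sum_(d : T * T | z d.1 d.2 && (enum_rank d.2 < enum_rank d.1)) (b == ctr L d.1))%N.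
    have swK : involutive (fun d : T * T => (d.2, d.1)) by case.
    rewrite (reindex_inj (inv_inj swK)) /=.
    by apply: eq_bigl => d; rewrite /P /= zsym.
  have -> : (\sum_(d | P d) (b == ctr L d.1) +
      \sum_(d : T * T | z d.1 d.2 && (enum_rank d.2 < enum_rank d.1)) (b == ctr L d.1) =
      \sum_(d : T * T | z d.1 d.2) (b == ctr L d.1))%N.
    rewrite [RHS](bigID (fun d : T * T => (enum_rank d.1 < enum_rank d.2)%N)) /=.
    congr (_ + _)%N; apply: eq_bigl => d.
    case: (boolP (z d.1 d.2)) => //= zd; rewrite -leqNgt ltn_neqAle.
    have -> // : enum_rank d.2 != enum_rank d.1 :> nat.
    apply/negP => /eqP /val_inj /enum_rank_inj E.
    by have := ze _ _ zd; rewrite E eirr.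
  rewrite -(pair_big_dep xpredT z (fun u _ => (b == ctr L u) : nat)) /=.
  rewrite (big_morph odd oddD (erefl : odd 0 = false)) big1 // => u _.
  rewrite sum_nat_const oddM.
  by have := zeven u; rewrite cardsE => /negbTE ->.
have [M hM] : exists M : nat, forall d, P d -> forall a b, Zf d a b -> - M%:Z <= a.1.
  have /fin_all_exists [Mf hM] : forall d : T * T, exists M : nat, P d ->
      forall a b, Zf d a b -> - M%:Z <= a.1.
    move=> d; case: (boolP (P d)) => [/PE /ZP [_ _ _ _ [M h]]|_]; first by exists M.
    by exists 0%N.
  exists (\max_d Mf d)%N => d Pd a b /(hM d Pd).
  by apply: le_trans; rewrite lerN2 lez_nat (leq_bigmax d).
have Zfin a b : a.1 < - M%:Z -> Z a b = false.
  by move=> aM; apply/negP => /Zsupp [d Pd /(hM d Pd)]; rewrite leNgt aM.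
have [f fP] := parity_exists Zsym Zeven Zfin.
have flat a b : adj a b -> ~~ wall L a b -> f (lcell a b) = f (lcell b a).
  move=> ab; apply: contraNeq => h; apply: Zw; rewrite -fP //.
  by case: (f _) (f _) h => [] [].
exists (dval L f) => u v uv; split; last first.
  by apply: (dval_next e_sym eirr flat); rewrite e_sym.
(* The step out of a box belongs to no box and to no other path, so there the sum has at most one
   term. *)
have Zport x y : e x y -> P (x, y) || ~~ z x y -> Z (port L x y) (port2 L x y) = z x y.
  move=> xy Pxy.
  have other d : P d -> d != (x, y) -> d != (y, x) -> Zf d (port L x y) (port2 L x y) = false.
    move=> Pd d1 d2; have ed := PE _ Pd; case: (ZP d ed) => _ _ sup _ _.
    have nb w : inb w (port L x y) && inb w (port2 L x y) = false.
      apply/negP => /andP [h1 h2]; have E := box_inj h1 (port_box L xy).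
      by rewrite E (negbTE (port2_out eirr L xy)) in h2.
    have nd : port L x y \notin pth L d.1 d.2.
      apply/negP => h; case: (pth_disj xy ed (port_in L xy) h) => [[]|[]] e1 e2.
        by move/eqP: d1; apply; rewrite e1 e2; case: (d).
      by move/eqP: d2; apply; rewrite e1 e2; case: (d).
    apply/negP => /sup; rewrite !nb; case=> // /pedgeP [i si [h1 h2]]; case/negP: nd.
      by rewrite h1 mem_nth // ltnW.
    by rewrite h2 mem_nth.
  case: (boolP (z x y)) Pxy => zxy; rewrite ?orbF ?orbT => Pxy; last first.
    apply/negP => /Zsupp [d Pd]; rewrite other //.
      by apply: contraTneq Pd => ->; rewrite /P /= (negbTE zxy).
    by apply: contraTneq Pd => ->; rewrite /P /= zsym (negbTE zxy).
  rewrite /Z (bigD1 (x, y)) //= big1 ?addbF.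
    by case: (ZP (x, y) (PE _ Pxy)).
  move=> d /andP [Pd dn]; apply: other => //.
  apply: contraTneq Pd => ->; rewrite /P /=; case/andP: Pxy => _ /= h.
  by rewrite ltnNge (ltnW h) andbF.
have main x y : e x y -> P (x, y) || ~~ z x y -> dval L f x y = dval L f y x (+) z x y.
  move=> xy h; rewrite -(Zport x y) // -fP; last exact: port_adj.
  have yx : e y x by rewrite e_sym.
  by rewrite (dval_path flat yx) /dval; case: (f _) (f _) => [] [].
have vu : e v u by rewrite e_sym.
case: (boolP (P (v, u) || ~~ z v u)) => h; first by rewrite main // zsym.
rewrite (main u v) //; last first.
  move: h; rewrite negb_or negbK => /andP [+ zvu]; rewrite /P /= [z u v]zsym zvu /= -leqNgt leq_eqVlt.
  case/orP=> [/eqP /val_inj /enum_rank_inj E|->//].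
  by move: uv; rewrite E eirr.
by rewrite -addbA addbb addbF.
Qed.

End Parity.

(** * Trimming walks to lattice models *)

Lemma last_visit (P : pred ipoint) x s : path adj x s -> has P (x :: s) ->
  exists y t, [/\ path adj y t, P y, last y t = last x s, {subset y :: t <= x :: s} & ~~ has P t].
Proof.
elim: s x => [|z s IH] x /=; first by rewrite orbF => _ Px; exists x, [::]; split.
case/andP => xz zs; case: (boolP (has P (z :: s))) => [h _|h].
  have [y [t [h1 h2 h3 h4 h5]]] := IH z zs h.
  by exists y, t; split => // a /h4 ha; rewrite in_cons ha orbT.
have /= /negbTE -> := h; rewrite orbF => Px; exists x, (z :: s); split => //=.
by rewrite xz.
Qed.

Lemma first_visit (Q : pred ipoint) y t : path adj y t -> Q (last y t) ->
  exists t', [/\ path adj y t', Q (last y t'), {subset t' <= t} &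
    forall z, z \in y :: t' -> Q z -> z = last y t'].
Proof.
elim: t y => [|z t IH] y /=.
  by move=> _ Qy; exists [::]; split => // z; rewrite inE => /eqP.
case/andP => yz zt Ql; case: (boolP (Q y)) => [Qy|nQy].
  by exists [::]; split => // a; rewrite inE => /eqP.
have [t' [h1 h2 h3 h4]] := IH z zt Ql; exists (z :: t'); split => //=.
- by rewrite yz.
- by move=> a; rewrite !inE => /orP [->//|/h3 ->]; rewrite orbT.
- by move=> a; rewrite inE => /orP [/eqP ->|/h4 //]; rewrite (negbTE nQy).
Qed.

(** Start at the last visit to [P], stop at the first visit to [Q] after it, and cut out loops. *)
Lemma cut_walk (P Q : pred ipoint) x s : path adj x s -> P x -> Q (last x s) ->
  (forall z, P z -> Q z -> False) ->
  exists t, [/\ (1 < size t)%N, uniq t, {subset t <= x :: s},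
    forall i, (i.+1 < size t)%N -> adj (nth 0 t i) (nth 0 t i.+1) &
    forall i, (i < size t)%N ->
      P (nth 0 t i) = (i == 0%N) /\ Q (nth 0 t i) = (i.+1 == size t)].
Proof.
move=> xs Px Ql PQ.
have [|y [t [yt Py lt sub nP]]] := last_visit (P := P) xs; first by rewrite /= Px.
rewrite -lt in Ql.
have [t1 [yt1 Ql1 sub1 Q1]] := first_visit yt Ql.
case: (shortenP yt1) Ql1 Q1 => t2 yt2 un2 sub2 Ql2 Q2.
have sub2' z : z \in y :: t2 -> z \in y :: t1.
  by rewrite !inE => /orP [->//|/sub2 ->]; rewrite orbT.
case: t2 => [|z2 t2] in yt2 un2 sub2 Ql2 Q2 sub2' *; first by case: (PQ y).
exists [:: y, z2 & t2]; split => //.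
- move=> z /sub2'; rewrite inE => /orP [/eqP ->|/sub1 zt]; apply: sub.
    exact: mem_head.
  by rewrite inE zt orbT.
- by move=> i si; exact: (pathP 0 yt2).
- move=> i si; have mi : nth 0 [:: y, z2 & t2] i \in [:: y, z2 & t2] by apply: mem_nth.
  split.
    case: i si mi => [|i] si mi; first by move: Py; rewrite /= => ->.
    apply: contraNF nP => Pz; apply/hasP; exists (nth 0 (z2 :: t2) i) => //.
    by apply/sub1/sub2/mem_nth.
  apply/idP/eqP => [Qz|[->]]; last by rewrite (last_nth 0) in Ql2.
  have := Q2 _ (sub2' _ mi) Qz; rewrite (last_nth 0) => E.
  have := nth_pt_inj un2 si _ E; rewrite /= ltnSn => /(_ isT) -> //.
Qed.

(* As [lmodel], but a walk may visit the boxes of its ends repeatedly. *)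
Definition weak_model (T : finType) (e : rel T) : Prop :=
  exists (c : T -> ipoint) (r : nat) (w : T -> T -> seq ipoint),
  [/\ (0 < r)%N, forall u v z, inbox r (c u) z -> inbox r (c v) z -> u = v,
    forall u v, e u v -> exists x s, [/\ w u v = x :: s, path adj x s,
        inbox r (c u) x & inbox r (c v) (last x s)],
    forall u v z x, e u v -> z \in w u v -> inbox r (c x) z -> x = u \/ x = v &
    forall u v u' v' z, e u v -> e u' v' -> z \in w u v -> z \in w u' v' ->
      u = u' /\ v = v' \/ u = v' /\ v = u'].

Lemma weak_modelP (T : finType) (e : rel T) : symmetric e -> irreflexive e ->
  weak_model e -> exists L : lmodel e, True.
Proof.
move=> e_sym eirr [c [r [w [r0 binj wP w3 wd]]]].
have /fin_all_exists [p pP] : forall d : T * T, exists t, e d.1 d.2 ->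
  [/\ (1 < size t)%N, uniq t, {subset t <= w d.1 d.2},
    forall i, (i.+1 < size t)%N -> adj (nth 0 t i) (nth 0 t i.+1) &
    forall i, (i < size t)%N ->
      inbox r (c d.1) (nth 0 t i) = (i == 0%N) /\ inbox r (c d.2) (nth 0 t i) = (i.+1 == size t)].
  case=> u v /=; case: (boolP (e u v)) => [uv|_]; last by exists [::].
  have [x [s [west xs hx hl]]] := wP u v uv.
  have [|t ht] := cut_walk xs hx hl; last by exists t; rewrite west.
  by move=> z h1 h2; have E := binj _ _ _ h1 h2; rewrite E eirr in uv.
(* [w u v] and [w v u] need not be the reverse of each other, so one of the two serves both
   darts. *)
pose q u v := if (enum_rank u < enum_rank v)%N then p (u, v) else rev (p (v, u)).
have rk u v : e u v -> ~~ (enum_rank u < enum_rank v)%N -> (enum_rank v < enum_rank u)%N.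
  move=> uv; rewrite -leqNgt leq_eqVlt => /orP [/eqP /val_inj /enum_rank_inj E|//].
  by rewrite E eirr in uv.
have qP u v : e u v -> [/\ (1 < size (q u v))%N, uniq (q u v), {subset q u v <= [predU w u v & w v u]},
    forall i, (i.+1 < size (q u v))%N -> adj (nth 0 (q u v) i) (nth 0 (q u v) i.+1) &
    forall i, (i < size (q u v))%N -> inbox r (c u) (nth 0 (q u v) i) = (i == 0%N) /\
       inbox r (c v) (nth 0 (q u v) i) = (i.+1 == size (q u v))].
  move=> uv; have vu : e v u by rewrite e_sym.
  rewrite /q; case: ifP => _.
    have [h1 h2 h3 h4 h5] := pP (u, v) uv; split => // z /h3 /= h.
    by rewrite inE /= h.
  have [h1 h2 h3 h4 h5] := pP (v, u) vu; rewrite size_rev; split => //.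
  - by rewrite rev_uniq.
  - by move=> z; rewrite mem_rev => /h3 /= h; rewrite inE /= h orbT.
  - move=> i si; rewrite !nth_rev //; last by exact: ltnW.
    rewrite adj_sym; set n := size _ in si *.
    have -> : (n - i.+1 = (n - i.+2).+1)%N by lia.
    by apply: h4; rewrite -/n; lia.
  - move=> i si; rewrite nth_rev //.
    move: h5 si; set n := size _ => h5 si.
    have [|g1 g2] := h5 (n - i.+1)%N; first by lia.
    by rewrite /= in g1 g2 *; rewrite g1 g2; split; apply/eqP/eqP; lia.
have q3 u v z x : e u v -> z \in q u v -> inbox r (c x) z -> x = u \/ x = v.
  move=> uv zq; have vu : e v u by rewrite e_sym.
  case: (qP _ _ uv) => _ _ /(_ z zq) /orP [] /= h _ _.
    exact: w3 uv h.
  by move/(w3 _ _ _ _ vu h); case; [right|left].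
unshelve eexists; last by [].
apply: (@LModel _ e c r q) => //.
- move=> u v uv; rewrite /q; case: (boolP (enum_rank u < enum_rank v)%N) => h.
    by rewrite ltnNge (ltnW h).
  by rewrite (rk _ _ uv h) revK.
- by move=> u v /qP [].
- by move=> u v i /qP [_ _ _ h _]; apply: h.
- by move=> u v /qP [].
- move=> u v i x uv si; have [_ _ _ _ /(_ i si) [h1 h2]] := qP _ _ uv.
  have uNv : (u == v) = false by apply: contraTF uv => /eqP ->; rewrite eirr.
  case: (x =P u) => [->|xu]; first by rewrite h1 uNv /= orbF.
  case: (x =P v) => [->|xv]; first by rewrite h2.
  apply/negP => /(q3 u v _ _ uv); case=> //; by rewrite mem_nth.
- move=> u v u' v' z uv uv' h1 h2; have vu : e v u by rewrite e_sym.
  have vu' : e v' u' by rewrite e_sym.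
  case: (qP _ _ uv) => _ _ /(_ z h1) /orP [] /= g1 _ _;
  case: (qP _ _ uv') => _ _ /(_ z h2) /orP [] /= g2 _ _.
  + exact: wd g1 g2.
  + by case: (wd _ _ _ _ _ uv vu' g1 g2) => [[-> ->]|[-> ->]]; [right|left].
  + by case: (wd _ _ _ _ _ vu uv' g1 g2) => [[-> ->]|[-> ->]]; [right|left].
  + by case: (wd _ _ _ _ _ vu vu' g1 g2) => [[-> ->]|[-> ->]]; [left|right].
Qed.

(* The point at distance k from 4a on the segment from 4a to 4b. *)
Definition on4 (a b : ipoint) (k : nat) : ipoint :=
  (4 * a.1 + k%:Z * (b.1 - a.1), 4 * a.2 + k%:Z * (b.2 - a.2)).

Lemma on4_share a b a' b' k k' : adj a b -> adj a' b' -> (k <= 4)%N -> (k' <= 4)%N ->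
  on4 a b k = on4 a' b' k' -> [\/ a = a', a = b', b = a' | b = b'].
Proof.
move=> ab ab' k4 k4' E.
suff : [|| a == a', a == b', b == a' | b == b'].
  by case/or4P => /eqP; [apply: Or41|apply: Or42|apply: Or43|apply: Or44].
move/eqP: E; rewrite /on4 xpair_eqE !pt_eqE; case: a ab => a1 a2 ab; case: a' ab' => c1 c2 ab'.
case/adjP: ab => ->; case/adjP: ab' => -> /=.
all: have e1 (x : int) : x + 1 - x = 1 by lia.
all: have e2 (x : int) : x - 1 - x = -1 by lia.
all: have e3 (x : int) : x - x = 0 by lia.
all: rewrite ?e1 ?e2 ?e3; lia.
Qed.

(** After scaling by 4 the boxes are widened by 1, so that a new edge can enter them from a touching
    cell; a refined lattice edge still meets such a box only if the old edge had an end in the old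
    box. *)
Lemma on4_box a b k c r : adj a b -> (k <= 4)%N ->
  inbox (4 * r + 1) (4 * c.1, 4 * c.2) (on4 a b k) -> inbox r c a \/ inbox r c b.
Proof.
move=> ab k4; suff : inbox (4 * r + 1) (4 * c.1, 4 * c.2) (on4 a b k) -> inbox r c a || inbox r c b.
  by move=> H /H /orP.
rewrite /on4 /inbox; case: a ab => a1 a2 ab; case/adjP: ab => -> /=.
all: have e1 (x : int) : x + 1 - x = 1 by lia.
all: have e2 (x : int) : x - 1 - x = -1 by lia.
all: have e3 (x : int) : x - x = 0 by lia.
all: rewrite ?e1 ?e2 ?e3; lia.
Qed.

Fixpoint refine4 (a : ipoint) (s : seq ipoint) : seq ipoint :=
  if s is b :: s' then
    [:: on4 a b 1, on4 a b 2, on4 a b 3, on4 a b 4 & refine4 b s'] else [::].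

Lemma on4_start a b : on4 a b 0 = (4 * a.1, 4 * a.2).
Proof. by rewrite /on4 !mul0r !addr0. Qed.

Lemma on4_end a b : on4 a b 4 = (4 * b.1, 4 * b.2).
Proof. by rewrite /on4; congr pair; lia. Qed.

Lemma on4_adj a b k : adj a b -> adj (on4 a b k) (on4 a b k.+1).
Proof.
case: a => a1 a2 /adjP [] ->; rewrite adjE /on4 /=.
all: have e1 (x : int) : x + 1 - x = 1 by lia.
all: have e2 (x : int) : x - 1 - x = -1 by lia.
all: have e3 (x : int) : x - x = 0 by lia.
all: rewrite ?e1 ?e2 ?e3; lia.
Qed.

Lemma refine4_path a s : path adj a s -> path adj (4 * a.1, 4 * a.2) (refine4 a s).
Proof.
elim: s a => //= b s IH a /andP [ab /IH h].
by rewrite -{1}(on4_start a b) !on4_adj //= on4_end.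
Qed.

Lemma refine4_last a s : last (4 * a.1, 4 * a.2) (refine4 a s) =
  (4 * (last a s).1, 4 * (last a s).2).
Proof. by elim: s a => //= b s IH a; rewrite on4_end IH. Qed.

Lemma refine4_mem a s z : path adj a s -> s != [::] ->
  z \in (4 * a.1, 4 * a.2) :: refine4 a s ->
  exists a' b' k, [/\ pedge (a :: s) a' b', adj a' b', (k <= 4)%N & z = on4 a' b' k].
Proof.
elim: s a => // b s IH a /= /andP [ab bs] _.
rewrite !inE => zs.
have base k : (k <= 4)%N -> z = on4 a b k -> exists a' b' k', 
    [/\ (a' == a) && (b' == b) || pedge (b :: s) a' b', adj a' b', (k' <= 4)%N & z = on4 a' b' k'].
  by move=> k4 zE; exists a, b, k; rewrite !eqxx.
case: s IH bs zs base => [|d s] IH bs zs base.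
  move: zs; rewrite !orbA => zs.
  by case/orP: zs => // /orP [/orP [/orP [/orP []|]|]|] /eqP zE;
    [apply: (base 0%N); rewrite ?on4_start|apply: (base 1%N)|apply: (base 2%N)
     |apply: (base 3%N)|apply: (base 4%N)].
case: (boolP (z \in (4 * b.1, 4 * b.2) :: refine4 b (d :: s))) => zb.
  have [a' [b' [k [h1 h2 h3 h4]]]] := IH b bs isT zb.
  by exists a', b', k; split => //; apply/orP; right; exact: h1.
move: zs; rewrite inE negb_or in zb; case/andP: zb => _ /negbTE ->; rewrite orbF !orbA => zs.
by case/orP: zs => [/orP [/orP [/orP []|]|]|] /eqP zE;
    [apply: (base 0%N); rewrite ?on4_start|apply: (base 1%N)|apply: (base 2%N)
     |apply: (base 3%N)|apply: (base 4%N)].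
Qed.

(** * Adding an edge to a lattice model *)

Section Add.
Variables (T : finType) (e : rel T).
Hypotheses (e_sym : symmetric e) (eirr : irreflexive e).
Variable L : lmodel e.
Local Notation inb v := (inbox (rad L) (ctr L v)).

Lemma pedge_rev u v a b : e u v -> pedge (pth L u v) a b -> pedge (pth L v u) b a.
Proof.
move=> uv /pedgeP [i si [east eb]]; apply/pedgeP.
have sr := size_pth_rev L uv.
exists (size (pth L u v) - i.+2)%N; first by rewrite sr; lia.
rewrite !(nth_pth_rev uv) //; try lia.
by rewrite east eb; split; congr nth; lia.
Qed.

Lemma pedge_wall u v a b : e u v -> pedge (pth L u v) a b -> wall L a b.
Proof.
move=> uv h; apply/orP; right; apply/existsP; exists u; apply/existsP; exists v.
by rewrite uv.
Qed.

Lemma box_wall u a b : inb u a -> inb u b -> wall L a b.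
Proof. by move=> ha hb; apply/orP; left; apply/existsP; exists u; rewrite ha. Qed.

Lemma wall_sym : symmetric (wall L).
Proof.
suff h a b : wall L a b -> wall L b a by move=> a b; apply/idP/idP => /h.
case/orP=> [/existsP [v /andP [h1 h2]]|/existsP [u /existsP [v /andP [uv h]]]].
  exact: box_wall h2 h1.
by apply: (@pedge_wall v u); [rewrite e_sym|apply: pedge_rev].
Qed.

(* Cells joined by crossing lattice edges that are not walls, that is, lie neither
   in a box nor on a path. *)
Inductive reach (c0 : ipoint) : ipoint -> Prop :=
| reach0 : reach c0 c0
| reachS a b : adj a b -> ~~ wall L a b -> reach c0 (lcell a b) -> reach c0 (lcell b a).

Lemma reach_trans c0 c1 c2 : reach c0 c1 -> reach c1 c2 -> reach c0 c2.
Proof. by move=> h; elim=> // a b ab nw _; apply: reachS. Qed.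

Lemma reach_sym c0 c1 : reach c0 c1 -> reach c1 c0.
Proof.
elim=> [|a b ab nw _ IH]; first exact: reach0.
apply: reach_trans IH; apply: reachS; rewrite 1?adj_sym 1?wall_sym //.
exact: reach0.
Qed.

Definition touches u (c : ipoint) : Prop :=
  exists s t : bool, inb u (c.1 + s%:Z, c.2 + t%:Z).

Let centre (c : ipoint) : ipoint := (4 * c.1 + 2, 4 * c.2 + 2).

(** The points between the centres of two neighbouring cells whose common edge is not a wall. *)
Let arm (z : ipoint) : Prop := exists a : ipoint,
  [/\ ~~ wall L a (north a), z.2 = 4 * a.2 + 2, 4 * a.1 - 2 <= z.1 & z.1 <= 4 * a.1 + 2] \/
  [/\ ~~ wall L a (east a), z.1 = 4 * a.1 + 2, 4 * a.2 - 2 <= z.2 & z.2 <= 4 * a.2 + 2].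

(** [centre], [mid] and [hook] lead from the middle of a cell to the unit margin of the widened box
    at its corner [(s, t)]. *)
Let mid (c : ipoint) (s : bool) : ipoint := (4 * c.1 + 1 + 2 * s%:Z, 4 * c.2 + 2).
Let hook (c : ipoint) (s t : bool) : ipoint := (4 * c.1 + 1 + 2 * s%:Z, 4 * c.2 + 1 + 2 * t%:Z).

Lemma arm_walk c1 c2 : reach c1 c2 -> exists s, 
  [/\ path adj (centre c1) s, last (centre c1) s = centre c2 &
      forall z, z \in s -> arm z].
Proof.
elim=> [|a b ab nw _ [s [h1 h2 h3]]]; first by exists [::].
have step p1 p2 p3 p4 : adj (centre (lcell a b)) p1 -> adj p1 p2 -> adj p2 p3 -> adj p3 p4 ->
    p4 = centre (lcell b a) -> arm p1 -> arm p2 -> arm p3 -> arm p4 ->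
    exists s, [/\ path adj (centre c1) s, last (centre c1) s = centre (lcell b a) &
      forall z, z \in s -> arm z].
  move=> a1 a2 a3 a4 <- g1 g2 g3 g4; exists (s ++ [:: p1; p2; p3; p4]).
  rewrite cat_path last_cat h1 h2 /= a1 a2 a3 a4; split => // z.
  by rewrite mem_cat !inE => /orP [/h3 //|/or4P [] /eqP ->].
case/adjP: ab nw step => ->; rewrite lcellE lcellEr => nw step.
- by apply: (step (4 * a.1 + 2, 4 * a.2 + 1) (4 * a.1 + 2, 4 * a.2) (4 * a.1 + 2, 4 * a.2 - 1)
    (4 * a.1 + 2, 4 * a.2 - 2)); rewrite ?adjE /centre /=; try lia;
    [congr pair; lia| | | |]; exists a; right; split => //=; lia.
- by apply: (step (4 * a.1 - 1, 4 * a.2 + 2) (4 * a.1, 4 * a.2 + 2) (4 * a.1 + 1, 4 * a.2 + 2)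
    (4 * a.1 + 2, 4 * a.2 + 2)); rewrite ?adjE /centre /=; try lia;
    [congr pair; lia| | | |]; exists a; left; split => //=; lia.
- have nw' : ~~ wall L (west a) (east (west a)) by rewrite dirK wall_sym.
  by apply: (step (4 * a.1 - 2, 4 * a.2 - 1) (4 * a.1 - 2, 4 * a.2) (4 * a.1 - 2, 4 * a.2 + 1)
    (4 * a.1 - 2, 4 * a.2 + 2)); rewrite ?adjE /centre /=; try lia;
    [congr pair; lia| | | |]; exists (west a); right; split => //=; lia.
- have nw' : ~~ wall L (south a) (north (south a)) by rewrite dirK wall_sym.
  by apply: (step (4 * a.1 + 1, 4 * a.2 - 2) (4 * a.1, 4 * a.2 - 2) (4 * a.1 - 1, 4 * a.2 - 2)
    (4 * a.1 - 2, 4 * a.2 - 2)); rewrite ?adjE /centre /=; try lia;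
    [congr pair; lia| | | |]; exists (south a); left; split => //=; lia.
Qed.

Local Notation big_in x := (inbox (4 * rad L + 1) (4 * (ctr L x).1, 4 * (ctr L x).2)).

Lemma arm_out z x : arm z -> ~~ big_in x z.
Proof.
case=> a [] [nw h1 h2 h3]; apply: contra nw; rewrite /inbox /= => h; apply: (@box_wall x).
- by rewrite /inbox; lia.
- by rewrite /inbox /=; lia.
- by rewrite /inbox; lia.
- by rewrite /inbox /=; lia.
Qed.

Lemma arm_free z u v a b k : arm z -> e u v -> pedge (pth L u v) a b -> adj a b -> (k <= 4)%N ->
  z <> on4 a b k.
Proof.
move=> az uv pab ab k4 zE; have wab := pedge_wall uv pab.
have wba : wall L b a by rewrite wall_sym.
move: az; rewrite zE /on4 => -[c hc].
have e1 (x : int) : x + 1 - x = 1 by lia.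
have e2 (x : int) : x - 1 - x = -1 by lia.
have e3 (x : int) : x - x = 0 by lia.
case/adjP: ab wab wba hc => -> wab wba /= [] [nw]; rewrite ?e1 ?e2 ?e3 => h1 h2 h3.
- lia.
- have E : c = a by apply/eqP; rewrite pt_eqE; lia.
  by rewrite E wab in nw.
- have E : c = a by apply/eqP; rewrite pt_eqE; lia.
  by rewrite E wab in nw.
- lia.
- lia.
- have E : c = west a by apply/eqP; rewrite pt_eqE /=; lia.
  by rewrite E dirK wba in nw.
- have E : c = south a by apply/eqP; rewrite pt_eqE /=; lia.
  by rewrite E dirK wba in nw.
- lia.
Qed.

Lemma hook_out c (s t : bool) u x z : inb u (c.1 + s%:Z, c.2 + t%:Z) ->
  z \in [:: centre c; mid c s; hook c s t] -> big_in x z -> x = u.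
Proof.
move=> yu zin xz; apply: (@box_inj _ _ L x u (c.1 + s%:Z, c.2 + t%:Z)) => //.
by move: zin xz; rewrite !inE => /or3P [] /eqP ->; rewrite /inbox /=;
  clear yu; case: s t => [] []; lia.
Qed.

Lemma hook_free c (s t : bool) z a b k : adj a b -> (k <= 4)%N ->
  z \in [:: centre c; mid c s; hook c s t] -> z <> on4 a b k.
Proof.
move=> ab k4 zin zE; move: zin; rewrite zE !inE /on4.
case/adjP: ab => -> /=.
all: have e1 (x : int) : x + 1 - x = 1 by lia.
all: have e2 (x : int) : x - 1 - x = -1 by lia.
all: have e3 (x : int) : x - x = 0 by lia.
all: by rewrite ?e1 ?e2 ?e3 !xpair_eqE; case: s t => [] []; lia.
Qed.

(** In the refined lattice the new edge runs from the box of [u] through the centres of the cells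
    between [c1] and [c2] to the box of [w]. Since it only crosses edges that are not walls, it
    meets no old path and no other box. *)
Lemma add_edge u w c1 c2 : u != w -> reach c1 c2 -> touches u c1 -> touches w c2 ->
  weak_model (fun x y => [|| e x y, (x == u) && (y == w) | (x == w) && (y == u)]).
Proof.
move=> uw r12 [s1 [t1 y1]] [s2 [t2 y2]].
have [s [ps ls armS]] := arm_walk r12.
pose nw := [:: hook c1 s1 t1, mid c1 s1, centre c1 & s ++ [:: mid c2 s2; hook c2 s2 t2]].
pose old x y := if pth L x y is a :: s' then (4 * a.1, 4 * a.2) :: refine4 a s' else [::].
have nwP : path adj (hook c1 s1 t1) (behead nw).
  have hm c (b t : bool) : adj (hook c b t) (mid c b).
    by rewrite adjE /=; case: t => /=; lia.
  have mc c (b : bool) : adj (mid c b) (centre c).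
    by rewrite adjE /=; case: b => /=; lia.
  by rewrite /= cat_path ps ls /= hm mc adj_sym mc adj_sym hm.
have nwM z : z \in nw -> [\/ arm z, z \in [:: centre c1; mid c1 s1; hook c1 s1 t1]
     | z \in [:: centre c2; mid c2 s2; hook c2 s2 t2]].
  rewrite /nw !inE mem_cat !inE => /or4P [->|->|->|]; rewrite ?orbT; try by apply: Or32.
  by case/orP => [/armS ?|/orP [->|->]]; rewrite ?orbT; [apply: Or31|apply: Or33|apply: Or33].
have oldM x y z : e x y -> z \in old x y -> exists a b k,
    [/\ pedge (pth L x y) a b, adj a b, (k <= 4)%N & z = on4 a b k].
  move=> xy; have := path_pth L xy; have := pth_size L xy; rewrite /old /port.
  case: (pth L x y) => // a s' /= s1' ps'; apply: refine4_mem => //.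
  by case: s' s1' {ps'}.
have box4 x z : inb x z -> big_in x (4 * z.1, 4 * z.2) by rewrite /inbox /=; lia.
have oldbox x y z v : e x y -> z \in old x y -> big_in v z -> v = x \/ v = y.
  move=> xy /(oldM _ _ _ xy) [a [b [k [pab ab k4 ->]]]] /(on4_box ab k4).
  case/pedgeP: pab => i si [-> ->].
  case; rewrite pth_box //; try exact: ltnW.
    by case/orP => /andP [/eqP -> _]; [left|right].
  by case/orP => /andP [/eqP -> _]; [left|right].
have nwbox z v : z \in nw -> big_in v z -> v = u \/ v = w.
  case/nwM => h; first by move=> h2; have := arm_out v h; rewrite h2.
    by move/(hook_out y1 h) => ->; left.
  by move/(hook_out y2 h) => ->; right.
have nwold x y z : e x y -> z \in nw -> z \in old x y -> False.
  move=> xy /nwM znw /(oldM _ _ _ xy) [a [b [k [pab ab k4 zE]]]].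
  by case: znw => h; [apply: (arm_free h xy pab ab k4 zE)|apply: (hook_free ab k4 h zE)|
    apply: (hook_free ab k4 h zE)].
pose ww x y := if e x y then old x y else if x == u then nw else rev nw.
exists (fun x => (4 * (ctr L x).1, 4 * (ctr L x).2)), (4 * rad L + 1)%N, ww.
have wwE x y : [|| e x y, (x == u) && (y == w) | (x == w) && (y == u)] ->
   e x y \/ ~~ e x y /\ (x = u /\ y = w \/ x = w /\ y = u).
  case: (e x y) => /=; first by left.
  by case/orP => /andP [/eqP -> /eqP ->]; right; split=> //; [left|right].
have wwM x y z : e x y = false -> z \in ww x y -> z \in nw.
  by rewrite /ww => ->; case: ifP => // _; rewrite mem_rev.
have nwu : big_in u (hook c1 s1 t1).
  by move: y1; rewrite /inbox /=; case: (s1) (t1) => [] []; lia.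
have nww : big_in w (last (hook c1 s1 t1) (behead nw)).
  by move: y2; rewrite /= last_cat /= /inbox /=; case: (s2) (t2) => [] []; lia.
split.
- by lia.
- move=> x y z h1 h2.
  (* The larger lower bound in each coordinate gives a common point of the old boxes. *)
  pose m (a b : int) : int := if a <= b then b - (rad L)%:Z else a - (rad L)%:Z.
  apply: (@box_inj _ _ L x y (m (ctr L x).1 (ctr L y).1, m (ctr L x).2 (ctr L y).2)).
    by move: h1 h2; rewrite /m /inbox /=; do 2 case: ifP; lia.
  by move: h1 h2; rewrite /m /inbox /=; do 2 case: ifP; lia.
- move=> x y /wwE [xy|[nxy [[ex ey]|[ex ey]]]].
  + have yx : e y x by rewrite e_sym.
    have oE : old x y = (4 * (port L x y).1, 4 * (port L x y).2) :: refine4 (port L x y) (behead (pth L x y)).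
      by rewrite /old {1}(pth_cons L xy).
    exists (4 * (port L x y).1, 4 * (port L x y).2), (refine4 (port L x y) (behead (pth L x y))).
    split; first by rewrite /ww xy.
    * exact/refine4_path/path_pth.
    * exact/box4/port_box.
    * by rewrite refine4_last last_pth //; exact/box4/port_box.
  + subst x y; exists (hook c1 s1 t1), (behead nw).
    by rewrite /ww (negbTE nxy) eqxx; split.
  + subst x y; rewrite /ww (negbTE nxy) ifN 1?eq_sym //.
    exists (last (hook c1 s1 t1) (behead nw)), (rev (belast (hook c1 s1 t1) (behead nw))).
    split => //.
    * have nwE : nw = hook c1 s1 t1 :: behead nw by [].
      by rewrite {1}nwE lastI rev_rcons.
    * rewrite rev_path; apply: sub_path nwP => a b; by rewrite adj_sym.
    * by rewrite [belast _ _]/= rev_cons last_rcons.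
- move=> x y z v /wwE [xy|[/negbTE nxy hxy]] zw zv.
    by apply: oldbox zv => //; move: zw; rewrite /ww xy.
  have := nwbox z v (wwM _ _ _ nxy zw) zv.
  by case: hxy => [[-> ->]|[-> ->]] [->|->]; auto.
- move=> x y x' y' z /wwE [xy|[/negbTE nxy hxy]] /wwE [xy'|[/negbTE nxy' hxy']] h1 h2.
  + move: h1 h2; rewrite /ww xy xy' => h1 h2.
    have [a [b [k [pab ab k4 zE]]]] := oldM _ _ _ xy h1.
    have [a' [b' [k' [pab' ab' k4' zE']]]] := oldM _ _ _ xy' h2.
    have [i si [east eb]] := pedgeP _ _ _ pab.
    have [i' si' [ea' eb']] := pedgeP _ _ _ pab'.
    have ain : a \in pth L x y by rewrite east mem_nth // ltnW.
    have bin : b \in pth L x y by rewrite eb mem_nth.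
    have ain' : a' \in pth L x' y' by rewrite ea' mem_nth // ltnW.
    have bin' : b' \in pth L x' y' by rewrite eb' mem_nth.
    rewrite zE in zE'; case: (on4_share ab ab' k4 k4' zE') => E.
    * by apply: (pth_disj xy xy' ain); rewrite E.
    * by apply: (pth_disj xy xy' ain); rewrite E.
    * by apply: (pth_disj xy xy' bin); rewrite E.
    * by apply: (pth_disj xy xy' bin); rewrite E.
  + by case: (nwold x y z xy); [apply: wwM nxy' h2|move: h1; rewrite /ww xy].
  + by case: (nwold x' y' z xy'); [apply: wwM nxy h1|move: h2; rewrite /ww xy'].
  + by case: hxy hxy' => [[-> ->]|[-> ->]] [[-> ->]|[-> ->]]; auto.
Qed.

Lemma touches_lcell u a b : adj a b -> inb u a -> touches u (lcell a b).
Proof.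
case: a => a1 a2 /adjP [] -> ua; rewrite lcellE /touches /=.
- by exists false, false; rewrite !addr0.
- by exists true, false; rewrite addr0 subrK.
- by exists true, true; rewrite !subrK.
- by exists false, true; rewrite addr0 subrK.
Qed.

Lemma touches_rcell u a b : adj a b -> inb u a -> touches u (lcell b a).
Proof.
case: a => a1 a2 /adjP [] -> ua; rewrite lcellEr /touches /=.
- by exists false, true; rewrite addr0 subrK.
- by exists false, false; rewrite !addr0.
- by exists true, false; rewrite addr0 subrK.
- by exists true, true; rewrite !subrK.
Qed.

(** Reachability is itself a function on cells that changes only across walls, so the lemmas on
    [dval] carry it along paths and round boxes. *)
Lemma reach_flat (f : ipoint -> Prop) :
  (forall c d, f c -> reach c d -> f d) ->
  forall a b, adj a b -> ~~ wall L a b -> `[< f (lcell a b) >] = `[< f (lcell b a) >].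
Proof.
move=> h a b ab nw; apply/asboolP/asboolP => fc; apply: h fc _.
  by apply: reachS ab nw _; apply: reach0.
by apply: reachS; rewrite 1?adj_sym 1?wall_sym //; apply: reach0.
Qed.

(** Start in a cell at the box of [u] to the left of the path to [v], follow this path, go round the
    box of [v] to the next exit, and follow the path to [w]: no wall is crossed. *)
Lemma add_next v u (w := next (rotation L v) u) : e v u -> u != w ->
  weak_model (fun x y => [|| e x y, (x == u) && (y == w) | (x == w) && (y == u)]).
Proof.
move=> vu uw; have uv : e u v by rewrite e_sym.
have vw : e v w by rewrite -(mem_rotation eirr L) mem_next mem_rotation.
have wv : e w v by rewrite e_sym.
pose c0 := lcell (port L u v) (port2 L u v).
pose f c := `[< reach c0 c >].
have flat := @reach_flat (reach c0) (fun c d h1 h2 => reach_trans h1 h2).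
have h1 : dval L f v w = true.
  rewrite (dval_next e_sym eirr flat vu); apply/asboolP; exact: reach0.
rewrite -(dval_path flat vw) in h1; move/asboolP: h1 => h1.
apply: (add_edge uw h1).
- by apply: touches_lcell; [apply: port_adj|apply: port_box].
- by apply: touches_rcell; [apply: port_adj|apply: port_box].
Qed.

(** Otherwise no cell is reachable from both [A] and its complement. Then being reachable from [A]
    does not change across any lattice edge, so it is constant on the plane, against the cells at
    [u0] and [w0]. *)
Lemma add_cut (A : pred T) u0 w0 : A u0 -> ~~ A w0 -> (forall x y, e x y -> A x = A y) ->
  exists u w, [/\ A u, ~~ A w &
   weak_model (fun x y => [|| e x y, (x == u) && (y == w) | (x == w) && (y == u)])].
Proof.
move=> Au0 Aw0 Ae.
pose near (B : pred T) c := exists u c', [/\ B u, reach c' c & touches u c'].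
case: (pselect (exists c, near A c /\ near (predC A) c)) => [[c [[u [c1 [Au r1 t1]]] [w [c2 [Aw r2 t2]]]]]|none].
  exists u, w; split => //; apply: (add_edge _ (reach_trans r1 (reach_sym r2)) t1 t2).
  by apply: contraNneq Aw => <-.
pose f c := `[< near A c >].
have fl : forall a b, adj a b -> ~~ wall L a b -> f (lcell a b) = f (lcell b a).
  apply: reach_flat => c d [u [c' [Au r t]]] cd.
  by exists u, c'; split => //; apply: reach_trans cd.
have ft u c : touches u c -> f c = A u.
  move=> t; case: (boolP (A u)) => Au; first by apply/asboolP; exists u, c; split => //; apply: reach0.
  apply/asboolP => nA; apply: none; exists c; split => //.
  by exists u, c; split => //; apply: reach0.
(* Across walls too: the two sides of a wall in a box touch the same vertex, and the two sides of a
   path from [u] to [v] have the values [A u] and [A v], which agree. *)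
have fall a b : adj a b -> f (lcell a b) = f (lcell b a).
  move=> ab; case: (boolP (wall L a b)) => [|/(fl _ _ ab) //].
  case/wallP => [[v [va vb]]|[u [v [i [uv si east eb]]]]].
    by rewrite (ft v) ?(ft v) //; [apply: touches_rcell|apply: touches_lcell].
  have vu : e v u by rewrite e_sym.
  have -> : f (lcell a b) = A u.
    rewrite east eb (dval_path_nth fl uv si); apply: ft.
    by apply: touches_lcell; [apply: port_adj|apply: port_box].
  have : pedge (pth L v u) b a by apply: pedge_rev => //; apply/pedgeP; exists i.
  case/pedgeP => j sj [eb' ea'].
  rewrite eb' ea' (dval_path_nth fl vu sj) (Ae _ _ uv); apply/esym/ft.
  by apply: touches_lcell; [apply: port_adj|apply: port_box].
have fwe a : f (west a) = f a.
  by have := fall a (north a); rewrite lcellE lcellEr; apply; rewrite /adj eqxx orbT.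
have fso a : f (south a) = f a.
  by have := fall a (east a); rewrite lcellE lcellEr => ->//; rewrite /adj eqxx.
have f1 (i j : int) : f (i, j) = f (0, j).
  have pos (n : nat) : f (n%:Z, j) = f (0, j).
    elim: n => // n <-; rewrite -(fwe (n.+1%:Z, j)); congr (f (_, _)); rewrite /=; lia.
  case: i => n //; rewrite NegzE; elim: n => [|n IH].
    by rewrite -(fwe (0, j)); congr (f (_, _)).
  by rewrite -IH -(fwe (- n.+1%:Z, j)); congr (f (_, _)); rewrite /=; lia.
have f2 (j : int) : f (0, j) = f (0, 0).
  have pos (n : nat) : f (0, n%:Z) = f (0, 0).
    elim: n => // n <-; rewrite -(fso (0, n.+1%:Z)); congr (f (_, _)); rewrite /=; lia.
  case: j => n //; rewrite NegzE; elim: n => [|n IH].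
    by rewrite -(fso (0, 0)); congr (f (_, _)).
  by rewrite -IH -(fso (0, - n.+1%:Z)); congr (f (_, _)); rewrite /=; lia.
have tc u : touches u (ctr L u).
  by exists false, false; rewrite /= !addr0 -surjective_pairing inbox_ctr.
have := ft _ _ (tc u0); have := ft _ _ (tc w0).
case: (ctr L u0) (ctr L w0) => a1 a2 [b1 b2].
by rewrite !f1 !f2 (negbTE Aw0) Au0 => ->.
Qed.

End Add.

From mathcomp Require Import all_classical all_reals all_analysis.

Import Order.TTheory GRing.Theory Num.Theory.
Import numFieldNormedType.Exports.

(** * From lattice drawings to plane drawings and back *)

Section Polyline.
Variable R : realType.
Implicit Types (a b p : R * R).

Definition seg a b (t : R) : R * R := ((1 - t) * a.1 + t * b.1, (1 - t) * a.2 + t * b.2).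

Definition inseg a b p : Prop := exists2 t : R, 0 <= t <= 1 & p = seg a b t.

Lemma seg0 a b : seg a b 0 = a.
Proof. by case: a => x y; rewrite /seg /= subr0 !mul1r !mul0r !addr0. Qed.

Lemma seg1 a b : seg a b 1 = b.
Proof. by case: b => x y; rewrite /seg /= subrr !mul1r !mul0r !add0r. Qed.

Lemma segV a b t : seg b a (1 - t) = seg a b t.
Proof. by rewrite /seg; congr pair; ring. Qed.

Lemma insegC a b p : inseg a b p -> inseg b a p.
Proof. by case=> t t01 ->; exists (1 - t); rewrite ?segV //; lra. Qed.

Lemma inseg_r a b : inseg a b b.
Proof. by exists 1; rewrite ?seg1 //; lra. Qed.

Lemma seg_inj a b s t : a != b -> seg a b s = seg a b t -> s = t.
Proof.
case: a b => a1 a2 [b1 b2]; rewrite xpair_eqE negb_and /seg /= => ab [e1 e2].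
case/orP: ab => ab.
  have : (s - t) * (b1 - a1) = 0 by lra.
  by move/eqP; rewrite mulf_eq0 !subr_eq0 [b1 == _]eq_sym (negbTE ab) orbF => /eqP.
have : (s - t) * (b2 - a2) = 0 by lra.
by move/eqP; rewrite mulf_eq0 !subr_eq0 [b2 == _]eq_sym (negbTE ab) orbF => /eqP.
Qed.

Definition lipschitz_curve (f : R -> R * R) : Prop := exists2 K : R, 0 <= K &
  forall s t, `|(f s).1 - (f t).1| <= K * `|s - t| /\ `|(f s).2 - (f t).2| <= K * `|s - t|.

Lemma lipschitz_continuous (f : R -> R * R) : lipschitz_curve f -> continuous f.
Proof.
move=> [K K0 h] t; apply/cvg_ballP => eps e0; rewrite -nbhs_nearE.
exists (eps / (K + 1)); first by rewrite /= divr_gt0 //; lra.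
move=> s /= ts; have [h1 h2] := h t s.
have st : K * `|t - s| < eps.
  rewrite ltr_pdivlMr in ts; last by lra.
  have : 0 <= `|t - s| by [].
  case: (ltrP 0 `|t - s|); nra.
by split; [apply: le_lt_trans h1 _|apply: le_lt_trans h2 _].
Qed.

Lemma lipschitz_seg a b : lipschitz_curve (seg a b).
Proof.
exists (`|b.1 - a.1| + `|b.2 - a.2|); first by rewrite addr_ge0.
move=> s t; rewrite /seg /=.
have -> : (1 - s) * a.1 + s * b.1 - ((1 - t) * a.1 + t * b.1) = (b.1 - a.1) * (s - t) by ring.
have -> : (1 - s) * a.2 + s * b.2 - ((1 - t) * a.2 + t * b.2) = (b.2 - a.2) * (s - t) by ring.
by rewrite !normrM !mulrDl; split; rewrite ?lerDl ?lerDr mulr_ge0.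
Qed.

Let lo (t : R) : R := if t <= 1 / 2 then 2 * t else 1.
Let hi (t : R) : R := if t <= 1 / 2 then 0 else 2 * t - 1.

(** A sum of one map that moves in the first half of the time and a shifted one that moves in the
    second half. In this form the Lipschitz bound, and with it continuity, needs no gluing. *)
Fixpoint polyline (a b : R * R) (s : seq (R * R)) (t : R) : R * R :=
  if s is c :: s' then
    ((seg a b (lo t)).1 + ((polyline b c s' (hi t)).1 - b.1),
     (seg a b (lo t)).2 + ((polyline b c s' (hi t)).2 - b.2))
  else seg a b t.

Lemma polyline_cons a b c s t : polyline a b (c :: s) t =
  ((seg a b (lo t)).1 + ((polyline b c s (hi t)).1 - b.1),
   (seg a b (lo t)).2 + ((polyline b c s (hi t)).2 - b.2)).
Proof. by []. Qed.

Lemma lipschitz_polyline a b s : lipschitz_curve (polyline a b s).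
Proof.
elim: s a b => [|c s IH] a b; first exact: lipschitz_seg.
have [K K0 hK] := lipschitz_seg a b; have [M M0 hM] := IH b c.
exists (2 * K + 2 * M); first by lra.
have los s' t' : `|lo s' - lo t'| <= 2 * `|s' - t'|.
  have d1 := ler_norm (s' - t'); have d2 := ler_norm (t' - s'); rewrite distrC in d2.
  rewrite /lo ler_norml; case: (lerP s' (1 / 2)) => ?; case: (lerP t' (1 / 2)) => ?;
    by apply/andP; split; lra.
have his s' t' : `|hi s' - hi t'| <= 2 * `|s' - t'|.
  have d1 := ler_norm (s' - t'); have d2 := ler_norm (t' - s'); rewrite distrC in d2.
  rewrite /hi ler_norml; case: (lerP s' (1 / 2)) => ?; case: (lerP t' (1 / 2)) => ?;
    by apply/andP; split; lra.
move=> s' t' /=; have [k1 k2] := hK (lo s') (lo t'); have [m1 m2] := hM (hi s') (hi t').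
have n1 := los s' t'; have n2 := his s' t'.
have aux (x y z x' y' : R) : `|x - x'| <= K * `|lo s' - lo t'| ->
  `|y - y'| <= M * `|hi s' - hi t'| ->
  `|x + (y - z) - (x' + (y' - z))| <= (2 * K + 2 * M) * `|s' - t'|.
  move=> g1 g2; have -> : x + (y - z) - (x' + (y' - z)) = (x - x') + (y - y') by ring.
  apply: (le_trans (ler_normD _ _)); rewrite mulrDl; apply: lerD.
    apply: le_trans g1 _; rewrite [2 * K]mulrC -mulrA; exact: ler_wpM2l.
  apply: le_trans g2 _; rewrite [2 * M]mulrC -mulrA; exact: ler_wpM2l.
by split; apply: aux.
Qed.

Lemma polyline0 a b s : polyline a b s 0 = a.
Proof.
elim: s a b => [|c s IH] a b; rewrite ?polyline_cons; first exact: seg0.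
have -> : lo 0 = 0 by rewrite /lo mulr0; case: ifP => // /negP []; lra.
have -> : hi 0 = 0 by rewrite /hi; case: ifP => // /negP []; lra.
by rewrite IH seg0 !subrr !addr0 -surjective_pairing.
Qed.

Lemma polyline1 a b s : polyline a b s 1 = last b s.
Proof.
elim: s a b => [|c s IH] a b; rewrite ?polyline_cons; first exact: seg1.
have -> : lo 1 = 1 by rewrite /lo; case: ifP => //; lra.
have -> : hi 1 = 1 by rewrite /hi; case: ifP; lra.
rewrite IH seg1 /=; case: (last c s) => x y; congr pair => /=; ring.
Qed.

Fixpoint on_polyline (a b : R * R) (s : seq (R * R)) (p : R * R) : Prop :=
  inseg a b p \/ if s is c :: s' then on_polyline b c s' p else False.

Fixpoint simple_polyline (a b : R * R) (s : seq (R * R)) : Prop :=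
  a != b /\ if s is c :: s' then
    (forall p, inseg a b p -> on_polyline b c s' p -> p = b) /\ simple_polyline b c s'
  else True.

Lemma polyline_left a b c s t : t <= 1 / 2 -> polyline a b (c :: s) t = seg a b (2 * t).
Proof.
move=> t2; rewrite polyline_cons /lo /hi t2 polyline0 !subrr !addr0; exact/esym/surjective_pairing.
Qed.

Lemma polyline_right a b c s t : 1 / 2 < t -> polyline a b (c :: s) t = polyline b c s (2 * t - 1).
Proof.
move=> t2; rewrite polyline_cons /lo /hi leNgt t2 [~~ true]/= seg1.
by case: (polyline _ _ _ _) => x y /=; congr pair; ring.
Qed.

Lemma polyline_on a b s t : 0 <= t <= 1 -> on_polyline a b s (polyline a b s t).
Proof.
elim: s a b t => [|c s IH] a b t t01; first by left; exists t.
case: (lerP t (1 / 2)) => t2; first by left; rewrite polyline_left //; exists (2 * t) => //; lra.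
by right; rewrite polyline_right //; apply: IH; lra.
Qed.

Lemma polyline_inj a b s : simple_polyline a b s ->
  forall t t', 0 <= t <= 1 -> 0 <= t' <= 1 -> polyline a b s t = polyline a b s t' -> t = t'.
Proof.
elim: s a b => [|c s IH] a b; first by case=> ab _ t t' _ _; apply: seg_inj.
case=> ab [sep sim].
have mixed t t' : 0 <= t <= 1 / 2 -> 1 / 2 < t' <= 1 ->
    polyline a b (c :: s) t = polyline a b (c :: s) t' -> False.
  move=> h h'; rewrite polyline_left; last by lra.
  rewrite polyline_right; last by lra.
  move=> E; have E1 : seg a b (2 * t) = b.
    apply: sep; first by exists (2 * t) => //; lra.
    by rewrite E; apply: polyline_on; lra.
  have : polyline b c s (2 * t' - 1) = polyline b c s 0 by rewrite polyline0 -E E1.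
  by move/(IH _ _ sim); lra.
move=> t t' h h'; case: (lerP t (1 / 2)) => t2; case: (lerP t' (1 / 2)) => t2' E.
- by move: E; rewrite !polyline_left // => /(seg_inj ab); lra.
- by case: (mixed t t' _ _ E); lra.
- by case: (mixed t' t _ _ (esym E)); lra.
- by move: E; rewrite !polyline_right // => /(IH _ _ sim); lra.
Qed.

Lemma on_polylineP a b s p : on_polyline a b s p ->
  exists2 i, (i.+1 < size [:: a, b & s])%N & inseg (nth 0 [:: a, b & s] i) (nth 0 [:: a, b & s] i.+1) p.
Proof.
elim: s a b => [|c s IH] a b /= [h|] //; try by exists 0%N.
by case/IH => i si hp; exists i.+1.
Qed.

Lemma simple_polylineP a b s : let l := [:: a, b & s] in
  (forall i, (i.+1 < size l)%N -> nth 0 l i != nth 0 l i.+1) ->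
  (forall i j p, (i < j)%N -> (j.+1 < size l)%N -> inseg (nth 0 l i) (nth 0 l i.+1) p ->
     inseg (nth 0 l j) (nth 0 l j.+1) p -> p = nth 0 l i.+1) ->
  simple_polyline a b s.
Proof.
elim: s a b => [|c s IH] a b l h1 h2; first by split => //; exact: (h1 0%N).
split; first exact: (h1 0%N).
split; last first.
  apply: IH => [i si|i j p ij sj]; first exact: (h1 i.+1).
  exact: (h2 i.+1 j.+1).
move=> p pab /on_polylineP [j sj pj].
exact: (h2 0%N j.+1).
Qed.

End Polyline.

(** * Lattice segments and boxes in the real plane *)

Section RealPoints.
Variable R : realType.

Definition rpt (z : ipoint) : R * R := (z.1%:~R, z.2%:~R).

Definition rbox (r : nat) (c : ipoint) (p : R * R) : bool :=
  [&& (c.1 - r%:Z)%:~R <= p.1, p.1 <= (c.1 + r%:Z)%:~R,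
      (c.2 - r%:Z)%:~R <= p.2 & p.2 <= (c.2 + r%:Z)%:~R].

Lemma rpt_inj : injective rpt.
Proof. by move=> [a b] [c d] [/intr_inj -> /intr_inj ->]. Qed.

Lemma rbox_rpt r c z : rbox r c (rpt z) = inbox r c z.
Proof. by rewrite /rbox /inbox /= !ler_int. Qed.

Lemma adj_cases (P : ipoint -> ipoint -> Prop) :
  (forall a b, P a b -> P b a) -> (forall a, P a (east a)) -> (forall a, P a (north a)) ->
  forall a b, adj a b -> P a b.
Proof.
move=> s h1 h2 a b /adjP [] -> //.
  by apply: s; rewrite -{2}[a](dirK a).1.1.1; apply: h1.
by apply: s; rewrite -{2}[a](dirK a).1.2; apply: h2.
Qed.

Lemma int_ler1 (i k : int) : (i%:~R : R) - k%:~R <= 1 -> i <= k + 1.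
Proof. by rewrite lerBlDl -[1]/(1%:~R) -intrD ler_int. Qed.

Lemma int_cast_between (i k : int) (t : R) : 0 <= t <= 1 -> (i%:~R : R) + t = k%:~R ->
  k = i /\ t = 0 \/ k = i + 1 /\ t = 1.
Proof.
move=> t01 E.
have h1 : k <= i + 1 by apply: int_ler1; lra.
have h2 : i <= k by rewrite -(ler_int R); lra.
have /orP [/eqP k1|/eqP k1] : (k == i) || (k == i + 1) by lia.
  by left; split => //; rewrite k1 in E; lra.
by right; split => //; rewrite k1 intrD in E; lra.
Qed.

Lemma seg_east a t : seg (rpt a) (rpt (east a)) t = (a.1%:~R + t, a.2%:~R).
Proof. by rewrite /seg /rpt /= intrD; congr pair; ring. Qed.

Lemma seg_north a t : seg (rpt a) (rpt (north a)) t = (a.1%:~R, a.2%:~R + t).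
Proof. by rewrite /seg /rpt /= intrD; congr pair; ring. Qed.

Definition share (a b c d : ipoint) (p : R * R) : Prop :=
  (exists q, [/\ q = a \/ q = b, q = c \/ q = d & p = rpt q]) \/
  (a = c /\ b = d \/ a = d /\ b = c).

Lemma lattice_segments a b c d p : adj a b -> adj c d ->
  inseg (rpt a) (rpt b) p -> inseg (rpt c) (rpt d) p -> share a b c d p.
Proof.
move=> ab; move: c d; move: a b ab.
have hor a c : inseg (rpt a) (rpt (east a)) p -> inseg (rpt c) (rpt (east c)) p -> share a (east a) c (east c) p.
  case=> t t01 ->; case=> s s01; rewrite !seg_east => -[e1 /intr_inj e2].
  have h1 : a.1 <= c.1 + 1 by apply: int_ler1; lra.
  have h2 : c.1 <= a.1 + 1 by apply: int_ler1; lra.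
  have /or3P [] : [|| a.1 == c.1, a.1 == c.1 + 1 | c.1 == a.1 + 1] by lia.
  - move/eqP => e3; have -> : a = c by rewrite [a]surjective_pairing e2 e3 -surjective_pairing.
    by right; left.
  - move/eqP => e3; left; exists a; split; [by left|right|].
      by rewrite [a]surjective_pairing e2 e3.
    rewrite e3 intrD in e1; rewrite (_ : t = 0) ?addr0 //; lra.
  - move/eqP => e3; left; exists c; split; [right|by left|].
      by rewrite [c]surjective_pairing -e2 e3.
    rewrite e3 intrD in e1; rewrite (_ : t = 1); last by lra.
    by rewrite /rpt e3 e2 intrD.
have ver a c : inseg (rpt a) (rpt (north a)) p -> inseg (rpt c) (rpt (north c)) p -> share a (north a) c (north c) p.
  case=> t t01 ->; case=> s s01; rewrite !seg_north => -[/intr_inj e2 e1].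
  have h1 : a.2 <= c.2 + 1 by apply: int_ler1; lra.
  have h2 : c.2 <= a.2 + 1 by apply: int_ler1; lra.
  have /or3P [] : [|| a.2 == c.2, a.2 == c.2 + 1 | c.2 == a.2 + 1] by lia.
  - move/eqP => e3; have -> : a = c by rewrite [a]surjective_pairing e2 e3 -surjective_pairing.
    by right; left.
  - move/eqP => e3; left; exists a; split; [by left|right|].
      by rewrite [a]surjective_pairing e2 e3.
    rewrite e3 intrD in e1; rewrite (_ : t = 0) ?addr0 //; lra.
  - move/eqP => e3; left; exists c; split; [right|by left|].
      by rewrite [c]surjective_pairing -e2 e3.
    rewrite e3 intrD in e1; rewrite (_ : t = 1); last by lra.
    by rewrite /rpt e3 e2 intrD.
have mix a c : inseg (rpt a) (rpt (east a)) p -> inseg (rpt c) (rpt (north c)) p -> share a (east a) c (north c) p.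
  case=> t t01 ->; case=> s s01; rewrite seg_east seg_north => -[e1 e2].
  have h1 := int_cast_between t01 e1; have h2 := int_cast_between s01 (esym e2).
  left; exists (c.1, a.2); split.
  - by case: h1 => [[-> _]|[-> _]]; [left|right]; rewrite // -surjective_pairing.
  - by case: h2 => [[-> _]|[-> _]]; [left|right]; rewrite // -surjective_pairing.
  - by rewrite e1.
have swap a b c d : share a b c d p -> share c d a b p.
  case=> [[q [h1 h2 h3]]|[[-> ->]|[-> ->]]]; last by right; right.
    by left; exists q.
  by right; left.
have flip a b c d : share a b c d p -> share a b d c p.
  case=> [[q [h1 h2 h3]]|[[-> ->]|[-> ->]]].
  - by left; exists q; split => //; case: h2; [right|left].
  - by right; right.
  - by right; left.
apply: adj_cases => [a b h c d|a|a].
- by move=> cd /insegC iab icd; apply/swap/flip/swap/h.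
- apply: adj_cases => [c d h|c|c]; [|exact: hor|exact: mix].
  by move=> iab /insegC icd; apply/flip/h.
- apply: adj_cases => [c d h|c|c]; [|by move=> h1 h2; apply/swap/mix|exact: ver].
  by move=> iab /insegC icd; apply/flip/h.
Qed.

Lemma rbox_convex r c a b p : rbox r c a -> rbox r c b -> inseg a b p -> rbox r c p.
Proof.
rewrite /rbox => /and4P [a1 a2 a3 a4] /and4P [b1 b2 b3 b4] [t t01 ->] /=.
by apply/and4P; split; nra.
Qed.

Lemma rbox_meet r c c' p : rbox r c p -> rbox r c' p ->
  exists z, inbox r c z /\ inbox r c' z.
Proof.
move=> /and4P [a1 a2 a3 a4] /and4P [b1 b2 b3 b4].
have i1 := le_trans a1 b2; have i2 := le_trans b1 a2.
have i3 := le_trans a3 b4; have i4 := le_trans b3 a4.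
rewrite ler_int in i1; rewrite ler_int in i2; rewrite ler_int in i3; rewrite ler_int in i4.
pose m (a b : int) : int := if a <= b then b - r%:Z else a - r%:Z.
exists (m c.1 c'.1, m c.2 c'.2); rewrite /inbox /m /=; clear -i1 i2 i3 i4.
by case: (lerP c.1 c'.1); case: (lerP c.2 c'.2); lia.
Qed.

(** The sides of the box have integer coordinates, so a unit segment between lattice points cannot
    cut through it. *)
Lemma out_segment r c a b p : adj a b -> ~~ inbox r c a -> ~~ inbox r c b ->
  inseg (rpt a) (rpt b) p -> ~~ rbox r c p.
Proof.
move=> ab; move: a b ab; apply: adj_cases => [a b h h1 h2 /insegC|a|a]; first exact: h.
  move=> na nb [t t01 ->]; rewrite seg_east; apply/negP => /and4P [/= a1 a2].
  rewrite !ler_int => a3 a4.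
  have i1 : a.1 <= c.1 + r%:Z by rewrite -(ler_int R); lra.
  have i2 : c.1 - r%:Z <= a.1 + 1 by rewrite -(ler_int R) intrD; lra.
  by move: na nb; rewrite /inbox /=; clear -i1 i2 a3 a4; lia.
move=> na nb [t t01 ->]; rewrite seg_north; apply/negP => /and4P [/=].
rewrite !ler_int => a3 a4 a1 a2.
have i1 : a.2 <= c.2 + r%:Z by rewrite -(ler_int R); lra.
have i2 : c.2 - r%:Z <= a.2 + 1 by rewrite -(ler_int R) intrD; lra.
by move: na nb; rewrite /inbox /=; clear -i1 i2 a3 a4; lia.
Qed.

Lemma exit_segment r c a b p : adj a b -> inbox r c a -> ~~ inbox r c b ->
  inseg (rpt a) (rpt b) p -> rbox r c p -> p = rpt a.
Proof.
move=> ab ia ib [t t01 ->] pin.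
suff -> : t = 0 by rewrite seg0.
move: ab ia ib pin => /adjP []; case: a => a1 a2 ->; rewrite /rbox /inbox /seg /= ?intrD ?rmorphB /=
  => /and4P [i1 i2 i3 i4] o /and4P [h1 h2 h3 h4].
- have E : (a1%:~R : R) = (c.1 + r%:Z)%:~R by congr (_%:~R); lia.
  rewrite ?intrD ?rmorphB /= in E *; lra.
- have E : (a2%:~R : R) = (c.2 + r%:Z)%:~R by congr (_%:~R); lia.
  rewrite ?intrD ?rmorphB /= in E *; lra.
- have E : (a1%:~R : R) = (c.1 - r%:Z)%:~R by congr (_%:~R); lia.
  rewrite ?intrD ?rmorphB /= in E *; lra.
- have E : (a2%:~R : R) = (c.2 - r%:Z)%:~R by congr (_%:~R); lia.
  rewrite ?intrD ?rmorphB /= in E *; lra.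
Qed.

(** Sup norms are compared: the vector [X] to the boundary has norm at least [r], and [Y] has norm
    at most [r]. Applied both ways, this makes the parameters on two radii equal. *)
Lemma ray_le (t t' r X1 X2 Y1 Y2 : R) : 0 < r -> 0 <= t' ->
  - r <= Y1 <= r -> - r <= Y2 <= r -> [\/ X1 = r, X1 = - r, X2 = r | X2 = - r] ->
  t * X1 = t' * Y1 -> t * X2 = t' * Y2 -> t <= t'.
Proof.
move=> r0 t0 y1 y2 hX e1 e2; rewrite -(ler_pM2r r0).
by case: hX => E; rewrite E in e1 e2; nra.
Qed.

Definition onside (r : nat) (c x : ipoint) : Prop :=
  [\/ x.1 = c.1 + r%:Z, x.1 = c.1 - r%:Z, x.2 = c.2 + r%:Z | x.2 = c.2 - r%:Z].

Lemma onsideP r c x y : inbox r c x -> adj x y -> ~~ inbox r c y -> onside r c x.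
Proof.
case: x => x1 x2 ix /adjP [] ->; move: ix; rewrite /onside /inbox /= => ix o.
- by apply: Or41; lia.
- by apply: Or43; lia.
- by apply: Or42; lia.
- by apply: Or44; lia.
Qed.

Lemma rays r c x x' p : (0 < r)%N -> inbox r c x -> onside r c x -> inbox r c x' -> onside r c x' ->
  x != x' -> inseg (rpt c) (rpt x) p -> inseg (rpt c) (rpt x') p -> p = rpt c.
Proof.
move=> r0 ix sx ix' sx' xx' [t t01 ->] [t' t01'].
rewrite /seg /rpt /=; case=> e1 e2.
pose X1 : R := x.1%:~R - c.1%:~R; pose X2 : R := x.2%:~R - c.2%:~R.
pose Y1 : R := x'.1%:~R - c.1%:~R; pose Y2 : R := x'.2%:~R - c.2%:~R.
have R0 : (0 : R) < r%:R by rewrite ltr0n.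
have f1 : t * X1 = t' * Y1 by rewrite /X1 /Y1; lra.
have f2 : t * X2 = t' * Y2 by rewrite /X2 /Y2; lra.
pose rr : R := r%:R.
have bnd (z : ipoint) : inbox r c z -> - rr <= (z.1%:~R - c.1%:~R : R) <= rr /\
    - rr <= (z.2%:~R - c.2%:~R : R) <= rr.
  rewrite /inbox -!(ler_int R) !rmorphB !intrD /= -!pmulrn -/rr => /and4P [h1 h2 h3 h4].
  by split; apply/andP; split; lra.
have sd (z : ipoint) : onside r c z ->
  [\/ z.1%:~R - c.1%:~R = r%:R :> R, z.1%:~R - c.1%:~R = - r%:R :> R,
      z.2%:~R - c.2%:~R = r%:R :> R | z.2%:~R - c.2%:~R = - r%:R :> R].
  case=> ->; rewrite ?rmorphB ?intrD /= -?pmulrn; [apply: Or41|apply: Or42|apply: Or43|apply: Or44];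
  ring.
have [bx1 bx2] := bnd _ ix; have [by1 by2] := bnd _ ix'.
have t0 : 0 <= t by lra.
have t0' : 0 <= t' by lra.
have l1 := ray_le R0 t0' by1 by2 (sd _ sx) f1 f2.
have l2 := ray_le R0 t0 bx1 bx2 (sd _ sx') (esym f1) (esym f2).
have E : t = t' by apply/le_anti; rewrite l1 l2.
case: (t =P 0) => [->|/eqP tn0]; first by congr pair; ring.
rewrite -E in f1 f2.
have g1 := mulfI tn0 f1; have g2 := mulfI tn0 f2.
have k1 : (x.1%:~R : R) = x'.1%:~R by rewrite /X1 /Y1 in g1; lra.
have k2 : (x.2%:~R : R) = x'.2%:~R by rewrite /X2 /Y2 in g2; lra.
by move: xx'; rewrite pt_eqE (intr_inj k1) (intr_inj k2) !eqxx.
Qed.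

End RealPoints.

(** * Drawing a lattice model *)

Section Draw.
Variables (R : realType) (T : finType) (e : rel T).
Hypotheses (e_sym : symmetric e) (eirr : irreflexive e).
Variable L : lmodel e.
Local Notation inb v := (inbox (rad L) (ctr L v)).
Local Notation rb v := (rbox (rad L) (ctr L v)).
Local Notation rp := (@rpt R).

(** The lattice path with radii to the centres added at both ends; [box_walk] would not do here, as
    distinct edges must stay disjoint inside a box. *)
Definition arc_uv u v : R -> R * R :=
  polyline (rp (ctr L u)) (rp (port L u v)) [seq rp z | z <- rcons (behead (pth L u v)) (ctr L v)].

Let lst u v := ctr L u :: rcons (pth L u v) (ctr L v).

Let lst_map u v : e u v -> [:: rp (ctr L u), rp (port L u v) &
  [seq rp z | z <- rcons (behead (pth L u v)) (ctr L v)]] = [seq rp z | z <- lst u v].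
Proof. by move=> uv; rewrite /lst [in RHS](pth_cons L uv). Qed.

Let size_lst u v : size (lst u v) = (size (pth L u v)).+2.
Proof. by rewrite /lst /= size_rcons. Qed.

Definition radial u v (p : R * R) := inseg (rp (ctr L u)) (rp (port L u v)) p.

Definition inner u v (p : R * R) := exists2 j, (j.+1 < size (pth L u v))%N &
  inseg (rp (nth 0 (pth L u v) j)) (rp (nth 0 (pth L u v) j.+1)) p.

Let seg_kind u v i (p : R * R) : e u v -> (i.+1 < size (lst u v))%N ->
  inseg (rp (nth 0 (lst u v) i)) (rp (nth 0 (lst u v) i.+1)) p ->
  [\/ i = 0%N /\ radial u v p,
      exists j, [/\ i = j.+1, (j.+1 < size (pth L u v))%N &
        inseg (rp (nth 0 (pth L u v) j)) (rp (nth 0 (pth L u v) j.+1)) p] |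
      i = size (pth L u v) /\ radial v u p].
Proof.
move=> uv; rewrite size_lst /lst; have su := pth_size L uv.
case: i => [|j] sj.
  by rewrite /= nth_rcons ltnW // => h; apply: Or31.
rewrite /= !nth_rcons.
have -> : (j < size (pth L u v))%N by lia.
case: ltngtP => [h|h|h] hp; last 1 first.
- apply: Or33; split; first by lia.
  apply: insegC; rewrite /(port L v u) (nth_pth_rev uv) 1?ltnW //.
  by rewrite -h subn1 /= in hp *.
- by apply: Or32; exists j.
- lia.
Qed.

Lemma radial_rb u v (p : R * R) : e u v -> radial u v p -> rb u p.
Proof.
move=> uv h; apply: (rbox_convex _ _ h); rewrite rbox_rpt; first exact: inbox_ctr.
exact: port_box.
Qed.

Lemma rb_inj u v (p : R * R) : rb u p -> rb v p -> u = v.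
Proof. by move=> h1 h2; have [z [z1 z2]] := rbox_meet h1 h2; apply: box_inj z1 z2. Qed.

Let nthout u v i : e u v -> (0 < i)%N -> (i < size (pth L u v))%N -> ~~ inb u (nth 0 (pth L u v) i).
Proof.
move=> uv i0 si; rewrite pth_box // (gtn_eqF i0) andbF /=.
by case: eqP => // E; rewrite E eirr in uv.
Qed.

Lemma inner_rb_l u v j (p : R * R) : e u v -> (j.+1 < size (pth L u v))%N ->
  inseg (rp (nth 0 (pth L u v) j)) (rp (nth 0 (pth L u v) j.+1)) p ->
  rb u p -> j = 0%N /\ p = rp (port L u v).
Proof.
move=> uv sj hp pu; case: j sj hp => [|j] sj hp.
  split=> //; apply: (exit_segment _ _ _ hp pu); first exact: pth_adj.
    exact: port_box.
  exact: nthout.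
have := @out_segment R (rad L) (ctr L u) _ _ p (pth_adj uv sj) _ _ hp.
rewrite pu => /(_ _ _)/negP; case => //; apply: nthout => //; exact: ltnW.
Qed.

Lemma inner_rb_r u v j (p : R * R) : e u v -> (j.+1 < size (pth L u v))%N ->
  inseg (rp (nth 0 (pth L u v) j)) (rp (nth 0 (pth L u v) j.+1)) p ->
  rb v p -> j.+2 = size (pth L u v) /\ p = rp (port L v u).
Proof.
move=> uv sj /insegC hp pv; have vu : e v u by rewrite e_sym.
have sz := size_pth_rev L uv.
have := @inner_rb_l v u (size (pth L u v) - j.+2) p vu.
rewrite sz !(nth_pth_rev uv); try lia.
have -> : (size (pth L u v) - (size (pth L u v) - j.+2).+1 = j.+1)%N by lia.
have -> : (size (pth L u v) - (size (pth L u v) - j.+2).+2 = j)%N by lia.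
case/(_ _ hp pv) => [|h1 h2]; first by lia.
by split => //; lia.
Qed.

Lemma inner_rb u v w (p : R * R) : e u v -> inner u v p -> rb w p ->
  w = u /\ p = rp (port L u v) \/ w = v /\ p = rp (port L v u).
Proof.
move=> uv [j sj hp] pw.
case: (w =P u) => [wu|wu]; first by subst w; left; case: (inner_rb_l uv sj hp pw).
case: (w =P v) => [wv|wv]; first by subst w; right; case: (inner_rb_r uv sj hp pw).
have := @out_segment R (rad L) (ctr L w) _ _ p (pth_adj uv sj) _ _ hp.
rewrite pw => /(_ _ _)/negP; case => //.
  by rewrite pth_box ?(ltnW sj) // (introF eqP wu) (introF eqP wv).
by rewrite pth_box // (introF eqP wu) (introF eqP wv).
Qed.

Lemma port_onside u v : e u v -> onside (rad L) (ctr L u) (port L u v).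
Proof.
move=> uv; apply: (onsideP (port_box L uv) (port_adj L uv)); exact: port2_out.
Qed.

Lemma port_neq_ctr u v : e u v -> port L u v != ctr L u.
Proof.
move=> uv; have r0 := rad_gt0 L; apply/eqP => E; have := port_onside uv; rewrite E.
by rewrite /onside; case; lia.
Qed.

Lemma radials u v v' (p : R * R) : e u v -> e u v' -> v != v' -> radial u v p -> radial u v' p ->
  p = rp (ctr L u).
Proof.
move=> uv uv' vv'; apply: (@rays R (rad L) _ (port L u v) (port L u v')).
- exact: (rad_gt0 L).
- exact: port_box.
- exact: port_onside.
- exact: port_box.
- exact: port_onside.
- by apply: contraNneq vv' => /(port_inj eirr uv uv') ->.
Qed.

Lemma arc_simple u v : e u v ->
  simple_polyline (rp (ctr L u)) (rp (port L u v)) [seq rp z | z <- rcons (behead (pth L u v)) (ctr L v)].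
Proof.
move=> uv; have vu : e v u by rewrite e_sym.
have su := pth_size L uv.
have nthE i : (i < size (lst u v))%N -> nth 0 [seq rp z | z <- lst u v] i = rp (nth 0 (lst u v) i).
  by move=> si; rewrite (nth_map 0).
have uNv : u <> v by move=> E; rewrite E eirr in uv.
have last_port : nth 0 (pth L u v) (size (pth L u v)).-1 = port L v u.
  by rewrite /(port L v u) (nth_pth_rev uv) ?subn1 // ltnW.
apply: simple_polylineP; rewrite (lst_map uv) size_map.
  move=> i si; rewrite !nthE //; last exact: ltnW.
  rewrite (inj_eq (@rpt_inj R)) /lst; rewrite size_lst in si.
  case: i si => [|i] si; rewrite /= nth_rcons.
    by rewrite ltnW // eq_sym; apply: port_neq_ctr.
  have -> : (i < size (pth L u v))%N by lia.
  rewrite nth_rcons; case: ltngtP => h; last 1 first.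
  - have -> : i = (size (pth L u v)).-1 by lia.
    by rewrite last_port; apply: port_neq_ctr.
  - apply/eqP => /(nth_pt_inj (pth_uniq L uv) (ltnW h) h); lia.
  - lia.
move=> i j p ij sj; have si : (i.+1 < size (lst u v))%N by lia.
have nthS k : (k.+1 < size (lst u v))%N -> nth 0 (lst u v) k.+1 =
    if (k < size (pth L u v))%N then nth 0 (pth L u v) k else ctr L v.
  rewrite size_lst => sk; rewrite /lst /= nth_rcons; case: ltngtP => //; lia.
rewrite !nthE //; try exact: ltnW.
move=> hi hj; have ki := seg_kind uv si hi; have kj := seg_kind uv sj hj.
rewrite nthS //.
case: ki => [[i0 ri]|[i' [ei si' ri]]|[ei ri]]; last by move: sj; rewrite size_lst; lia.
- rewrite i0 ltnW //; have pu := radial_rb uv ri.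
  case: kj => [[j0 _]|[j' [ej sj' rj]]|[ej rj]]; first by lia.
    by case: (inner_rb_l uv sj' rj pu).
  by case: uNv; apply: rb_inj pu (radial_rb vu rj).
- have -> : (i < size (pth L u v))%N by lia.
  case: kj => [[j0 _]|[j' [ej sj' rj]]|[ej rj]]; first by lia.
    have inj a b : (a < size (pth L u v))%N -> (b < size (pth L u v))%N ->
      nth 0 (pth L u v) a = nth 0 (pth L u v) b -> a = b := nth_pt_inj (pth_uniq L uv).
    case: (lattice_segments (pth_adj uv si') (pth_adj uv sj') ri rj) => [[q [h1 h2 ->]]|h].
      case: h1 => h1; case: h2 => h2; rewrite h1 in h2 *; rewrite ?ei //.
      - by have := inj _ _ (ltnW si') (ltnW sj') h2; lia.
      - by have := inj _ _ (ltnW si') sj' h2; lia.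
    by case: h => [[h _]|[h _]]; [have := inj _ _ (ltnW si') (ltnW sj') h|
      have := inj _ _ (ltnW si') sj' h]; lia.
  have [h1 ->] := inner_rb_r uv si' ri (radial_rb vu rj).
  by rewrite -last_port; congr (rp (nth _ _ _)); lia.
Qed.

Lemma arc_uv_on u v t : e u v -> 0 <= t <= 1 ->
  [\/ radial u v (arc_uv u v t), inner u v (arc_uv u v t) | radial v u (arc_uv u v t)].
Proof.
move=> uv t01; have /on_polylineP := polyline_on (rp (ctr L u)) (rp (port L u v))
  [seq rp z | z <- rcons (behead (pth L u v)) (ctr L v)] t01.
rewrite (lst_map uv) size_map => -[i si].
rewrite !(nth_map 0) //; last exact: ltnW.
by case/(seg_kind uv si) => [[_ h]|[j [_ sj h]]|[_ h]];
  [apply: Or31|apply: Or32; exists j|apply: Or33].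
Qed.

Lemma arc_uv0 u v : arc_uv u v 0 = rp (ctr L u).
Proof. exact: polyline0. Qed.

Lemma arc_uv1 u v : arc_uv u v 1 = rp (ctr L v).
Proof. by rewrite /arc_uv polyline1 last_map last_rcons. Qed.

Lemma arc_ctr u v t w : e u v -> 0 <= t <= 1 -> arc_uv u v t = rp (ctr L w) -> w = u \/ w = v.
Proof.
move=> uv t01 E; have vu : e v u by rewrite e_sym.
have ww : rb w (rp (ctr L w)) by rewrite rbox_rpt inbox_ctr.
case: (arc_uv_on uv t01); rewrite E => h.
- by left; apply: rb_inj ww (radial_rb uv h).
- by case: (inner_rb uv h ww) => [[-> _]|[-> _]]; [left|right].
- by right; apply: rb_inj ww (radial_rb vu h).
Qed.

Lemma arcs_disjoint u v u' v' p : e u v -> e u' v' ->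
  ~ (u = u' /\ v = v' \/ u = v' /\ v = u') ->
  [\/ radial u v p, inner u v p | radial v u p] ->
  [\/ radial u' v' p, inner u' v' p | radial v' u' p] ->
  exists w, [/\ w = u \/ w = v, w = u' \/ w = v' & p = rp (ctr L w)].
Proof.
have rr a b c d : e a b -> e c d -> ~ (a = c /\ b = d) -> radial a b p -> radial c d p ->
    a = c /\ p = rp (ctr L a).
  move=> ab cd ne h1 h2; have E := rb_inj (radial_rb ab h1) (radial_rb cd h2).
  subst c; split => //; apply: radials ab cd _ h1 h2.
  by apply/eqP => bd; apply: ne.
have ri a b c d : e a b -> e c d -> ~ (a = c /\ b = d \/ a = d /\ b = c) ->
    radial a b p -> inner c d p -> (a = c \/ a = d) /\ p = rp (ctr L a).
  move=> ab cd ne h1 h2; have dc : e d c by rewrite e_sym.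
  case: (inner_rb cd h2 (radial_rb ab h1)) => [[E pE]|[E pE]]; subst a.
    split; first by left.
    apply: (radials ab cd) => //; last by rewrite /radial pE; apply: inseg_r.
    by apply/eqP => bd; apply: ne; left.
  split; first by right.
  apply: (radials ab dc) => //; last by rewrite /radial pE; apply: inseg_r.
  by apply/eqP => bd; apply: ne; right.
move=> uv uv' ne; have vu : e v u by rewrite e_sym.
have vu' : e v' u' by rewrite e_sym.
case=> h; case=> h'.
- by case: (rr u v u' v' uv uv' _ h h') => [|-> ->]; [tauto|exists u'; split; auto].
- by case: (ri u v u' v' uv uv' _ h h') => [|hu ->]; [tauto|exists u; split; auto].
- by case: (rr u v v' u' uv vu' _ h h') => [|-> ->]; [tauto|exists v'; split; auto].
- case: (ri u' v' u v uv' uv _ h' h) => [|hu ->]; last by exists u'; split; auto.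
  by case=> [[? ?]|[? ?]]; apply: ne; auto.
- case: h h' => i si hi [j sj hj].
  have mem a b k : e a b -> (k < size (pth L a b))%N -> nth 0 (pth L a b) k \in pth L a b.
    by move=> _; apply: mem_nth.
  case: ne; case: (lattice_segments (pth_adj uv si) (pth_adj uv' sj) hi hj) => [[q [h1 h2 _]]|h].
    apply: (@pth_disj _ _ L u v u' v' q uv uv').
      by case: h1 => ->; apply: mem => //; apply: ltnW.
    by case: h2 => ->; apply: mem => //; apply: ltnW.
  have := @pth_disj _ _ L u v u' v' (nth 0 (pth L u v) i) uv uv'.
  apply; first by apply: mem => //; apply: ltnW.
  by case: h => [[-> _]|[-> _]]; apply: mem => //; apply: ltnW.
- case: (ri v' u' u v vu' uv _ h' h) => [|hu ->]; last by exists v'; split; auto.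
  by case=> [[? ?]|[? ?]]; apply: ne; auto.
- by case: (rr v u u' v' vu uv' _ h h') => [|-> ->]; [tauto|exists u'; split; auto].
- by case: (ri v u u' v' vu uv' _ h h') => [|hu ->]; [tauto|exists v; split; tauto].
- by case: (rr v u v' u' vu vu' _ h h') => [|-> ->]; [tauto|exists v'; split; auto].
Qed.

End Draw.

Lemma lmodel_planar (R : realType) (T : finType) (E : {set {set T}}) :
  simple_graph E -> lmodel (erel E) -> planar R E.
Proof.
move=> sE L; have e_sym := erel_sym E; have eirr := erel_irr E.
pose pick2 (e : {set T}) := [pick d : T * T | (d.1 != d.2) && (e == [set d.1; d.2]%SET)].
have pickP2 e : e \in E -> exists u v, [/\ pick2 e = Some (u, v), e = [set u; v]%SET & erel E u v].
  move=> eE; have /cards2P [x [y [xy ee]]] : #|e| == 2%N by rewrite sE.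
  rewrite /pick2; case: pickP => [[u v] /= /andP [uv /eqP ed]|/(_ (x, y))] /=.
    by exists u, v; split; rewrite // /erel uv -ed.
  by rewrite xy ee eqxx.
pose arc e := if pick2 e is Some d then @arc_uv R _ _ L d.1 d.2 else fun _ => 0.
have tr e u v p : pick2 e = Some (u, v) -> trace (arc e) p ->
    exists2 t, 0 <= t <= 1 & @arc_uv R _ _ L u v t = p.
  by move=> pe; rewrite /arc pe => -[t /=]; rewrite in_itv /= => t01 <-; exists t.
exists (fun v => rpt R (ctr L v)), arc; split.
- move=> u v /rpt_inj E'; apply: (@box_inj _ _ L u v (ctr L u)); first exact: inbox_ctr.
  by rewrite E'; apply: inbox_ctr.
- move=> e eE; have [u [v [pe ee uv]]] := pickP2 e eE.
  rewrite /arc pe /=; split; last first.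
    by exists u, v; rewrite arc_uv0 arc_uv1.
  split.
    by apply: continuous_subspaceT; apply/lipschitz_continuous/lipschitz_polyline.
  move=> s t; rewrite !in_itv /= => s01 t01.
  by apply: polyline_inj => //; apply: arc_simple.
- move=> e w eE; have [u [v [pe ee uv]]] := pickP2 e eE.
  case/(tr _ _ _ _ pe) => t t01 /(arc_ctr e_sym eirr uv t01) h.
  by rewrite ee !inE; case: h => ->; rewrite eqxx ?orbT.
- move=> e f eE fE ef p [pe' pf'].
  have [u [v [pe ee uv]]] := pickP2 e eE.
  have [u' [v' [pf ff uv']]] := pickP2 f fE.
  have [t t01 tp] := tr _ _ _ _ pe pe'; have [t' t01' tp'] := tr _ _ _ _ pf pf'.
  have := arc_uv_on L uv t01; rewrite tp => h.
  have := arc_uv_on L uv' t01'; rewrite tp' => h'.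
  have [|w [w1 w2 ->]] := arcs_disjoint e_sym eirr uv uv' _ h h'.
    move=> hh; move/eqP: ef; apply; rewrite ee ff.
    by case: hh => [[-> ->]|[-> ->]] //; rewrite finset.setUC.
  exists w => //=; rewrite !inE ee ff !inE.
  by apply/andP; split; [case: w1 => ->|case: w2 => ->]; rewrite eqxx ?orbT.
Qed.

Local Open Scope classical_set_scope.
Local Open Scope ring_scope.

(** * Compactness, and approximation of curves on a grid *)

Section Separate.
Variable R : realType.
Implicit Types (p q : R * R) (c : R -> R * R) (a b r s t : R).

Definition close (r : R) p q : Prop := `|p.1 - q.1| < r /\ `|p.2 - q.2| < r.

Lemma closeC r p q : close r p q -> close r q p.
Proof. by case=> h1 h2; split; rewrite distrC. Qed.

Lemma close_trans r s p q q' : close r p q -> close s q q' -> close (r + s) p q'.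
Proof.
case=> h1 h2 [k1 k2]; split.
  by apply: le_lt_trans (ler_distD q.1 _ _) _; apply: ltrD.
by apply: le_lt_trans (ler_distD q.2 _ _) _; apply: ltrD.
Qed.

Lemma close_le r s p q : r <= s -> close r p q -> close s p q.
Proof. by move=> rs [h1 h2]; split; apply: lt_le_trans rs. Qed.

Lemma ball_close r p q : ball p r q = close r p q.
Proof. by []. Qed.

Lemma within_close c a b : {within `[a, b], continuous c} ->
  forall t0, a <= t0 <= b -> forall r, 0 < r -> exists2 s, 0 < s &
    forall t, a <= t <= b -> `|t0 - t| < s -> close r (c t0) (c t).
Proof.
move=> /subspace_continuousP cc t0 t01 r r0.
have := cc t0; rewrite /= in_itv /= t01 => /(_ isT) /cvg_ballP /(_ r r0).
rewrite near_withinE => -[s /= s0 h]; exists s => // t tab ts.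
by rewrite -ball_close; apply: h; rewrite //= in_itv.
Qed.

Lemma trace_compact c a b : {within `[a, b], continuous c} -> compact (c @` `[a, b]).
Proof. by move=> cc; apply: continuous_compact => //; apply: segment_compact. Qed.

(** Every point of [A] has a neighbourhood on which all small radii 1/(n + 1) work, and compactness
    provides one n for all of [A]. *)
Lemma compact_apart (A B : set (R * R)) : compact A -> closed B -> A `&` B = set0 ->
  exists2 r, 0 < r & forall p q, A p -> B q -> ~ close r p q.
Proof.
move=> cA cB AB.
have [|N _ hN] := (compact_near_coveringP A).1 cA nat \oo
  (fun n p => forall q, B q -> ~ close (n.+1%:R^-1) p q).
  move=> p Ap; have nBp : (~` B) p by move=> Bp; rewrite -[False]/(set0 p) -AB.
  have /nbhs_ballP [r /= r0 hr] : nbhs p (~` B) by apply: open_nbhs_nbhs; split => //; apply: closed_openC.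
  have r2 : 0 < r / 2 by rewrite divr_gt0.
  exists (ball p (r / 2), [set n | n.+1%:R^-1 < r / 2]) => /=.
    by split; [apply: nbhsx_ballx|apply: near_infty_natSinv_lt (PosNum r2)].
  move=> [p' n] /= [pp' nr] q Bq p'q; apply: (hr q) => //.
  rewrite ball_close in pp' *; have -> : r = r / 2 + r / 2 by lra.
  by apply: close_trans pp' (close_le _ p'q); apply: ltW.
exists (N.+1%:R^-1); first by rewrite invr_gt0 ltr0n.
by move=> p q Ap Bq; apply: (hN N) => //=.
Qed.

Lemma curve_apart c (d : R -> R * R) a b (a' b' : R) : {within `[a, b], continuous c} -> {within `[a', b'], continuous d} ->
  (forall s t, a <= s <= b -> a' <= t <= b' -> c s <> d t) ->
  exists2 r, 0 < r & forall s t, a <= s <= b -> a' <= t <= b' -> ~ close r (c s) (d t).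
Proof.
move=> cc cd ne.
have [|r r0 h] := compact_apart (trace_compact cc) (compact_closed (@norm_hausdorff _ _) (trace_compact cd)).
  rewrite -subset0 => p [[s /= sa <-] [t /= tb E]].
  by rewrite !in_itv /= in sa tb; apply: (ne s t).
exists r => // s t sa tb; apply: h; first by exists s; rewrite //= in_itv.
by exists t; rewrite //= in_itv.
Qed.

Lemma point_apart c a b q : {within `[a, b], continuous c} ->
  (forall s, a <= s <= b -> c s <> q) ->
  exists2 r, 0 < r & forall s, a <= s <= b -> ~ close r (c s) q.
Proof.
move=> cc ne.
have [|r r0 h] := compact_apart (trace_compact cc) (compact_closed (@norm_hausdorff _ _) (@compact_set1 _ q)).
  rewrite -subset0 => p [[s /= sa <-] E].
  by rewrite !in_itv /= in sa; apply: (ne s).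
exists r => // s sa; apply: h => //; by exists s; rewrite //= in_itv.
Qed.

Lemma uniform_close c a b r : {within `[a, b], continuous c} -> 0 < r ->
  exists2 s, 0 < s & forall t t', a <= t <= b -> a <= t' <= b -> `|t - t'| < s ->
    close r (c t) (c t').
Proof.
move=> cc r0; have r2 : 0 < r / 2 by rewrite divr_gt0.
have [|N _ hN] := (compact_near_coveringP `[a, b]).1 (@segment_compact R a b) nat \oo
  (fun n t => a <= t <= b -> forall t', a <= t' <= b -> `|t - t'| < n.+1%:R^-1 -> close r (c t) (c t')).
  move=> t0; rewrite /= in_itv /= => t01.
  have [s s0 hs] := within_close cc t01 r2.
  have s2 : 0 < s / 2 by rewrite divr_gt0.
  exists (ball t0 (s / 2), [set n | n.+1%:R^-1 < s / 2]) => /=.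
    by split; [apply: nbhsx_ballx|apply: near_infty_natSinv_lt (PosNum s2)].
  move=> [t n] /= [tt0 ns] tab t' tab' tt'.
  have -> : r = r / 2 + r / 2 by lra.
  have t0t : `|t0 - t| < s / 2 by [].
  apply: (@close_trans _ _ _ (c t0)).
    by apply/closeC/hs => //; apply: lt_trans t0t _; lra.
  apply: hs => //; apply: le_lt_trans (ler_distD t _ _) _.
  have -> : s = s / 2 + s / 2 by lra.
  by apply: ltrD => //; apply: lt_trans ns.
exists (N.+1%:R^-1); first by rewrite invr_gt0 ltr0n.
by move=> t t' ta ta'; apply: (hN N) => //=; rewrite in_itv.
Qed.

Definition gridpt (d : R) p : ipoint := (Num.floor (p.1 / d), Num.floor (p.2 / d)).

Definition scale (d : R) (z : ipoint) : R * R := (d * z.1%:~R, d * z.2%:~R).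

Lemma floor_scale (d x : R) : 0 < d -> d * (Num.floor (x / d))%:~R <= x < d * (Num.floor (x / d))%:~R + d.
Proof.
move=> d0; have /andP [h1 h2] := floor_itv (x / d); rewrite intrD in h2.
rewrite ler_pdivlMr // in h1; rewrite ltr_pdivrMr // mulrDl mul1r in h2.
by rewrite mulrC h1.
Qed.

Lemma grid_close d p : 0 < d -> close (2 * d) p (scale d (gridpt d p)).
Proof.
move=> d0; have /andP [h1 h2] := floor_scale p.1 d0; have /andP [h3 h4] := floor_scale p.2 d0.
by split; rewrite ltr_norml /=; apply/andP; split; lra.
Qed.

Lemma floor_near (d x y : R) : 0 < d -> `|x - y| < d ->
  [|| Num.floor (y / d) == Num.floor (x / d), Num.floor (y / d) == Num.floor (x / d) + 1 |
      Num.floor (y / d) == Num.floor (x / d) - 1].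
Proof.
move=> d0; rewrite ltr_norml => /andP [k1 k2].
have /andP [h1 h2] := floor_scale x d0; have /andP [h3 h4] := floor_scale y d0.
have i1 : (Num.floor (y / d)%R < Num.floor (x / d)%R + 2).
  by rewrite -(ltr_int R) intrD -(ltr_pM2l d0) mulrDr; lra.
have i2 : (Num.floor (x / d)%R < Num.floor (y / d)%R + 2).
  by rewrite -(ltr_int R) intrD -(ltr_pM2l d0) mulrDr; lra.
by clear -i1 i2; lia.
Qed.

(** The columns and the rows of the two grid points differ by at most one, so a horizontal and a
    vertical step suffice, with [m] at the bend. *)
Lemma grid_step d p q : 0 < d -> close d p q -> exists w : seq ipoint,
  [/\ path adj (gridpt d p) w, last (gridpt d p) w = gridpt d q &
    forall z, z \in w -> close (4 * d) p (scale d z)].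
Proof.
move=> d0 pq; have [pq1 pq2] := pq.
have gp := grid_close p d0; have gq := grid_close q d0.
pose m : ipoint := ((gridpt d q).1, (gridpt d p).2).
have cm : close (4 * d) p (scale d m).
  case: gp gq => g1 g2 [g3 g4]; split; last by apply: lt_trans g2 _; lra.
  rewrite /= in g3 *; apply: le_lt_trans (ler_distD q.1 _ _) _; lra.
have cq : close (4 * d) p (scale d (gridpt d q)).
  by apply: close_le (close_trans pq gq); lra.
have lk (a b : ipoint) : a.2 = b.2 -> [|| b.1 == a.1, b.1 == a.1 + 1 | b.1 == a.1 - 1] ->
    b = a \/ adj a b.
  case: a b => a1 a2 [b1 b2] /= <-; rewrite adjE /= => /or3P [/eqP ->|->|->]; first by left.
    by right; rewrite eqxx.
  by right; rewrite eqxx /= !orbT.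
have lk2 (a b : ipoint) : a.1 = b.1 -> [|| b.2 == a.2, b.2 == a.2 + 1 | b.2 == a.2 - 1] ->
    b = a \/ adj a b.
  case: a b => a1 a2 [b1 b2] /= <-; rewrite adjE /= => /or3P [/eqP ->|->|->]; first by left.
    by right; rewrite eqxx /= !orbT.
  by right; rewrite eqxx /= !orbT.
have h1 := lk (gridpt d p) m erefl (floor_near d0 pq1).
have h2 := lk2 m (gridpt d q) erefl (floor_near d0 pq2).
case: h1 => h1; case: h2 => h2.
- by exists [::]; rewrite h2 h1.
- exists [:: gridpt d q]; rewrite /= -h1 h2; split => // z.
  by rewrite inE => /eqP ->.
- exists [:: m]; rewrite /= h1 -h2; split => // z.
  by rewrite inE => /eqP ->.
- exists [:: m; gridpt d q]; rewrite /= h1 h2; split => // z.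
  by rewrite !inE => /orP [] /eqP ->.
Qed.

Lemma grid_walk c a b d : {within `[a, b], continuous c} -> a <= b -> 0 < d -> exists w : seq ipoint,
  [/\ path adj (gridpt d (c a)) w, last (gridpt d (c a)) w = gridpt d (c b) &
    forall z, z \in gridpt d (c a) :: w -> exists2 t, a <= t <= b & close (4 * d) (c t) (scale d z)].
Proof.
move=> cc ab d0; have [s s0 hs] := uniform_close cc d0.
(* The parameter advances by at most [s / 2] at a time, and the curve then moves by less than
   [d]. *)
suff claim n t : a <= t <= b -> t - a <= n%:R * (s / 2) -> exists w : seq ipoint,
  [/\ path adj (gridpt d (c a)) w, last (gridpt d (c a)) w = gridpt d (c t) &
    forall z, z \in gridpt d (c a) :: w -> exists2 t, a <= t <= b & close (4 * d) (c t) (scale d z)].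
  apply: (claim (Num.bound ((b - a) / (s / 2)))); first by lra.
  rewrite -ler_pdivrMr; last by lra.
  by apply/ltW/archi_boundP/divr_ge0; lra.
have start z : z = gridpt d (c a) -> exists2 t, a <= t <= b & close (4 * d) (c t) (scale d z).
  by move=> ->; exists a; [lra|apply: close_le (grid_close (c a) d0); lra].
elim: n t => [|n IH] t tab tn.
  have -> : t = a by lra.
  by exists [::]; split => // z; rewrite inE => /eqP /start.
pose t' := Num.max a (t - s / 2).
have t'ab : a <= t' <= b by rewrite /t' /Num.max; case: ifP; lra.
have tt' : `|t' - t| < s.
  by rewrite ltr_norml /t' /Num.max; case: (ltrP a (t - s / 2)) => ?; apply/andP; split; lra.
have [|w [w1 w2 w3]] := IH t' t'ab.
  rewrite -[n.+1]addn1 natrD mulrDl mul1r in tn.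
  have : 0 <= n%:R * (s / 2) by rewrite mulr_ge0 ?ler0n //; lra.
  by rewrite /t' /Num.max; case: ifP => ? ?; lra.
have [u [u1 u2 u3]] := grid_step d0 (hs t' t t'ab tab tt').
exists (w ++ u); rewrite cat_path last_cat w1 w2 u1 u2; split => // z.
rewrite -cat_cons mem_cat => /orP [/w3 //|/u3 h].
by exists t'.
Qed.

End Separate.

Lemma fin_common_radius (R : realType) (I : finType) (P : I -> R -> Prop) :
  (forall i r s, 0 < s -> s <= r -> P i r -> P i s) ->
  (forall i, exists2 r, 0 < r & P i r) -> exists2 r, 0 < r & forall i, P i r.
Proof.
move=> mono ex.
have [r r0 h] : exists2 r : R, 0 < r & forall i, i \in enum I -> P i r.
  elim: (enum I) => [|i s [r r0 h]]; first by exists 1.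
  have [r' r0' h'] := ex i; exists (Num.min r r'); first by rewrite lt_min r0.
  move=> j; rewrite inE => /orP [/eqP ->|/h hj].
    by apply: mono h'; rewrite ?lt_min ?r0 // ge_min lexx orbT.
  by apply: mono hj; rewrite ?lt_min ?r0 // ge_min lexx.
by exists r => // i; apply: h; rewrite mem_enum.
Qed.

(** * From a plane drawing to lattice walks *)

Section Grid.
Variables (R : realType) (T : finType) (E : {set {set T}}).
Variables (pos : T -> R * R) (arc : {set T} -> R -> R * R).
Hypothesis D : plane_drawing E pos arc.

Let pos_inj : injective pos. Proof. by case: D. Qed.

Let cont e : e \in E -> {within `[0, 1], continuous (arc e)}.
Proof. by case: D => _ h _ _ /h [[]]. Qed.

Let ends u v : erel E u v -> arc [set u; v]%SET 0 = pos u /\ arc [set u; v]%SET 1 = pos v \/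
  arc [set u; v]%SET 0 = pos v /\ arc [set u; v]%SET 1 = pos u.
Proof.
case/andP => uv eE; case: D => _ /(_ _ eE) [_ [x [y [exy e0 e1]]]] _ _.
rewrite e0 e1.
have xin : x \in [set u; v]%SET by rewrite exy !inE eqxx.
have yin : y \in [set u; v]%SET by rewrite exy !inE eqxx orbT.
have uin : u \in [set x; y]%SET by rewrite -exy !inE eqxx.
have vin : v \in [set x; y]%SET by rewrite -exy !inE eqxx orbT.
move: xin yin uin vin uv; rewrite !inE.
case/orP => /eqP -> /orP [] /eqP ->; rewrite ?orbb; try by [left|right].
- by move=> _ /eqP ->; rewrite eqxx.
- by move=> /eqP ->; rewrite eqxx.
Qed.

Let arc_inj e s t : e \in E -> 0 <= s <= 1 -> 0 <= t <= 1 -> arc e s = arc e t -> s = t.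
Proof.
by case: D => _ h _ _ /h [[_ h2] _] s01 t01; apply: h2; rewrite in_itv.
Qed.

Let not_vertex e t w : e \in E -> 0 < t < 1 -> arc e t <> pos w.
Proof.
move=> eE t01 E1; case: D => _ h1 h2 _.
have [_ [u [v [euv a0 a1]]]] := h1 e eE.
have : w \in e.
  by apply: h2 => //; exists t => //=; rewrite in_itv /=; lra.
rewrite euv !inE => /orP [] /eqP E2; subst w.
  by have := arc_inj eE _ _ (etrans E1 (esym a0)); lra.
by have := arc_inj eE _ _ (etrans E1 (esym a1)); lra.
Qed.

Let vertex_apart : exists2 r : R, 0 < r &
  (forall u v, u != v -> ~ close r (pos u) (pos v)) /\
  (forall e w t, e \in E -> w \notin e -> 0 <= t <= 1 -> ~ close r (arc e t) (pos w)).
Proof.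
have [||r1 r10 h1] := @fin_common_radius R _ (fun (d : T * T) r => d.1 != d.2 -> ~ close r (pos d.1) (pos d.2)).
- by move=> d r s _ sr h dd /(close_le sr); apply: h.
- case=> u v /=; case: (u =P v) => [->|/eqP uv]; first by exists 1.
  have : (pos u).1 != (pos v).1 \/ (pos u).2 != (pos v).2.
    apply/orP; rewrite -negb_and; apply: contra uv => /andP [/eqP a1 /eqP a2].
    by apply/eqP/pos_inj; rewrite [pos u]surjective_pairing a1 a2 -surjective_pairing.
  case=> h; [exists (`|(pos u).1 - (pos v).1|) | exists (`|(pos u).2 - (pos v).2|)];
    rewrite ?normr_gt0 ?subr_eq0 // => _ []; by rewrite ltxx.
have [||r2 r20 h2] := @fin_common_radius R _ (fun (d : {set T} * T) r => d.1 \in E -> d.2 \notin d.1 ->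
  forall t, 0 <= t <= 1 -> ~ close r (arc d.1 t) (pos d.2)).
- by move=> d r s _ sr h dE dd t t01 /(close_le sr); apply: h.
- case=> e w /=; case: (boolP (e \in E)) => eE; last by exists 1.
  case: (boolP (w \in e)) => west; first by exists 1.
  have [|r r0 h] := point_apart (q := pos w) (cont eE); last by exists r => // _ _.
  move=> t t01 E1; move/negP: west; apply; case: D => _ _ h _; apply: h => //.
  by exists t => //=; rewrite in_itv.
exists (Num.min r1 r2); first by rewrite lt_min r10.
split=> [u v uv|e w t eE west t01].
  have : Num.min r1 r2 <= r1 by rewrite ge_min lexx.
  by move=> le /(close_le le); apply: (h1 (u, v)).
have : Num.min r1 r2 <= r2 by rewrite ge_min lexx orbT.
by move=> le /(close_le le); apply: (h2 (e, w)).
Qed.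

(** Arcs with a common end have distance 0. The walks will therefore follow an arc only for
    parameters in [[s, 1 - s]], with [s] so small that both ends of this part lie in the boxes. *)
Let trim (r : R) : 0 < r -> exists2 s : R, 0 < s & s < 1 / 2 /\ forall e, e \in E ->
  close r (arc e s) (arc e 0) /\ close r (arc e (1 - s)) (arc e 1).
Proof.
move=> r0.
have [||s s0 h] := @fin_common_radius R _ (fun (e : {set T}) s => e \in E -> forall t, 0 <= t <= 1 ->
  (t < s -> close r (arc e t) (arc e 0)) /\ (1 - s < t -> close r (arc e t) (arc e 1))).
- move=> e s s' _ ss h eE t t01; have [g1 g2] := h eE t t01.
  by split=> k; [apply: g1|apply: g2]; lra.
- move=> e; case: (boolP (e \in E)) => eE; last by exists 1.
  have [|s1 s10 h1] := within_close (t0 := 0) (cont eE) _ r0; first by lra.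
  have [|s2 s20 h2] := within_close (t0 := 1) (cont eE) _ r0; first by lra.
  exists (Num.min s1 s2); first by rewrite lt_min s10.
  move=> _ t t01; split => k; apply: closeC.
    by apply: h1 => //; rewrite sub0r normrN ger0_norm; move: k; rewrite ?lt_min; lra.
  apply: h2 => //; rewrite ger0_norm; last by lra.
  have : Num.min s1 s2 <= s2 by rewrite ge_min lexx orbT.
  lra.
exists (Num.min (s / 2) (1 / 4)); first by rewrite lt_min; lra.
set m := Num.min _ _.
have m1 : m <= s / 2 by rewrite ge_min lexx.
have m2 : m <= 1 / 4 by rewrite ge_min lexx orbT.
have m0 : 0 < m by rewrite lt_min; lra.
split; first by lra.
move=> e eE; split.
  by apply: (h e eE m _).1; lra.
by apply: (h e eE (1 - m) _).2; lra.
Qed.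

Let arcs_apart (s : R) : 0 < s -> exists2 r : R, 0 < r & forall e f, e \in E -> f \in E -> e != f ->
  forall t t', s <= t <= 1 - s -> s <= t' <= 1 - s -> ~ close r (arc e t) (arc f t').
Proof.
move=> s0.
have [||r r0 h] := @fin_common_radius R _ (fun (d : {set T} * {set T}) r => d.1 \in E -> d.2 \in E ->
  d.1 != d.2 -> forall t t', s <= t <= 1 - s -> s <= t' <= 1 - s -> ~ close r (arc d.1 t) (arc d.2 t')).
- by move=> d r r' _ rr h h1 h2 h3 t t' t1 t2 /(close_le rr); apply: h.
- case=> e f /=; case: (boolP (e \in E)) => eE; last by exists 1.
  case: (boolP (f \in E)) => fE; last by exists 1.
  case: (boolP (e == f)) => ef; first by exists 1.
  have sub : `[s, 1 - s] `<=` `[0, 1].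
    by move=> t /=; rewrite !in_itv /= => h; lra.
  have [|r r0 h] := curve_apart (continuous_subspaceW sub (cont eE)) (continuous_subspaceW sub (cont fE)); last by exists r.
  move=> t t' t1 t2 E1; case: D => _ _ _ h.
  have [|w _ wE] := h e f eE fE ef (arc e t).
    split; first by exists t => //=; rewrite in_itv /=; lra.
    by exists t' => //=; rewrite in_itv /=; lra.
  by apply: (@not_vertex e t w eE) => //; lra.
by exists r => // e f eE fE ef; apply: (h (e, f)).
Qed.

(* Away from its ends each arc has a positive distance to the other arcs and to the
   vertices; follow it through a lattice that is fine with respect to these
   finitely many distances. *)
Lemma drawing_weak_model : weak_model (erel E).
Proof.
have [r0 r00 [vv av]] := vertex_apart.
pose r := r0 / 8; have r_gt : 0 < r by rewrite divr_gt0.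
have [s s0 [s2 tr]] := trim r_gt.
have [eta eta0 aa] := arcs_apart s0.
(* The boxes have half side [N * d = 2 * r], enough to contain the grid points of everything within
   [r] of the vertex. The summand 16 ensures [8 * d <= r], which keeps boxes apart; the other one
   ensures [8 * d <= eta], twice the error [4 * d] of a walk. *)
pose N := (16 + Num.bound (16 * r / eta))%N.
pose d := 2 * r / N%:R.
have N0 : (0 : R) < N%:R by rewrite ltr0n.
have d0 : 0 < d by rewrite divr_gt0 // mulr_gt0.
have dN : d * N%:R = 2 * r by rewrite /d mulfVK // gt_eqF.
have d8 : 8 * d <= r.
  rewrite -(ler_pM2r N0).
  have : (16 : R) <= N%:R by rewrite ler_nat leq_addr.
  nra.
have deta : 8 * d <= eta.
  rewrite -(ler_pM2r N0).
  have h : 16 * r / eta <= N%:R.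
    apply: (@le_trans _ _ (Num.bound (16 * r / eta))%:R); last by rewrite ler_nat leq_addl.
    by apply/ltW/archi_boundP/divr_ge0; lra.
  rewrite ler_pdivrMr // in h; lra.
pose c v := gridpt d (pos v).
have box_close v z : inbox N (c v) z -> close (2 * r + 3 * d) (scale d z) (pos v).
  rewrite /inbox -!(ler_int R) !rmorphB !intrD /= -!pmulrn => /and4P [h1 h2 h3 h4].
  have /andP [k1 k2] := floor_scale (pos v).1 d0; have /andP [k3 k4] := floor_scale (pos v).2 d0.
  rewrite -(ler_pM2l d0) mulrBr dN in h1; rewrite -(ler_pM2l d0) mulrDr dN in h2.
  rewrite -(ler_pM2l d0) mulrBr dN in h3; rewrite -(ler_pM2l d0) mulrDr dN in h4.
  by rewrite /c /gridpt /= in h1 h2 h3 h4; split; rewrite ltr_norml /=; apply/andP; split; lra.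
have close_box v p : close r p (pos v) -> inbox N (c v) (gridpt d p).
  case; rewrite !ltr_norml => /andP [h1 h2] /andP [h3 h4].
  have /andP [k1 k2] := floor_scale (pos v).1 d0; have /andP [k3 k4] := floor_scale (pos v).2 d0.
  have /andP [l1 l2] := floor_scale p.1 d0; have /andP [l3 l4] := floor_scale p.2 d0.
  rewrite /inbox -!(ler_int R) !rmorphB !intrD /= -!pmulrn.
  by apply/and4P; split; rewrite -(ler_pM2l d0) /c /gridpt; lra.
have /fin_all_exists [w wP] : forall x : T * T, exists w, erel E x.1 x.2 ->
    exists y l, [/\ w = y :: l, path adj y l, inbox N (c x.1) y, inbox N (c x.2) (last y l) &
      forall z, z \in w -> exists2 t, s <= t <= 1 - s & close (4 * d) (arc [set x.1; x.2]%SET t) (scale d z)].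
  case=> u v /=; case: (boolP (erel E u v)) => [uv|_]; last by exists [::].
  have eE : [set u; v]%SET \in E by case/andP: uv.
  have sub : `[s, 1 - s] `<=` `[0, 1] by move=> t /=; rewrite !in_itv /= => h; lra.
  have [|l [l1 l2 l3]] := grid_walk (continuous_subspaceW sub (cont eE)) _ d0; first by lra.
  have [t1 t2] := tr _ eE.
  case: (ends uv) => [[a0 a1]|[a0 a1]]; rewrite a0 a1 in t1 t2.
    exists (gridpt d (arc [set u; v]%SET s) :: l) => _.
    exists (gridpt d (arc [set u; v]%SET s)), l; split => //; first exact: close_box.
    by rewrite l2; apply: close_box.
  set y := gridpt d (arc [set u; v]%SET s) in l1 l2 l3 *.
  exists (rev (y :: l)) => _; exists (last y l), (rev (belast y l)); split.
  - by rewrite lastI rev_rcons.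
  - by rewrite rev_path; apply: sub_path l1 => ? ?; rewrite adj_sym.
  - by rewrite l2; apply: close_box.
  - have -> : last (last y l) (rev (belast y l)) = y; last exact: close_box.
    by case: (l) => //= b l'; rewrite rev_cons last_rcons.
  - by move=> z; rewrite mem_rev => /l3.
exists c, N, (fun u v => w (u, v)); split.
- by rewrite /N addSn.
- move=> u v z h1 h2; apply/eqP; apply: contrapT => /negP uv; apply: (vv u v uv).
  apply: close_le (close_trans (closeC (box_close _ _ h1)) (box_close _ _ h2)).
  by rewrite /r in d8 *; lra.
- by move=> u v /(wP (u, v)) [y [l [h1 h2 h3 h4 _]]]; exists y, l.
- move=> u v z x uv zw xz; have [y [l [_ _ _ _ /(_ z zw) [t t01 h]]]] := wP (u, v) uv.
  have eE : [set u; v]%SET \in E by case/andP: uv.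
  suff : x \in [set u; v]%SET by rewrite !inE => /orP [] /eqP ->; [left|right].
  apply: contrapT => /negP xe; apply: (av _ x t eE xe); first by lra.
  apply: close_le (close_trans h (box_close _ _ xz)); by rewrite /r in d8 *; lra.
- move=> u v u' v' z uv uv' zw zw'.
  have [y [l [_ _ _ _ /(_ z zw) [t t01 h]]]] := wP (u, v) uv.
  have [y' [l' [_ _ _ _ /(_ z zw') [t' t01' h']]]] := wP (u', v') uv'.
  have eE : [set u; v]%SET \in E by case/andP: uv.
  have fE : [set u'; v']%SET \in E by case/andP: uv'.
  case: (boolP ([set u; v]%SET == [set u'; v']%SET)) => [/eqP ef|ef]; last first.
    case: (aa _ _ eE fE ef t t' t01 t01'); apply: close_le (close_trans h (closeC h')); lra.
  have : u \in [set u'; v']%SET by rewrite -ef !inE eqxx.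
  have : v \in [set u'; v']%SET by rewrite -ef !inE eqxx orbT.
  rewrite !inE; case/andP: uv => uv _; move: uv.
  by move=> uv /orP [] /eqP E1 /orP [] /eqP E2; subst u v; auto; rewrite eqxx in uv.
Qed.

End Grid.

Lemma planar_lmodel (R : realType) (T : finType) (E : {set {set T}}) :
  planar R E -> exists L : lmodel (erel E), True.
Proof.
case=> pos [arc D]; apply: weak_modelP; [exact: erel_sym|exact: erel_irr|].
exact: drawing_weak_model D.
Qed.

Local Close Scope classical_set_scope.

Lemma planarW (R : realType) (T : finType) (E E' : {set {set T}}) :
  E' \subset E -> planar R E -> planar R E'.
Proof.
move=> /fintype.subsetP sub [pos [arc [h1 h2 h3 h4]]]; exists pos, arc; split => //.
- by move=> e /sub; apply: h2.
- by move=> e v /sub; apply: h3.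
- by move=> e f /sub eE /sub fE; apply: h4.
Qed.

Lemma planar_rot_exists (R : realType) (T : finType) (E : {set {set T}}) :
  planar R E -> exists rot, planar_rot (erel E) rot.
Proof.
case/planar_lmodel => L _; exists (rotation L); apply: planar_rotation.
  exact: erel_sym.
exact: erel_irr.
Qed.

Lemma planar_add (R : realType) (T : finType) (E : {set {set T}}) u w :
  simple_graph E -> u != w ->
  weak_model (fun x y => [|| erel E x y, (x == u) && (y == w) | (x == w) && (y == u)]) ->
  planar R ([set u; w]%SET |: E)%SET.
Proof.
move=> sE uw; have -> : (fun x y => [|| erel E x y, (x == u) && (y == w) | (x == w) && (y == u)]) =
    erel ([set u; w]%SET |: E)%SET.
  apply/funext => x; apply/funext => y; rewrite /erel finset.in_setU1.
  case: (x =P y) => [->|/eqP xy] /=.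
    apply/negP => /orP [] /andP [/eqP h1 /eqP h2]; move: uw; [rewrite -h1 -h2|rewrite -h1 h2];
    by rewrite eqxx.
  rewrite orbC; congr (_ || _); apply/idP/eqP.
    by case/orP => /andP [/eqP -> /eqP ->] //; rewrite finset.setUC.
  move=> h; have : x \in [set u; w]%SET by rewrite -h !inE eqxx.
  have : y \in [set u; w]%SET by rewrite -h !inE eqxx orbT.
  rewrite !inE => /orP [] /eqP yE /orP [] /eqP xE; subst x y; rewrite ?eqxx ?orbT // in xy *.
move/(weak_modelP (@erel_sym _ _) (@erel_irr _ _)) => [L _].
apply: lmodel_planar L => e; rewrite finset.in_setU1 => /orP [/eqP ->|/sE //].
by rewrite finset.cards2 uw.
Qed.

(** By maximality every edge that can be added to the lattice model is already present: between
    consecutive neighbours of a vertex by [add_next], and across any cut by [add_cut]. *)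
Lemma maximal_planar_rot (R : realType) (T : finType) (E : {set {set T}}) :
  maximal_planar R E -> exists rot, [/\ planar_rot (erel E) rot,
    forall v u, erel E v u -> next (rot v) u != u -> erel E u (next (rot v) u)
    & forall A : pred T, (forall x y, erel E x y -> A x = A y) -> forall x y, A x -> A y].
Proof.
case=> sE pE maxE; have [L _] := planar_lmodel pE.
have e_sym := @erel_sym T E; have eirr := @erel_irr T E.
have add u w : u != w ->
    weak_model (fun x y => [|| erel E x y, (x == u) && (y == w) | (x == w) && (y == u)]) ->
    erel E u w.
  move=> uw wm; rewrite /erel uw /=; apply: contrapT => /negP nE.
  by apply: (maxE [set u; w]%SET) => //; [rewrite finset.cards2 uw|apply: planar_add].
exists (rotation L); split; first exact: planar_rotation.
- move=> v u vu uw; rewrite eq_sym in uw; apply: add => //.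
  exact: (add_next e_sym eirr vu).
- move=> A Ae x y Ax; apply: contrapT => /negP Ay.
  have [u [w [Au Aw wm]]] := add_cut e_sym L Ax Ay Ae.
  have uw : u != w by apply: contraNneq Aw => <-.
  by move: Aw; rewrite -(Ae _ _ (add u w uw wm)) Au.
Qed.

(** * Saturated drawings of frames *)

(** Edges are added as long as possible. The old arcs are kept, so the frame stays straight. *)
Lemma saturate (R : realType) (T : finType) (E H0 : {set {set T}}) (pos : T -> R * R) arc0 :
  H0 \subset E -> plane_drawing H0 pos arc0 ->
  exists (H : {set {set T}}) arc, [/\ H0 \subset H, labeled_plane_saturated E H pos arc &
    forall e, e \in H0 -> arc e = arc0 e].
Proof.
have [n] := ubnP #|E :\: H0|%SET; elim: n H0 arc0 => // n IH H0 arc0 lt H0E d0.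
have [[e [c [eE ec]]]|no] := pselect (exists e c, e \in (E :\: H0)%SET /\
    plane_drawing (e |: H0)%SET pos [eta arc0 with e |-> c]); last first.
  exists H0, arc0; split => //; split => // e eE [c dc]; apply: no; by exists e, c.
have /finset.setDP [eE' eH0] := eE.
have [] := IH (e |: H0)%SET [eta arc0 with e |-> c]; last 1 first.
- move=> H [arc [sH sat arcE]]; exists H, arc; split => //.
    exact: fintype.subset_trans (finset.subsetUr _ _) sH.
  move=> f fH0; rewrite arcE; last by rewrite !inE fH0 orbT.
  by rewrite /=; case: eqP => // fe; rewrite -fe fH0 in eH0.
- have s : ((E :\: (e |: H0)) \subset (E :\: H0) :\ e)%SET.
    by apply/fintype.subsetP => f; rewrite !inE negb_or -andbA.
  apply: leq_ltn_trans (subset_leq_card s) _.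
  by move: lt; rewrite (cardsD1 e (E :\: H0)%SET) eE.
- by rewrite finset.subUset finset.sub1set eE'.
- exact: ec.
Qed.

Section Straight.
Variables (R : realType) (T : finType) (pos : T -> R * R).

Definition straight (e : {set T}) : R -> R * R :=
  if [pick d : T * T | (d.1 != d.2) && (e == [set d.1; d.2]%SET)] is Some d
  then seg (pos d.1) (pos d.2) else fun=> (0, 0).

Lemma straightP u v : u != v -> exists a b, [/\ a != b, [set u; v]%SET = [set a; b]%SET,
  straight [set u; v]%SET = seg (pos a) (pos b) &
  forall p, trace (straight [set u; v]%SET) p <-> inseg (pos u) (pos v) p].
Proof.
move=> uv; rewrite /straight; case: pickP => [[a b] /= /andP [ab /eqP e]|/(_ (u, v))]; last first.
  by rewrite /= uv eqxx.
exists a, b; split => // p.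
have h x y : trace (seg x y) p <-> inseg x y p.
  split; first by case=> t /=; rewrite in_itv /= => t01 <-; exists t.
  by case=> t t01 ->; exists t; rewrite //= in_itv.
rewrite h; case/(set2_inj uv): e => -[-> ->] //; split; exact: insegC.
Qed.

Variable H0 : {set {set T}}.
Hypotheses (sH : simple_graph H0) (pinj : injective pos).
Hypothesis vertex_free : forall a b c, erel H0 a b -> inseg (pos a) (pos b) (pos c) -> c \in [set a; b]%SET.
Hypothesis noncross : forall a b c d p, erel H0 a b -> erel H0 c d -> [set a; b]%SET != [set c; d]%SET ->
  inseg (pos a) (pos b) p -> inseg (pos c) (pos d) p ->
  exists z, [/\ z \in [set a; b]%SET, z \in [set c; d]%SET & p = pos z].

Lemma edge_erel e : e \in H0 -> exists a b, erel H0 a b /\ e = [set a; b]%SET.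
Proof.
move=> eH; have /cards2P [x [y [xy ee]]] : #|e| == 2%N by rewrite sH.
by exists x, y; split=> //; apply/andP; rewrite -ee.
Qed.

Lemma straight_drawing : plane_drawing H0 pos straight.
Proof.
split => // [e /edge_erel [u [v [uv ->]]]|e v /edge_erel [a [b [ab ->]]]|e f].
- have /andP [uNv _] := uv; have [a [b [ab E1 -> _]]] := straightP uNv; split.
    split; first exact/continuous_subspaceT/lipschitz_continuous/lipschitz_seg.
    by move=> s t _ _; apply: seg_inj; rewrite (inj_eq pinj).
  by exists a, b; rewrite seg0 seg1.
- have /andP [aNb _] := ab; have [x [y [_ _ _ h]]] := straightP aNb.
  by move/h; apply: vertex_free.
- case/edge_erel => [a [b [ab ->]]] /edge_erel [c [d [cd ->]]] ne p [].
  have /andP [aNb _] := ab; have [x [y [_ _ _ h]]] := straightP aNb.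
  have /andP [cNd _] := cd; have [x' [y' [_ _ _ h']]] := straightP cNd.
  move=> /h h1 /h' h2; have [z [z1 z2 ->]] := noncross ab cd ne h1 h2.
  by exists z => //=; rewrite finset.in_setI z1.
Qed.

End Straight.

(** Twice the signed area of the triangle, over any ring: frames are checked over the integers and
    used over the reals. *)
Definition ori (K : pzRingType) (a b p : K * K) : K :=
  (b.1 - a.1) * (p.2 - a.2) - (b.2 - a.2) * (p.1 - a.1).

Section Separation.
Variable R : realType.

Lemma ori_lipschitz (a b : R * R) : continuous (fun p : R * R => ori a b p).
Proof.
move=> p; rewrite /ori; apply: cvgB; apply: cvgM; try exact: cvg_cst; apply: cvgB; try exact: cvg_cst.
  exact: cvg_snd.
exact: cvg_fst.
Qed.

(** [ori c a p / ori a b c] is the barycentric coordinate of [p] at [b], and the coordinate at [c]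
    vanishes. *)
Lemma in_triangle_side (a b c p : R * R) : 0 < ori a b c -> 0 <= ori b c p -> 0 <= ori c a p ->
  ori a b p = 0 -> inseg a b p.
Proof.
move=> D h1 h2 h3.
have sumE : ori a b c = ori a b p + ori b c p + ori c a p by rewrite /ori; ring.
have cE : ori c a p / ori a b c <= 1 by rewrite ler_pdivrMr //; lra.
exists (ori c a p / ori a b c); first by rewrite cE andbT; apply: divr_ge0 => //; apply: ltW.
have D0 : ori a b c != 0 by rewrite gt_eqF.
set s := ori c a p / ori a b c; have sD : s * ori a b c = ori c a p by rewrite /s divfK.
have i1 : ori a b c * p.1 = ori a b c * a.1 + s * ori a b c * (b.1 - a.1) + ori a b p * (c.1 - a.1).
  by rewrite sD /ori; ring.
have i2 : ori a b c * p.2 = ori a b c * a.2 + s * ori a b c * (b.2 - a.2) + ori a b p * (c.2 - a.2).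
  by rewrite sD /ori; ring.
rewrite [p]surjective_pairing /seg; congr pair; apply: (mulfI D0).
  by rewrite i1 h3; ring.
by rewrite i2 h3; ring.
Qed.

Variables (T : finType) (H : {set {set T}}) (pos : T -> R * R) (arc : {set T} -> R -> R * R).
Hypothesis dH : plane_drawing H pos arc.

(** The minimum of the three orientations is positive at [x] and negative at [y], so it vanishes
    somewhere on an arc between them. This point lies on a side of the triangle, hence would be a
    common vertex of two edges without one. *)
Lemma triangle_separates (a b c x y : T) :
  (forall u v, (u, v) \in [:: (a, b); (b, c); (c, a)] -> [set u; v]%SET \in H /\
     forall p, inseg (pos u) (pos v) p -> trace (arc [set u; v]%SET) p) ->
  x \notin [:: a; b; c] -> y \notin [:: a; b; c] ->
  0 < ori (pos a) (pos b) (pos x) -> 0 < ori (pos b) (pos c) (pos x) -> 0 < ori (pos c) (pos a) (pos x) ->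
  [|| ori (pos a) (pos b) (pos y) < 0, ori (pos b) (pos c) (pos y) < 0 | ori (pos c) (pos a) (pos y) < 0] ->
  [set x; y]%SET \notin H.
Proof.
move=> sides xn yn x1 x2 x3 yout; apply/negP => eH.
have [pinj arcs _ cross] := dH.
have [[ac _] [u [v [uv a0 a1]]]] := arcs _ eH.
pose g p := Num.min (ori (pos a) (pos b) p) (Num.min (ori (pos b) (pos c) p) (ori (pos c) (pos a) p)).
have gx : 0 < g (pos x) by rewrite !lt_min x1 x2 x3.
have gy : g (pos y) < 0 by rewrite !gt_min.
have gcont : {within `[0, 1], continuous (g \o arc [set x; y]%SET)}%classic.
  move=> t; apply: (@continuous_comp _ _ _ (arc [set x; y]%SET : subspace _ -> _) g t); first exact: ac.
  by apply: min_fun_continuous; [|apply: min_fun_continuous]; exact: ori_lipschitz.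
have [t t01 /= gt] : exists2 t, t \in `[0, 1] & (g \o arc [set x; y]%SET) t = 0.
  apply: IVT => //=; rewrite a0 a1.
  have xy : x != y by apply/eqP => xy; move: gx; rewrite xy; lra.
  case/(set2_inj xy): uv => -[<- <-].
    by rewrite ge_min le_max (ltW gx) (ltW gy) ?orbT.
  by rewrite ge_min le_max (ltW gx) (ltW gy) ?orbT.
set p := arc [set x; y]%SET t in gt.
have tp : trace (arc [set x; y]%SET) p by exists t.
have D : 0 < ori (pos a) (pos b) (pos c).
  have -> : ori (pos a) (pos b) (pos c) = ori (pos a) (pos b) (pos x) + ori (pos b) (pos c) (pos x) + ori (pos c) (pos a) (pos x).
    by rewrite /ori; ring.
  by lra.
have D2 : ori (pos b) (pos c) (pos a) = ori (pos a) (pos b) (pos c) by rewrite /ori; ring.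
have D3 : ori (pos c) (pos a) (pos b) = ori (pos a) (pos b) (pos c) by rewrite /ori; ring.
have : 0 <= g p by rewrite gt.
rewrite /g !le_min => /and3P [p1 p2 p3].
have [q [w [qw qwp]]] : exists q w, (q, w) \in [:: (a, b); (b, c); (c, a)] /\ inseg (pos q) (pos w) p.
  have : [|| ori (pos a) (pos b) p == 0, ori (pos b) (pos c) p == 0 | ori (pos c) (pos a) p == 0].
    move: gt; rewrite /g /Num.min; case: ifP => _; first by move=> ->; rewrite eqxx.
    by case: ifP => _ ->; rewrite eqxx !orbT.
  case/or3P => /eqP p0.
  - by exists a, b; rewrite !inE eqxx; split => //; apply: (@in_triangle_side _ _ (pos c)).
  - by exists b, c; rewrite !inE eqxx orbT; split => //; apply: (@in_triangle_side _ _ (pos a)); rewrite ?D2.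
  - by exists c, a; rewrite !inE eqxx !orbT; split => //; apply: (@in_triangle_side _ _ (pos b)); rewrite ?D3.
have [fH /(_ _ qwp) tf] := sides _ _ qw.
have qwin z : z \in [set q; w]%SET -> z \in [:: a; b; c].
  by move: qw; rewrite !inE => /or3P [] /eqP [-> ->] /orP [] /eqP ->; rewrite eqxx ?orbT.
have ne : [set q; w]%SET != [set x; y]%SET.
  apply/eqP => h; have := qwin x; rewrite h !inE eqxx => /(_ isT) h'.
  by move: xn; rewrite !inE h'.
have [z /= + _] := cross _ _ fH eH ne p (conj tf tp).
rewrite finset.in_setI => /andP [/qwin z1]; rewrite !inE => /orP [] /eqP zE; subst z.
  by rewrite z1 in xn.
by rewrite z1 in yn.
Qed.

End Separation.

Section OriReal.
Variable R : realType.
Implicit Types a b c d p : R * R.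

Lemma ori_seg a b c d t : ori a b (seg c d t) = (1 - t) * ori a b c + t * ori a b d.
Proof. by rewrite /ori /seg /=; ring. Qed.

Lemma ori_inseg a b p : inseg a b p -> ori a b p = 0.
Proof. by case=> t _ ->; rewrite ori_seg /ori; ring. Qed.

Lemma ori_swap a b p : ori b a p = - ori a b p.
Proof. by rewrite /ori; ring. Qed.

Lemma convex_gt (y u v t : R) : 0 <= t <= 1 -> y < u -> y < v -> y < (1 - t) * u + t * v.
Proof.
move=> /andP [t0 t1] h1 h2; rewrite -subr_gt0.
have -> : (1 - t) * u + t * v - y = (1 - t) * (u - y) + t * (v - y) by ring.
have [t0'|t0'] := ltrP 0 t; last first.
  have t0E : t = 0 by lra.
  by rewrite t0E; lra.
by apply: ltr_wpDl; [apply: mulr_ge0; lra|apply: mulr_gt0; lra].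
Qed.

Lemma convex_lt (y u v t : R) : 0 <= t <= 1 -> u < y -> v < y -> (1 - t) * u + t * v < y.
Proof.
move=> t01 h1 h2; have := @convex_gt (- y) (- u) (- v) t t01; rewrite !ltrN2 => /(_ h1 h2).
by lra.
Qed.

Lemma ori_pos a b c d t : 0 <= t <= 1 -> 0 < ori a b c -> 0 < ori a b d -> 0 < ori a b (seg c d t).
Proof. by move=> t01 h1 h2; rewrite ori_seg; apply: convex_gt. Qed.

Lemma ori_neg a b c d t : 0 <= t <= 1 -> ori a b c < 0 -> ori a b d < 0 -> ori a b (seg c d t) < 0.
Proof. by move=> t01 h1 h2; rewrite ori_seg; apply: convex_lt. Qed.

Lemma share_endpoint a b d p : ori a b d != 0 -> inseg a b p -> inseg a d p -> p = a.
Proof.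
move=> h /ori_inseg p0 [t _ pE]; move: p0; rewrite pE ori_seg.
have -> : ori a b a = 0 by rewrite /ori; ring.
by rewrite mulr0 add0r => /eqP; rewrite mulf_eq0 (negbTE h) orbF => /eqP ->; rewrite seg0.
Qed.

Lemma one_side a b c d p : (0 < ori a b c) && (0 < ori a b d) || (ori a b c < 0) && (ori a b d < 0) ->
  inseg a b p -> inseg c d p -> False.
Proof.
move=> h /ori_inseg p0 [t t01 pE]; case/orP: h => /andP [h1 h2].
  by have := ori_pos t01 h1 h2; rewrite -pE p0; lra.
by have := ori_neg t01 h1 h2; rewrite -pE p0; lra.
Qed.

End OriReal.

(** * Frames certified by integer computation *)

Section Frame.
(* A frame is a straight-line drawing on the integer points [pts]; the cell
   number [i] is the point [pts_i] or, for [size pts <= i], a horizontal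
   segment [(x1, x2, y)] reserved for the vertices of one region. *)
Variables (pts : seq (int * int)) (regs : seq (int * int * int)).
Variables (edges : seq (nat * nat)) (tris : seq (nat * nat * nat)).

Definition pt i : int * int := nth (0, 0) pts i.
Definition cell i : int * int * int :=
  if (i < size pts)%N then ((pt i).1, (pt i).1, (pt i).2) else nth (0, 0, 0) regs (i - size pts)%N.
Definition cell_l i : int * int := ((cell i).1.1, (cell i).2).
Definition cell_r i : int * int := ((cell i).1.2, (cell i).2).

Definition left_of a b i := (0 < ori (pt a) (pt b) (cell_l i)) && (0 < ori (pt a) (pt b) (cell_r i)).
Definition right_of a b i := (ori (pt a) (pt b) (cell_l i) < 0) && (ori (pt a) (pt b) (cell_r i) < 0).

Definition corner (t : nat * nat * nat) i := [|| i == t.1.1, i == t.1.2 | i == t.2].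
Definition inside (t : nat * nat * nat) i :=
  [&& left_of t.1.1 t.1.2 i, left_of t.1.2 t.2 i & left_of t.2 t.1.1 i].
Definition outside (t : nat * nat * nat) i :=
  [|| right_of t.1.1 t.1.2 i, right_of t.1.2 t.2 i | right_of t.2 t.1.1 i].

Definition sepb i j := has (fun t => [&& ~~ corner t i, ~~ corner t j &
  inside t i && outside t j || inside t j && outside t i]) tris.

(** A sufficient test that the cell meets the edge at most in an end; comparing heights serves the
    cells that are on neither side of the line through the edge. *)
Definition off_edge i (e : nat * nat) := let y := (cell i).2 in
  [|| i == e.1, i == e.2, left_of e.1 e.2 i, right_of e.1 e.2 i,
      (y < (pt e.1).2) && (y < (pt e.2).2) | ((pt e.1).2 < y) && ((pt e.2).2 < y)].

Definition uncrossed (e f : nat * nat) := let: (a, b) := e in let: (c, d) := f in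
  if a == c then (b == d) || (ori (pt a) (pt b) (pt d) != 0)
  else if a == d then (b == c) || (ori (pt a) (pt b) (pt c) != 0)
  else if b == c then ori (pt a) (pt b) (pt d) != 0
  else if b == d then ori (pt a) (pt b) (pt c) != 0
  else [|| (0 < ori (pt a) (pt b) (pt c)) && (0 < ori (pt a) (pt b) (pt d)),
           (ori (pt a) (pt b) (pt c) < 0) && (ori (pt a) (pt b) (pt d) < 0),
           (0 < ori (pt c) (pt d) (pt a)) && (0 < ori (pt c) (pt d) (pt b)) |
           (ori (pt c) (pt d) (pt a) < 0) && (ori (pt c) (pt d) (pt b) < 0)].

Definition cells := iota 0 (size pts + size regs).

(** Pairwise different heights keep the cells disjoint, and a region with two different ends has
    room for any number of vertices. *)
Definition frame_ok :=
  [&& uniq [seq (cell i).2 | i <- cells],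
      all (fun r => r.1.1 != r.1.2) regs,
      all (fun e => [&& e.1 < size pts, e.2 < size pts & e.1 != e.2]%N) edges,
      all (fun t => all (fun e => (e \in edges) || ((e.2, e.1) \in edges))
        [:: (t.1.1, t.1.2); (t.1.2, t.2); (t.2, t.1.1)]) tris,
      all (fun e => all (fun i => off_edge i e) cells) edges &
      all (fun e => all (uncrossed e) edges) edges].

Hypothesis ok : frame_ok.
Variables (R : realType) (T : finType) (E : {set {set T}}) (s : seq T) (reg : T -> nat).
Hypotheses (sE : simple_graph E) (us : uniq s) (ss : size s = size pts).
Hypothesis regP : forall u, (reg u < size regs)%N.
Variable x0 : T.
Hypothesis edgesE : forall e, e \in edges -> [set nth x0 s e.1; nth x0 s e.2]%SET \in E.

Definition cell_of u := if u \in s then index u s else (size pts + reg u)%N.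

Definition real_pt (p : int * int) : R * R := (p.1%:~R, p.2%:~R).
(** The rank spreads the vertices of one region over its segment. *)
Definition param (u : T) : R := (enum_rank u).+1%:R / #|T|.+1%:R.
Definition place u := seg (real_pt (cell_l (cell_of u))) (real_pt (cell_r (cell_of u))) (param u).

Lemma ori_real a b p : ori (real_pt a) (real_pt b) (real_pt p) = (ori a b p)%:~R.
Proof. by rewrite /ori /real_pt /= !(intrM, intrB). Qed.

Lemma param01 u : 0 <= param u <= 1.
Proof.
rewrite /param divr_ge0 //= ler_pdivrMr ?ltr0n // mul1r ler_nat ltnS.
exact: ltnW (ltn_ord _).
Qed.

Lemma param_inj : injective param.
Proof.
move=> u v /(congr1 (fun x => x * #|T|.+1%:R)); rewrite /param !divfK ?pnatr_eq0 //.
by move/eqP; rewrite eqr_nat eqSS => /eqP /val_inj /enum_rank_inj.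
Qed.

Lemma cell_ofP u : (cell_of u < size pts + size regs)%N.
Proof.
rewrite /cell_of; case: ifP => h; last by rewrite ltn_add2l.
by apply: ltn_addr; rewrite -ss index_mem.
Qed.

Lemma place2 u : (place u).2 = (cell (cell_of u)).2%:~R.
Proof. by rewrite /place /seg /cell_l /cell_r /real_pt /=; ring. Qed.

Lemma cell_pt i : (i < size pts)%N -> cell_l i = pt i /\ cell_r i = pt i.
Proof. by rewrite /cell_l /cell_r /cell => ->; rewrite /=; case: (pt i). Qed.

Lemma place_nth i : (i < size pts)%N -> place (nth x0 s i) = real_pt (pt i).
Proof.
move=> h; rewrite /place /cell_of mem_nth ?ss // index_uniq ?ss //.
have [-> ->] := cell_pt h; rewrite /seg /real_pt /=; congr pair; ring.
Qed.

Lemma place_inj : injective place.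
Proof.
move=> u v h; case/and5P: ok => uy rx _ _ _.
have cE : cell_of u = cell_of v.
  have : (cell (cell_of u)).2 = (cell (cell_of v)).2.
    by have := congr1 snd h; rewrite !place2 => /intr_inj.
  have nthE w : (cell (cell_of w)).2 = nth 0 [seq (cell i).2 | i <- cells] (cell_of w).
    by rewrite (nth_map 0%N) ?size_iota ?cell_ofP // nth_iota ?cell_ofP.
  rewrite !nthE => /eqP; rewrite nth_uniq ?size_map ?size_iota ?cell_ofP // => /eqP //.
move: (cE); rewrite {1 2}/cell_of; case us1 : (u \in s); case vs : (v \in s).
- by move=> e; rewrite -(nth_index x0 us1) e nth_index.
- by move=> e; have : (index u s < size pts)%N; [rewrite -ss index_mem|rewrite e; lia].
- by move=> e; have : (index v s < size pts)%N; [rewrite -ss index_mem|rewrite -e; lia].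
- move=> _; apply: param_inj; apply: (@seg_inj _ (real_pt (cell_l (cell_of u))) (real_pt (cell_r (cell_of u)))).
    have := allP rx (nth (0, 0, 0) regs (reg u)) (mem_nth _ (regP u)).
    rewrite xpair_eqE /= /cell /cell_of us1 ltnNge leq_addr /= addKn negb_and eqr_int => ->//.
  by rewrite -/(place u) h /place cE.
Qed.

Definition frame_edges : {set {set T}} := [set e | has (fun p => e == [set nth x0 s p.1; nth x0 s p.2]%SET) edges]%SET.

Lemma frame_edgesP a b : erel frame_edges a b -> exists2 p, p \in edges &
  (a = nth x0 s p.1 /\ b = nth x0 s p.2) \/ (a = nth x0 s p.2 /\ b = nth x0 s p.1).
Proof. by case/andP => ab; rewrite inE => /hasP [p pe /eqP /(set2_inj ab) h]; exists p. Qed.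

Lemma edge_size e : e \in edges -> [/\ (e.1 < size pts)%N, (e.2 < size pts)%N & e.1 != e.2].
Proof. by move=> he; case/and5P: ok => _ _ /allP /(_ e he) /and3P []. Qed.

Lemma side_left a b u : (a < size pts)%N -> (b < size pts)%N -> left_of a b (cell_of u) ->
  0 < ori (place (nth x0 s a)) (place (nth x0 s b)) (place u).
Proof.
move=> ha hb /andP [h1 h2]; rewrite !place_nth // [place u]/place; apply: ori_pos (param01 u) _ _.
  by rewrite ori_real ltr0z.
by rewrite ori_real ltr0z.
Qed.

Lemma side_right a b u : (a < size pts)%N -> (b < size pts)%N -> right_of a b (cell_of u) ->
  ori (place (nth x0 s a)) (place (nth x0 s b)) (place u) < 0.
Proof.
move=> ha hb /andP [h1 h2]; rewrite !place_nth // [place u]/place; apply: ori_neg (param01 u) _ _.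
  by rewrite ori_real ltrz0.
by rewrite ori_real ltrz0.
Qed.

Lemma off_edgeP a b c : erel frame_edges a b -> inseg (place a) (place b) (place c) -> c \in [set a; b]%SET.
Proof.
case/frame_edgesP => e ee ab; have [e1 e2 e12] := edge_size ee.
wlog [-> ->] : a b ab / a = nth x0 s e.1 /\ b = nth x0 s e.2.
  move=> W; case: (ab) => h; first by apply: (W a b) => //; left.
  by move/insegC/(W b a); rewrite finset.setUC; apply; [left; case: h|case: h].
move=> h; case/and5P: ok => _ _ _ _ /andP [/allP /(_ e ee) /allP /(_ (cell_of c)) + _].
rewrite mem_iota add0n cell_ofP => /(_ isT).
have ix i : (i < size pts)%N -> cell_of c = i -> c = nth x0 s i.
  rewrite /cell_of; case: ifP => cs hi; first by move=> <-; rewrite nth_index.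
  by lia.
case/or4P => [/eqP /ix -> //|/eqP /ix -> //|/side_left l|]; rewrite ?inE ?eqxx ?orbT //.
  by have := l e1 e2; rewrite (ori_inseg h) ltxx.
case/or3P => [/side_right l|/andP [y1 y2]|/andP [y1 y2]].
- by have := l e1 e2; rewrite (ori_inseg h) ltxx.
- move: h; rewrite !place_nth // => -[t t01 /(congr1 snd)]; rewrite place2 /seg /=.
  move=> h; have := @convex_gt R (cell (cell_of c)).2%:~R (pt e.1).2%:~R (pt e.2).2%:~R t t01.
  by rewrite !ltr_int -h ltxx => /(_ y1 y2).
- move: h; rewrite !place_nth // => -[t t01 /(congr1 snd)]; rewrite place2 /seg /=.
  move=> h; have := @convex_lt R (cell (cell_of c)).2%:~R (pt e.1).2%:~R (pt e.2).2%:~R t t01.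
  by rewrite !ltr_int -h ltxx => /(_ y1 y2).
Qed.

Lemma uncrossedP a b c d p : erel frame_edges a b -> erel frame_edges c d -> [set a; b]%SET != [set c; d]%SET ->
  inseg (place a) (place b) p -> inseg (place c) (place d) p ->
  exists z, [/\ z \in [set a; b]%SET, z \in [set c; d]%SET & p = place z].
Proof.
case/frame_edgesP => [[i j] ee] ab; case/frame_edgesP => [[k l] ff] cd.
have /= [i1 j1 ij] := edge_size ee; have /= [k1 l1 kl] := edge_size ff.
wlog [-> ->] : a b ab / a = nth x0 s i /\ b = nth x0 s j.
  move=> W; case: (ab) => h; first by apply: (W a b) => //; left.
  rewrite [[set a; b]%SET]finset.setUC => ne /insegC; apply: (W b a) => //; by [left; case: h|case: h].
wlog [-> ->] : c d cd / c = nth x0 s k /\ d = nth x0 s l.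
  move=> W; case: (cd) => h; first by apply: (W c d) => //; left.
  rewrite [[set c; d]%SET]finset.setUC => ne h1 /insegC; apply: (W d c) => //; by [left; case: h|case: h].
move=> ne h1 h2; case/and5P: ok => _ _ _ _ /andP [_ /allP /(_ _ ee) /allP /(_ _ ff)] /=.
rewrite !place_nth // in h1 h2.
have oc x y z : (ori (pt x) (pt y) (pt z) != 0) -> ori (real_pt (pt x)) (real_pt (pt y)) (real_pt (pt z)) != 0 :> R.
  by rewrite ori_real intr_eq0.
have oc' x y z : (ori (pt x) (pt y) (pt z) != 0) -> ori (real_pt (pt y)) (real_pt (pt x)) (real_pt (pt z)) != 0 :> R.
  by rewrite ori_swap oppr_eq0; apply: oc.
have fin z : (z < size pts)%N -> z \in [:: i; j] -> z \in [:: k; l] -> p = real_pt (pt z) ->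
    exists z, [/\ z \in [set nth x0 s i; nth x0 s j]%SET, z \in [set nth x0 s k; nth x0 s l]%SET & p = place z].
  move=> zs zi zk pz; exists (nth x0 s z); rewrite place_nth // !inE; split => //.
    by move: zi; rewrite !inE => /orP [] /eqP ->; rewrite eqxx ?orbT.
  by move: zk; rewrite !inE => /orP [] /eqP ->; rewrite eqxx ?orbT.
case: (eqVneq i k) => ik.
  subst k; case/orP => [/eqP jl|/oc h]; first by subst l; rewrite eqxx in ne.
  by apply: (fin i); rewrite ?inE ?eqxx ?orbT //; apply: share_endpoint h h1 h2.
case: (eqVneq i l) => il.
  subst l; case/orP => [/eqP jk|/oc h]; first by subst k; rewrite finset.setUC eqxx in ne.
  by apply: (fin i); rewrite ?inE ?eqxx ?orbT //; apply: share_endpoint h h1 (insegC h2).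
case: (eqVneq j k) => jk.
  subst k => /oc' h.
  by apply: (fin j); rewrite ?inE ?eqxx ?orbT //; apply: share_endpoint h (insegC h1) h2.
case: (eqVneq j l) => jl.
  subst l => /oc' h.
  by apply: (fin j); rewrite ?inE ?eqxx ?orbT //; apply: share_endpoint h (insegC h1) (insegC h2).
rewrite orbA => h; exfalso; case/orP: h => h.
  by apply: one_side h1 h2; rewrite !ori_real !ltr0z !ltrz0.
by apply: one_side h2 h1; rewrite !ori_real !ltr0z !ltrz0.
Qed.

Theorem frame_saturated : exists (H : {set {set T}}) pos arc, [/\ H \subset E,
  @labeled_plane_saturated R T E H pos arc & forall x y, erel H x y -> ~~ sepb (cell_of x) (cell_of y)].
Proof.
have sH : simple_graph frame_edges.
  move=> e; rewrite inE => /hasP [p pe /eqP ->]; have [h1 h2 h3] := edge_size pe.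
  by rewrite cards2 nth_uniq ?ss // h3.
have HE : frame_edges \subset E.
  by apply/fintype.subsetP => e; rewrite inE => /hasP [p /edgesE h /eqP ->].
have d0 := straight_drawing sH place_inj off_edgeP uncrossedP.
have [H [arc [H0H sat arcE]]] := saturate HE d0.
exists H, place, arc; have [sub dH _] := sat; split => // x y xy; apply/negP.
have main x' y' t : t \in tris -> ~~ corner t (cell_of x') -> ~~ corner t (cell_of y') ->
    inside t (cell_of x') -> outside t (cell_of y') -> [set x'; y']%SET \notin H.
  move=> tt cx cy /and3P [i1 i2 i3] ot.
  case/and5P: ok => _ _ _ /allP /(_ t tt) /= ts _.
  have side e : (e \in edges) || ((e.2, e.1) \in edges) -> [/\ (e.1 < size pts)%N, (e.2 < size pts)%N & e.1 != e.2].
    case/orP => /edge_size [] //= h1 h2; rewrite eq_sym; by split.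
  case/and4P: ts => t1 t2 t3 _; have [/= a1 b1 ab] := side _ t1; have [/= _ c1 bc] := side _ t2.
  have nocorner z : ~~ corner t (cell_of z) -> z \notin [:: nth x0 s t.1.1; nth x0 s t.1.2; nth x0 s t.2].
    apply: contra; rewrite /corner /cell_of !inE.
    by case/or3P => /eqP ->; rewrite mem_nth ?ss // index_uniq ?ss // eqxx ?orbT.
  apply: (triangle_separates dH _ (nocorner _ cx) (nocorner _ cy)); try exact: side_left.
    have triE e : (e \in edges) || ((e.2, e.1) \in edges) ->
        [set nth x0 s e.1; nth x0 s e.2]%SET \in H /\ forall p, inseg (place (nth x0 s e.1)) (place (nth x0 s e.2)) p ->
          trace (arc [set nth x0 s e.1; nth x0 s e.2]%SET) p.
      move=> he; have eH : [set nth x0 s e.1; nth x0 s e.2]%SET \in frame_edges.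
        rewrite inE; apply/hasP; case/orP: he => he; first by exists e.
        by exists (e.2, e.1) => //=; rewrite finset.setUC.
      split; first exact: (fintype.subsetP H0H).
      move=> p hp; rewrite arcE //; have [h1 h2 h3] := side _ he.
      have ne : nth x0 s e.1 != nth x0 s e.2 by rewrite nth_uniq ?ss.
      by have [a [b [_ _ _ h]]] := straightP place ne; apply/h.
    by move=> u v; rewrite !inE => /or3P [] /eqP [-> ->]; [exact: triE t1|exact: triE t2|exact: triE t3].
  by apply/or3P; case/or3P: ot => h; [apply: Or31|apply: Or32|apply: Or33]; apply: side_right.
case/andP: xy => _ xyH; case/hasP => t tt /and3P [cx cy /orP [] /andP [h1 h2]].
  by have := main x y t tt cx cy h1 h2; rewrite xyH.
by have := main y x t tt cy cx h1 h2; rewrite finset.setUC xyH.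
Qed.

End Frame.

(* The coordinates were found by a random search. *)
Definition fan_pts : seq (int * int) := [:: (10, 10); (9, 13); (1, 9); (2, 7); (3, 1); (5, 0); (10, 6)].
Definition fan_regs : seq (int * int * int) := [:: (6, 7, 11); (2, 3, 8); (3, 4, 3); (4, 5, 2); (8, 9, 5)].
Definition fan_tris : seq (nat * nat * nat) := [:: (0, 1, 2); (0, 2, 3); (0, 3, 4); (0, 4, 5); (0, 5, 6)]%N.

Definition wheel5_pts : seq (int * int) := [:: (5, 6); (10, 10); (10, 0); (3, 2); (0, 4); (7, 11)].
Definition wheel5_regs : seq (int * int * int) := [:: (8, 9, 3); (7, 8, 1); (3, 4, 5); (4, 5, 7); (6, 7, 8)].
Definition wheel5_tris : seq (nat * nat * nat) := [:: (0, 2, 1); (0, 3, 2); (0, 4, 3); (0, 5, 4); (0, 1, 5)]%N.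

Definition far_pts : seq (int * int) := [:: (7, 4); (12, 0); (5, 2); (2, 10); (10, 5); (10, 9); (0, 11); (8, 13)].
Definition far_regs : seq (int * int * int) := [:: (9, 10, 1); (4, 5, 6); (5, 6, 7); (9, 10, 3); (5, 6, 12)].
Definition far_tris : seq (nat * nat * nat) := [:: (0, 2, 1); (0, 3, 2); (0, 4, 3); (0, 1, 4); (5, 7, 6)]%N.

Definition near_pts : seq (int * int) := [:: (5, 8); (13, 13); (13, 2); (8, 0); (1, 10); (11, 5); (8, 9)].
Definition near_regs : seq (int * int * int) := [:: (11, 12, 4); (8, 9, 1); (4, 5, 6); (6, 7, 11); (10, 11, 7)].
Definition near_tris : seq (nat * nat * nat) := [:: (0, 2, 1); (0, 3, 2); (0, 4, 3); (0, 1, 4); (1, 6, 5)]%N.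

Lemma sum5 (f : nat -> nat) : (\sum_(r < 5) f r = sumn [seq f r | r <- iota 0 5])%N.
Proof. by rewrite sumnE big_map -[iota 0 5]/(index_iota 0 5) big_mkord. Qed.

Lemma regions_check (k : nat) (sep : nat -> nat -> bool) :
  all (fun r => all (fun r' => (r == r') || sep (k + r)%N (k + r')%N) (iota 0 5)) (iota 0 5) ->
  forall r r' : 'I_5, r != r' -> sep (k + r)%N (k + r')%N.
Proof.
move=> /allP h r r' rr; have := h r; rewrite mem_iota ltn_ord => /(_ isT) /allP /(_ r').
by rewrite mem_iota ltn_ord => /(_ isT); rewrite (negbTE (rr : nat_of_ord r != r')).
Qed.

Lemma mult_check (k m a : nat) (sep : nat -> nat -> bool) :
  all (fun i => sumn [seq nat_of_bool (~~ sep i (k + r)%N) | r <- iota 0 5] <= m)%N (iota a (k - a)) ->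
  forall i, (a <= i < k)%N -> (\sum_(r < 5) ~~ sep i (k + r) <= m)%N.
Proof.
move=> /allP h i /andP [ai ik]; rewrite (sum5 (fun r => ~~ sep i (k + r)%N)); apply: h.
by rewrite mem_iota ai subnKC // (leq_trans ai) // ltnW.
Qed.

(** * Conclusion *)

Section Main.
Variables (R : realType) (T : finType) (E : {set {set T}}).

Lemma admissible_saturated pts regs edges tris : simple_graph E ->
  frame_ok pts regs edges tris -> size regs = 5 ->
  admissible E (size pts) edges (sepb pts regs tris) ->
  exists (H : {set {set T}}) pos arc, @labeled_plane_saturated R T E H pos arc /\ (#|H| <= #|T| + 7)%N.
Proof.
move=> sE ok r5 [s [reg [x0 [us ss regP edgesE bound]]]].
have regP' u : (reg u < size regs)%N by rewrite r5.
have [H [pos [arc [HE sat Hsep]]]] := frame_saturated ok R us ss regP' edgesE.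
exists H, pos, arc; split => //; apply: bound => // y z yz.
by have := Hsep y z yz; rewrite /cell_of /cell_of_reg ss.
Qed.

Lemma saturated_lpsr (H : {set {set T}}) pos arc m : @labeled_plane_saturated R T E H pos arc ->
  (#|H| <= m)%N -> lpsr R E <= m%:R / #|E|%:R.
Proof.
move=> sat Hm; apply: (@le_trans _ _ (#|H|%:R / #|E|%:R)); last first.
  by rewrite ler_wpM2r ?invr_ge0 // ler_nat.
by apply: bigmin_le_cond; apply/asboolP; exists pos, arc.
Qed.

End Main.

Theorem theorem2 (R : realType) (T : finType) (E : {set {set T}})
    (hn : (47 <= #|T|)%N) (hE : maximal_planar R E) :
  lpsr R E <= (#|T|%:R + 7) / (3 * #|T|%:R - 6).
Proof.
have [sE pE _] := hE; have [rot [PR next3 conn]] := maximal_planar_rot hE.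
have hpE : hplanar E by move=> E' E'E; apply: (@planar_rot_exists R); apply: planarW pE.
have T3 : (3 <= #|T|)%N by apply: leq_trans hn.
have next_adj v u : erel E v u -> erel E u (next (rot v) u).
  by move=> vu; apply: next3 vu (next_neq PR next3 conn T3 vu).
have mE : (#|E| + 6 = 3 * #|T|)%N.
  apply/eqP; rewrite eqn_leq (triangulation_edges sE PR next3 conn T3) andbT -cardsT.
  by apply: planar_edges => //; rewrite cardsT.
suff [H [pos [arc [sat Hle]]]] : exists (H : {set {set T}}) pos arc,
    @labeled_plane_saturated R T E H pos arc /\ (#|H| <= #|T| + 7)%N.
  have := saturated_lpsr sat Hle; rewrite natrD.
  have -> // : #|E|%:R = 3 * #|T|%:R - 6 :> R.
  by rewrite -natrM -mE natrD addrK.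
have ok1 : frame_ok fan_pts fan_regs fan_edges fan_tris by vm_compute.
have ok2 : frame_ok wheel5_pts wheel5_regs wheel5_edges wheel5_tris by vm_compute.
have ok3 : frame_ok far_pts far_regs far_edges far_tris by vm_compute.
have ok4 : frame_ok near_pts near_regs near_edges near_tris by vm_compute.
have regs_fan := @regions_check 7 (sepb fan_pts fan_regs fan_tris) ltac:(by vm_compute).
have mult_fan := @mult_check 7 2 1 (sepb fan_pts fan_regs fan_tris) ltac:(by vm_compute).
have regs_wheel5 := @regions_check 6 (sepb wheel5_pts wheel5_regs wheel5_tris) ltac:(by vm_compute).
have mult_wheel5 := @mult_check 6 2 1 (sepb wheel5_pts wheel5_regs wheel5_tris) ltac:(by vm_compute).
have regs_far := @regions_check 8 (sepb far_pts far_regs far_tris) ltac:(by vm_compute).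
have mult_far := @mult_check 8 2 1 (sepb far_pts far_regs far_tris) ltac:(by vm_compute).
have regs_near := @regions_check 7 (sepb near_pts near_regs near_tris) ltac:(by vm_compute).
have mult_near := @mult_check 7 2 2 (sepb near_pts near_regs near_tris) ltac:(by vm_compute).
(* The vertex 1 plays the role of [p]: it sees the regions in the two wheel faces at its side and
   the one in the triangle 1, 5, 6. *)
have mult_p : (\sum_(r < 5) ~~ sepb near_pts near_regs near_tris 1 (7 + r) <= 3)%N.
  by apply: (@mult_check 7 3 1 (sepb near_pts near_regs near_tris)); first by vm_compute.
have [h|[h|[h|h]]] := some_admissible sE hpE mE hn PR next_adj regs_fan mult_fan regs_wheel5 mult_wheel5
  regs_far mult_far regs_near mult_p mult_near ltac:(by vm_compute) ltac:(by vm_compute) ltac:(by vm_compute) ltac:(by vm_compute).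
- exact: admissible_saturated sE ok1 _ h.
- exact: admissible_saturated sE ok2 _ h.
- exact: admissible_saturated sE ok3 _ h.
- exact: admissible_saturated sE ok4 _ h.
Qed.
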